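(* Let $C$ be any tamely laced and indecomposable Cartan matrix such that the diagram $X'(C)$ is bipartite, and let $\ell\ge 2$ be an integer. Let $B$ be the skew-symmetric matrix corresponding to the quiver $Q_\ell(C)$ defined in the context. Then the ring $\mathcal{T}^{\circ}_{\ell}(C)_+$ is isomorphic to the T-subalgebra $\mathcal{A}_T(B,x)$, and the group $\mathcal{Y}^{\circ}_{\ell}(C)_+$ is isomorphic to the Y-subgroup $\mathcal{G}_Y(B,y)$.
   Context: **Cartan matrices.** $I=\{1,\dots,r\}$; $C=(C_{ij})_{i,j\in I}$ is an integer matrix with $C_{ii}=2$, $C_{ij}\le 0$ for $i\ne j$, $C_{ij}=0\iff C_{ji}=0$, and it is symmetrizable: there is $D=\mathrm{diag}(d_1,\dots,d_r)$, $d_i\in\mathbb{Z}_{>0}$, with $DC$ symmetric; the $d_i$ are taken without common divisor except 1. $C$ is *tamely laced* if moreover $C_{ij}<-1$ implies $d_i=-C_{ji}=1$. Write $a\sim b$ if $a\neq b$ and $C_{ab}<0$; $X(C)$ is the graph on $I$ with adjacency $\sim$ (the Dynkin diagram); $C$ is indecomposable if $X(C)$ is connected. If $a\sim b$ then $d_a=d_b$ or $\min(d_a,d_b)=1$. Put $t=\mathrm{lcm}(d_1,\dots,d_r)$, $t_a=t/d_a$, and $\mathcal{I}_\ell=\{(a,m,u)\mid a\in I,\ 1\le m\le t_a\ell-1,\ u\in\frac1t\mathbb{Z}\}$. **Even blocks, $X'(C)$.** An even block is a maximal connected full subdiagram of $X(C)$ all of whose vertices have $d_a$ even ($d_a$ is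 constant on it). $X'(C)$ is obtained from $X(C)$ by shrinking each even block to a single vertex, keeping all edges from the block to its outside. Bipartite means: no cycle of odd length. **T-system.** $\mathbb{T}_\ell(C)$ is the system of relations, for $(a,m,u)\in\mathcal{I}_\ell$, $$T^{(a)}_m(u-\tfrac{d_a}{t})T^{(a)}_m(u+\tfrac{d_a}{t})=T^{(a)}_{m-1}(u)T^{(a)}_{m+1}(u)+\begin{cases}\prod_{b\sim a}T^{(b)}_{d_am/d_b}(u)& d_a>1\\ \prod_{b\sim a}S^{(b)}_m(u)& d_a=1,\end{cases}$$ with $T^{(a)}_0(u)=T^{(a)}_{t_a\ell}(u)=1$, where for $m\ge0$, $0\le j<d_b$, $$S^{(b)}_{d_bm+j}(u)=\prod_{k=1}^{j}T^{(b)}_{m+1}(u+\tfrac{j+1-2k}{t})\ \prod_{k=1}^{d_b-j}T^{(b)}_m(u+\tfrac{d_b-j+1-2k}{t}).$$ $\mathcal{T}_\ell(C)$ is the commutative ring with generators $T^{(a)}_m(u)^{\pm1}$ ($(a,m,u)\in\mathcal{I}_\ell$) and relations $\mathbb{T}_\ell(C)$ (and $T^{(a)}_m(u)T^{(a)}_m(u)^{-1}=1$); $\mathcal{T}^\circ_\ell(C)$ is its subring generated by the $T^{(a)}_m(u)$. **Y-system.** A semifield is an abelian multiplicative group with a commutative, associative addition over which multiplication distributes. $\mathbb{Y}_\ell(C)$ is the system, for $(a,m,u)\in\mathcal{I}_\ell$, $$Y^{(a)}_m(u-\tfrac{d_a}{t})Y^{(a)}_m(u+\tfrac{d_a}{t})=\frac{N^{(a)}_m(u)}{(1+Y^{(a)}_{m-1}(u)^{-1})(1+Y^{(a)}_{m+1}(u)^{-1})},$$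 where $Y^{(a)}_0(u)^{-1}=Y^{(a)}_{t_a\ell}(u)^{-1}=0$ (the corresponding factor is 1); $N^{(a)}_m(u)=\prod_{b\sim a}Z^{(b)}_{d_a/d_b,m}(u)$ if $d_a>1$; $N^{(a)}_m(u)=\prod_{b\sim a,\ d_b\mid m}(1+Y^{(b)}_{m/d_b}(u))$ if $d_a=1$; and $Z^{(b)}_{p,m}(u)=\prod_{j=-p+1}^{p-1}\prod_{k=1}^{p-|j|}\bigl(1+Y^{(b)}_{pm+j}(u+\tfrac{p-|j|+1-2k}{t})\bigr)$. $\mathcal{Y}_\ell(C)$ is the semifield with generators $Y^{(a)}_m(u)$ and relations $\mathbb{Y}_\ell(C)$; $\mathcal{Y}^\circ_\ell(C)$ is the multiplicative subgroup generated by all $Y^{(a)}_m(u)$, $1+Y^{(a)}_m(u)$. **Parity.** Since $X'(C)$ is bipartite, there is a decomposition $I=I_+\sqcup I_-$ (fix one) such that for $a\sim b$: (I) if $d_a,d_b$ are both odd, $a$ and $b$ lie in different parts; (II) if at least one of $d_a,d_b$ is even, they lie in the same part. $\mathbf{Q}_+$ for $(a,m,u)$: $m+tu$ even if $d_a$ odd, $a\in I_+$; $m+tu$ odd if $d_a$ odd, $a\in I_-$; $tu$ even if $d_a$ even, $a\in I_+$; $tu$ odd if $d_a$ even, $a\in I_-$. $\mathbf{Q}'_+$: $(a,m,u)$ satisfies $\mathbf{Q}'_+$ iff $(a,m,u+\frac{d_a}{t})$ satisfies (the same parity requirements of) $\mathbf{Q}_+$. $\mathcal{T}^\circ_\ell(C)_+$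 is the subring of $\mathcal{T}^\circ_\ell(C)$ generated by $T^{(a)}_m(u)$ with $(a,m,u):\mathbf{Q}_+$; $\mathcal{Y}^\circ_\ell(C)_+$ is the subgroup of $\mathcal{Y}^\circ_\ell(C)$ generated by $Y^{(a)}_m(u)$, $1+Y^{(a)}_m(u)$ with $(a,m,u):\mathbf{Q}'_+$. **The diagram $\tilde X(C)$.** Replace each nonbipartite even block $Y$ of $X(C)$ by its bipartite double: each vertex $a$ of $Y$ is replaced by two vertices $a_+,a_-$; for $a,b\in Y$, $a_\varepsilon\sim b_{\varepsilon'}$ iff $a\sim b$ and $\varepsilon\ne\varepsilon'$; for $a\in Y$ and $b\notin Y$, $a_\pm\sim b$ iff $a\sim b$. All other vertices and adjacencies are unchanged. Let $J$ be the vertex set of $\tilde X(C)$; each $v\in J$ inherits $d_v$, $t_v$ and its part ($J=J_+\sqcup J_-$) from the underlying vertex of $I$. Fix a colour $c_v\in\{\alpha,\beta\}$ for each $v\in J$ with $d_v$ even such that adjacent coloured vertices have different colours. Put $N_v=\{1,3,\dots,d_v-1\}$ if $v$ comes from a nonbipartite even block, and $N_v=\{1,2,\dots,d_v\}$ otherwise. **The quiver $Q_\ell(C)$.** Vertex set $\mathbf{I}=\{(v,i,m)\mid v\in J,\ i\in N_v,\ 1\le m\le t_v\ell-1\}$. Each vertex $(v,i,m)$ has a sign, which is $+$ exactly when: $i+m$ is even, if ($d_v$ odd, $v\in J_+$) or ($d_v$ even, $c_v=\beta$); $i+m$ is odd, if ($d_v$ odd, $v\in J_-$) or ($d_v$ even,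 $c_v=\alpha$). Otherwise the sign is $-$. The arrows (all of multiplicity one) are: (A1) between $(v,i,m)$ and $(v,i,m\pm1)$ (which have opposite signs), from the $+$ vertex to the $-$ vertex; (A2) if $v\sim w$ and $d_v=d_w$: between $(v,i,m)$ and $(w,i,m)$ (which have opposite signs), from the $-$ vertex to the $+$ vertex; (A3) if $v\sim w$, $d:=d_v>1$, $d_w=1$: $(v,i,m)$ and $(w,1,k)$ are joined iff $|k-dm|\le\rho(v,i,m)$, and then the arrow is $(v,i,m)\to(w,1,k)$ if $(w,1,k)$ has sign $+$, and $(w,1,k)\to(v,i,m)$ if $(w,1,k)$ has sign $-$. Here, with $i^*=i+1$ for $i$ odd and $i^*=i-1$ for $i$ even, $\rho(v,i,m)$ is: – $d-i$ ($m$ odd), $i-1$ ($m$ even), if ($d$ odd, $v\in J_-$) or ($d$ even, $v\in J_+$, $c_v=\alpha$); – $i-1$ ($m$ odd), $d-i$ ($m$ even), if ($d$ odd, $v\in J_+$) or ($d$ even, $v\in J_+$, $c_v=\beta$); – $d-i^*$ ($m$ odd), $i^*-1$ ($m$ even), if $d$ even, $v\in J_-$, $c_v=\alpha$; – $i^*-1$ ($m$ odd), $d-i^*$ ($m$ even), if $d$ even, $v\in J_-$, $c_v=\beta$. $B=(B_{\mathbf{i}\mathbf{j}})$ is the skew-symmetric matrix with $B_{\mathbf{i}\mathbf{j}}=$ (number of arrows $\mathbf{i}\to\mathbf{j}$) $-$ (number of arrows $\mathbf{j}\to\mathbf{i}$). **Mutation sequence.** Let $\mathbf{I}^v_{\pm,i}$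 be the set of vertices $(v,i,m)$ of sign $\pm$ (empty if $i\notin N_v$). For $v\in J$, $d=d_v$, $k\in\mathbb{Z}$, define $M_v(k/t)\subset\mathbf{I}$: – $d$ odd, $p\in\{0,\dots,2d-1\}$, $p\equiv k$ mod $2d$: $M_v(k/t)=\mathbf{I}^v_{+,p+1}$ ($p<d$ even), $\mathbf{I}^v_{+,d-p}$ ($p<d$ odd), $\mathbf{I}^v_{-,2d-p}$ ($p\ge d$ even), $\mathbf{I}^v_{-,p+1-d}$ ($p\ge d$ odd); – $d$ even, with $p\in\{0,\dots,2d-1\}$, $p\equiv k$ mod $2d$ if $v\in J_+$, and $p\equiv k-1$ mod $2d$ if $v\in J_-$: $M_v(k/t)=\mathbf{I}^v_{+,p+1}\sqcup\mathbf{I}^v_{+,d-p}$ ($p<d$ even), $\mathbf{I}^v_{-,p+1-d}\sqcup\mathbf{I}^v_{-,2d-p}$ ($p\ge d$ even), $\emptyset$ ($p$ odd). Let $M(u)=\bigsqcup_vM_v(u)$ and let $\mu(u)$ be the composition of the mutations at all vertices of $M(u)$ (the order is immaterial). **Cluster algebra conventions.** $x=(x_{\mathbf i})$, $y=(y_{\mathbf i})$ are tuples of formal variables; $\mathbb{P}=\mathbb{Q}_{\mathrm{sf}}(y)$ is the universal semifield of subtraction-free rational functions in $y$, with addition $\oplus$ (also written $+$ in expressions $1+y$). The mutation at $k$ sends $(B',x',y')$ to $(B'',x'',y'')$, where $B''_{ij}=-B'_{ij}$ if $k\in\{i,j\}$ and $B''_{ij}=B'_{ij}+\frac12(|B'_{ik}|B'_{kj}+B'_{ik}|B'_{kj}|)$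 otherwise; $y''_k=y_k'^{-1}$, and for $i\ne k$, $y''_i=y'_i\bigl(\frac{y'_k}{1\oplus y'_k}\bigr)^{B'_{ki}}$ if $B'_{ki}\ge0$, $y''_i=y'_i(1\oplus y'_k)^{-B'_{ki}}$ if $B'_{ki}\le0$; $x''_i=x'_i$ for $i\neq k$ and $x''_k=\frac{y'_k\prod_{B'_{jk}>0}x_j'^{B'_{jk}}+\prod_{B'_{jk}<0}x_j'^{-B'_{jk}}}{(1\oplus y'_k)x'_k}$. Set $(B(0),x(0),y(0))=(B,x,y)$ and define $(B(u),x(u),y(u))$ for $u\in\frac1t\mathbb{Z}$ by $(B(u+\frac1t),x(u+\frac1t),y(u+\frac1t))=\mu(u)(B(u),x(u),y(u))$ (mutations are involutions, so this also defines negative $u$). $[x_{\mathbf i}(u)]_{\mathbf 1}$ is the trivial evaluation of $x_{\mathbf i}(u)$: the element of the cluster algebra $\mathcal{A}(B,x)$ with trivial coefficients obtained by the same mutations with all coefficients in the trivial semifield $\{1\}$. $\mathcal{A}_T(B,x)$ is the subring of $\mathcal{A}(B,x)$ generated by all $[x_{\mathbf i}(u)]_{\mathbf 1}$ ($\mathbf i\in\mathbf I$, $u\in\frac1t\mathbb{Z}$). $\mathcal{G}_Y(B,y)$ is the multiplicative subgroup of $\mathbb{P}$ generated by all $y_{\mathbf i}(u)$ ($\mathbf i\in\mathbf I,u\in\frac1t\mathbb{Z}$) and by $1+y_{\mathbf i}(u)$ for those $(\mathbf i,u)$ with $\mathbf i\in M(u)$ or $\mathbf i\in M(u-\frac1t)$.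 *)

(* Defs.v *)
From HB Require Import structures.
From mathcomp Require Import all_boot all_order all_algebra.
From mathcomp Require Import generic_quotient fraction.
From mathcomp.classical Require Import boolp.
From mathcomp.multinomials Require Import mpoly.

Set Implicit Arguments.
Unset Strict Implicit.
Unset Printing Implicit Defensive.

Import Order.TTheory GRing.Theory Num.Theory.

Local Open Scope quotient_scope.
Local Open Scope ring_scope.

HB.mixin Record Group_isSemifield P of Group P := {
  sadd : P -> P -> P;
  smulC : commutative (fun a b : P => (a * b)%g);
  saddC : commutative sadd;
  saddA : associative sadd;
  smulDr : forall a b c : P, (a * sadd b c)%g = sadd (a * b)%g (a * c)%g
}.

#[short(type="semifieldType")]
HB.structure Definition Semifield := {P of Group_isSemifield P & Group P}.

Variant triv_sf : Type := Triv.
HB.instance Definition _ := gen_eqMixin triv_sf.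
HB.instance Definition _ := gen_choiceMixin triv_sf.

Fact triv_mul1 : left_id Triv (fun _ _ => Triv). Proof. by case. Qed.
Fact triv_mul1r : right_id Triv (fun _ _ => Triv). Proof. by case. Qed.

HB.instance Definition _ := isGroup.Build triv_sf
  (inv := fun _ => Triv) (mul := fun _ _ => Triv)
  (fun _ _ _ => erefl) triv_mul1 triv_mul1r (fun _ => erefl) (fun _ => erefl).
HB.instance Definition _ := Group_isSemifield.Build triv_sf
  (sadd := fun _ _ => Triv)
  (fun _ _ => erefl) (fun _ _ => erefl) (fun _ _ _ => erefl)
  (fun _ _ _ => erefl).

Section PresentedRing.
Variable X : Type.

Inductive rterm : Type :=
  | RGen of X
  | RZero
  | ROne
  | ROpp of rterm
  | RAdd of rterm & rterm
  | RMul of rterm & rterm.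

HB.instance Definition _ := gen_eqMixin rterm.
HB.instance Definition _ := gen_choiceMixin rterm.

Variable E : rterm -> rterm -> Prop.

(* The smallest congruence containing E and the commutative ring axioms. *)
Inductive rcong : rterm -> rterm -> Prop :=
  | rcong_rel a b : E a b -> rcong a b
  | rcong_refl a : rcong a a
  | rcong_sym a b : rcong a b -> rcong b a
  | rcong_trans a b c : rcong a b -> rcong b c -> rcong a c
  | rcong_opp a a' : rcong a a' -> rcong (ROpp a) (ROpp a')
  | rcong_add a a' b b' :
      rcong a a' -> rcong b b' -> rcong (RAdd a b) (RAdd a' b')
  | rcong_mul a a' b b' :
      rcong a a' -> rcong b b' -> rcong (RMul a b) (RMul a' b')
  | rcong_addA a b c : rcong (RAdd a (RAdd b c)) (RAdd (RAdd a b) c)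
  | rcong_addC a b : rcong (RAdd a b) (RAdd b a)
  | rcong_add0 a : rcong (RAdd RZero a) a
  | rcong_addN a : rcong (RAdd (ROpp a) a) RZero
  | rcong_mulA a b c : rcong (RMul a (RMul b c)) (RMul (RMul a b) c)
  | rcong_mulC a b : rcong (RMul a b) (RMul b a)
  | rcong_mul1 a : rcong (RMul ROne a) a
  | rcong_mulDl a b c :
      rcong (RMul (RAdd a b) c) (RAdd (RMul a c) (RMul b c)).

Definition rcongb : rel rterm := fun a b => `[< rcong a b >].

Fact rcongb_refl : reflexive rcongb.
Proof. by move=> a; apply/asboolP; exact: rcong_refl. Qed.
Fact rcongb_sym : ssrbool.symmetric rcongb.
Proof. by move=> a b; apply/asboolP/asboolP; exact: rcong_sym. Qed.
Fact rcongb_trans : transitive rcongb.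
Proof.
move=> b a c /asboolP ab /asboolP bc; apply/asboolP; exact: rcong_trans ab bc.
Qed.

Canonical rcong_equiv := EquivRel rcongb rcongb_refl rcongb_sym rcongb_trans.

Definition pring : Type := {eq_quot rcongb}.
HB.instance Definition _ := Choice.on pring.
HB.instance Definition _ := EqQuotient.on pring.

Definition pr_class (a : rterm) : pring := \pi_pring a.

Fact pr_classP a b : pr_class a = pr_class b <-> rcong a b.
Proof. by split=> [/eqmodP /asboolP|ab]; last apply/eqmodP/asboolP. Qed.

Fact pr_reprK (x : pring) : pr_class (repr x) = x.
Proof. exact: reprK. Qed.

Fact pr_repr a : rcong (repr (pr_class a)) a.
Proof. by apply/pr_classP; rewrite pr_reprK. Qed.

Definition pr_zero : pring := pr_class RZero.
Definition pr_one : pring := pr_class ROne.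
Definition pr_opp (x : pring) : pring := pr_class (ROpp (repr x)).
Definition pr_add (x y : pring) : pring := pr_class (RAdd (repr x) (repr y)).
Definition pr_mul (x y : pring) : pring := pr_class (RMul (repr x) (repr y)).

Fact pr_addE a b : pr_add (pr_class a) (pr_class b) = pr_class (RAdd a b).
Proof. by apply/pr_classP/rcong_add; exact: pr_repr. Qed.
Fact pr_mulE a b : pr_mul (pr_class a) (pr_class b) = pr_class (RMul a b).
Proof. by apply/pr_classP/rcong_mul; exact: pr_repr. Qed.
Fact pr_oppE a : pr_opp (pr_class a) = pr_class (ROpp a).
Proof. by apply/pr_classP/rcong_opp; exact: pr_repr. Qed.

Fact pr_addA : associative pr_add.
Proof.
move=> x y z; rewrite -(pr_reprK x) -(pr_reprK y) -(pr_reprK z) !pr_addE.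
exact/pr_classP/rcong_addA.
Qed.
Fact pr_addC : commutative pr_add.
Proof.
move=> x y; rewrite -(pr_reprK x) -(pr_reprK y) !pr_addE.
exact/pr_classP/rcong_addC.
Qed.
Fact pr_add0 : left_id pr_zero pr_add.
Proof.
by move=> x; rewrite -(pr_reprK x) pr_addE; exact/pr_classP/rcong_add0.
Qed.
Fact pr_addN : left_inverse pr_zero pr_opp pr_add.
Proof.
move=> x; rewrite -(pr_reprK x) pr_oppE pr_addE.
exact/pr_classP/rcong_addN.
Qed.
Fact pr_mulA : associative pr_mul.
Proof.
move=> x y z; rewrite -(pr_reprK x) -(pr_reprK y) -(pr_reprK z) !pr_mulE.
exact/pr_classP/rcong_mulA.
Qed.
Fact pr_mulC : commutative pr_mul.
Proof.
move=> x y; rewrite -(pr_reprK x) -(pr_reprK y) !pr_mulE.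
exact/pr_classP/rcong_mulC.
Qed.
Fact pr_mul1 : left_id pr_one pr_mul.
Proof.
by move=> x; rewrite -(pr_reprK x) pr_mulE; exact/pr_classP/rcong_mul1.
Qed.
Fact pr_mulDl : left_distributive pr_mul pr_add.
Proof.
move=> x y z; rewrite -(pr_reprK x) -(pr_reprK y) -(pr_reprK z).
rewrite pr_addE !pr_mulE pr_addE; exact/pr_classP/rcong_mulDl.
Qed.

HB.instance Definition _ := GRing.isZmodule.Build pring
  pr_addA pr_addC pr_add0 pr_addN.
HB.instance Definition _ := GRing.Zmodule_isComPzRing.Build pring
  pr_mulA pr_mulC pr_mul1 pr_mulDl.

End PresentedRing.

Arguments RZero {X}.
Arguments ROne {X}.

Section PresentedSemifield.
Variable X : Type.

Inductive sterm : Type :=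
  | SGen of X
  | SOne
  | SInv of sterm
  | SMul of sterm & sterm
  | SAdd of sterm & sterm.

HB.instance Definition _ := gen_eqMixin sterm.
HB.instance Definition _ := gen_choiceMixin sterm.

Variable E : sterm -> sterm -> Prop.

(* The smallest congruence containing E and the semifield axioms. *)
Inductive scong : sterm -> sterm -> Prop :=
  | scong_rel a b : E a b -> scong a b
  | scong_refl a : scong a a
  | scong_sym a b : scong a b -> scong b a
  | scong_trans a b c : scong a b -> scong b c -> scong a c
  | scong_inv a a' : scong a a' -> scong (SInv a) (SInv a')
  | scong_mul a a' b b' :
      scong a a' -> scong b b' -> scong (SMul a b) (SMul a' b')
  | scong_add a a' b b' :
      scong a a' -> scong b b' -> scong (SAdd a b) (SAdd a' b')
  | scong_mulA a b c : scong (SMul a (SMul b c)) (SMul (SMul a b) c)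
  | scong_mulC a b : scong (SMul a b) (SMul b a)
  | scong_mul1 a : scong (SMul SOne a) a
  | scong_mulV a : scong (SMul (SInv a) a) SOne
  | scong_addA a b c : scong (SAdd a (SAdd b c)) (SAdd (SAdd a b) c)
  | scong_addC a b : scong (SAdd a b) (SAdd b a)
  | scong_mulDr a b c :
      scong (SMul a (SAdd b c)) (SAdd (SMul a b) (SMul a c)).

Definition scongb : rel sterm := fun a b => `[< scong a b >].

Fact scongb_refl : reflexive scongb.
Proof. by move=> a; apply/asboolP; exact: scong_refl. Qed.
Fact scongb_sym : ssrbool.symmetric scongb.
Proof. by move=> a b; apply/asboolP/asboolP; exact: scong_sym. Qed.
Fact scongb_trans : transitive scongb.
Proof.
move=> b a c /asboolP ab /asboolP bc; apply/asboolP; exact: scong_trans ab bc.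
Qed.

Canonical scong_equiv := EquivRel scongb scongb_refl scongb_sym scongb_trans.

Definition psemifield : Type := {eq_quot scongb}.
HB.instance Definition _ := Choice.on psemifield.
HB.instance Definition _ := EqQuotient.on psemifield.

Definition ps_class (a : sterm) : psemifield := \pi_psemifield a.

Fact ps_classP a b : ps_class a = ps_class b <-> scong a b.
Proof. by split=> [/eqmodP /asboolP|ab]; last apply/eqmodP/asboolP. Qed.

Fact ps_reprK (x : psemifield) : ps_class (repr x) = x.
Proof. exact: reprK. Qed.

Fact ps_repr a : scong (repr (ps_class a)) a.
Proof. by apply/ps_classP; rewrite ps_reprK. Qed.

Definition ps_one : psemifield := ps_class SOne.
Definition ps_inv (x : psemifield) : psemifield := ps_class (SInv (repr x)).
Definition ps_mul (x y : psemifield) : psemifield :=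
  ps_class (SMul (repr x) (repr y)).
Definition ps_add (x y : psemifield) : psemifield :=
  ps_class (SAdd (repr x) (repr y)).

Fact ps_addE a b : ps_add (ps_class a) (ps_class b) = ps_class (SAdd a b).
Proof. by apply/ps_classP/scong_add; exact: ps_repr. Qed.
Fact ps_mulE a b : ps_mul (ps_class a) (ps_class b) = ps_class (SMul a b).
Proof. by apply/ps_classP/scong_mul; exact: ps_repr. Qed.
Fact ps_invE a : ps_inv (ps_class a) = ps_class (SInv a).
Proof. by apply/ps_classP/scong_inv; exact: ps_repr. Qed.

Fact ps_mulA : associative ps_mul.
Proof.
move=> x y z; rewrite -(ps_reprK x) -(ps_reprK y) -(ps_reprK z) !ps_mulE.
exact/ps_classP/scong_mulA.
Qed.
Fact ps_mulC : commutative ps_mul.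
Proof.
move=> x y; rewrite -(ps_reprK x) -(ps_reprK y) !ps_mulE.
exact/ps_classP/scong_mulC.
Qed.
Fact ps_mul1 : left_id ps_one ps_mul.
Proof.
by move=> x; rewrite -(ps_reprK x) ps_mulE; exact/ps_classP/scong_mul1.
Qed.
Fact ps_mul1r : right_id ps_one ps_mul.
Proof. by move=> x; rewrite ps_mulC ps_mul1. Qed.
Fact ps_mulV : left_inverse ps_one ps_inv ps_mul.
Proof.
move=> x; rewrite -(ps_reprK x) ps_invE ps_mulE.
exact/ps_classP/scong_mulV.
Qed.
Fact ps_mulVr : right_inverse ps_one ps_inv ps_mul.
Proof. by move=> x; rewrite ps_mulC ps_mulV. Qed.

HB.instance Definition _ := isGroup.Build psemifield
  ps_mulA ps_mul1 ps_mul1r ps_mulV ps_mulVr.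

Fact ps_addA : associative ps_add.
Proof.
move=> x y z; rewrite -(ps_reprK x) -(ps_reprK y) -(ps_reprK z) !ps_addE.
exact/ps_classP/scong_addA.
Qed.
Fact ps_addC : commutative ps_add.
Proof.
move=> x y; rewrite -(ps_reprK x) -(ps_reprK y) !ps_addE.
exact/ps_classP/scong_addC.
Qed.
Fact ps_mulDr x y z : ps_mul x (ps_add y z) = ps_add (ps_mul x y) (ps_mul x z).
Proof.
rewrite -(ps_reprK x) -(ps_reprK y) -(ps_reprK z).
rewrite ps_addE !ps_mulE ps_addE; exact/ps_classP/scong_mulDr.
Qed.

HB.instance Definition _ := Group_isSemifield.Build psemifield
  ps_mulC ps_addC ps_addA ps_mulDr.

End PresentedSemifield.

Arguments SOne {X}.

Section GeneratedSubring.
Variables (R : comPzRingType) (G : R -> Prop).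

Inductive subring_gen : R -> Prop :=
  | subring_gen_in x : G x -> subring_gen x
  | subring_gen1 : subring_gen 1
  | subring_genB x y : subring_gen x -> subring_gen y -> subring_gen (x - y)
  | subring_genM x y : subring_gen x -> subring_gen y -> subring_gen (x * y).

Definition subring_pred : {pred R} := fun x => `[< subring_gen x >].

Fact subring_pred_closed : subring_closed subring_pred.
Proof.
split=> [|x y /asboolP gx /asboolP gy|x y /asboolP gx /asboolP gy].
- exact/asboolP/subring_gen1.
- exact/asboolP/subring_genB.
- exact/asboolP/subring_genM.
Qed.

Definition gen_subring : Type := {x : R | x \in subring_pred}.
HB.instance Definition _ := SubChoice.on gen_subring.
HB.instance Definition _ :=
  GRing.SubChoice_isSubComPzRing.Build R subring_pred gen_subring
    subring_pred_closed.

End GeneratedSubring.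

Section GeneratedSubgroup.
Variables (H : groupType) (G : H -> Prop).

Inductive subgroup_gen : H -> Prop :=
  | subgroup_gen_in x : G x -> subgroup_gen x
  | subgroup_gen1 : subgroup_gen 1%g
  | subgroup_genM x y :
      subgroup_gen x -> subgroup_gen y -> subgroup_gen (x * y)%g
  | subgroup_genV x : subgroup_gen x -> subgroup_gen (x^-1)%g.

Definition subgroup_pred : {pred H} := fun x => `[< subgroup_gen x >].

Fact subgroup_pred_closed : group_closed subgroup_pred.
Proof.
split=> [|x y /asboolP gx /asboolP gy]; first exact/asboolP/subgroup_gen1.
by apply/asboolP/subgroup_genM => //; exact: subgroup_genV.
Qed.

Definition gen_subgroup : Type := {x : H | x \in subgroup_pred}.
HB.instance Definition _ := SubChoice.on gen_subgroup.
HB.instance Definition _ := 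
  SubChoice_isSubGroup.Build H subgroup_pred gen_subgroup
    subgroup_pred_closed.

End GeneratedSubgroup.

Section Cartan.
Variables (r : nat) (C : 'M[int]_r) (d : 'I_r -> nat).

Definition gen_cartan : Prop :=
  [/\ forall i, C i i = 2,
      forall i j : 'I_r, i != j -> C i j <= 0 &
      forall i j, C i j = 0 <-> C j i = 0].

(* D = diag(d) has positive entries without common divisor, and DC is
   symmetric. *)
Definition symmetrizer : Prop :=
  [/\ forall i, (0 < d i)%N,
      forall i j, (d i)%:Z * C i j = (d j)%:Z * C j i &
      \big[gcdn/0%N]_i d i = 1%N].

Definition tamely_laced : Prop :=
  forall i j, C i j < -1 -> d i = 1%N /\ - C j i = 1.

Definition adj : rel 'I_r := fun a b => (a != b) && (C a b < 0).

Definition indecomposable : Prop := forall a b, connect adj a b.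

Definition bipartite (T : finType) (e : rel T) : Prop :=
  forall s : seq T, ucycle e s -> ~~ odd (size s).

Definition even_adj : rel 'I_r :=
  fun a b => [&& adj a b, ~~ odd (d a) & ~~ odd (d b)].

(* For d a even, the even block containing a. *)
Definition even_block (a : 'I_r) : {set 'I_r} := [set b | connect even_adj a b].

(* The vertex of X'(C) to which a is sent; vertices of X'(C) are represented
   by subsets of I, the vertices not in an even block by singletons. *)
Definition shrink (a : 'I_r) : {set 'I_r} :=
  if odd (d a) then [set a] else even_block a.

(* The adjacency of X'(C).  Parallel edges are identified, which does not
   matter for the existence of odd cycles. *)
Definition adj' : rel {set 'I_r} := fun P Q =>
  [exists a, exists b, [&& P == shrink a, Q == shrink b, P != Q & adj a b]].

Definition bipartite_X' : Prop := bipartite adj'.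

Definition nonbip (a : 'I_r) : bool :=
  ~~ odd (d a) &&
  ~~ `[< bipartite (fun x y => [&& x \in even_block a, y \in even_block a
                                 & adj x y]) >].

Definition lcmd : nat := \big[lcmn/1%N]_i d i.
Definition codeg (a : 'I_r) : nat := (lcmd %/ d a)%N.

(* Ip is the indicator of I_+. *)
Definition parity_decomposition (Ip : pred 'I_r) : Prop :=
  forall a b, adj a b ->
    if odd (d a) && odd (d b) then Ip a != Ip b else Ip a == Ip b.

End Cartan.

(* Throughout, an element u of (1/t)Z is represented by the integer k = tu. *)

Section TYsystems.
Variables (r : nat) (C : 'M[int]_r) (d : 'I_r -> nat) (ell : nat).
Variable Ip : pred 'I_r.

Local Notation t_ := (codeg d).

Definition in_range (a : 'I_r) (m : nat) : bool := (0 < m < t_ a * ell)%N.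

Definition Iell : Type :=
  {x : 'I_r * nat * int | in_range x.1.1 x.1.2}.

Definition Qplus (a : 'I_r) (m : nat) (k : int) : bool :=
  let s := if odd (d a) then m%:Z + k else k in
  odd `|s|%N == ~~ Ip a.

Definition Qplus' (a : 'I_r) (m : nat) (k : int) : bool :=
  Qplus a m (k + (d a)%:Z).

(* The generators T^{(a)}_m(u) and T^{(a)}_m(u)^{-1}. *)
Variant Tgen : Type := Tpos of Iell | Tneg of Iell.

(* T^{(a)}_m(u), including the convention T^{(a)}_0 = T^{(a)}_{t_a l} = 1; in
   the relations m never lies outside of 0, ..., t_a l. *)
Definition Tterm (a : 'I_r) (m : nat) (k : int) : rterm Tgen :=
  if insub (a, m, k) is Some g then RGen (Tpos g) else ROne.

Local Notation "\rprod_ ( i | P ) F" := (\big[@RMul Tgen/ROne]_(i | P) F)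
  (at level 36, F at level 36, i at level 50).
Local Notation "\rprod_ ( m <= i < n ) F" :=
  (\big[@RMul Tgen/ROne]_(m%N <= i < n%N) F)
  (at level 36, F at level 36, i, m, n at level 50).

(* S^{(b)}_n(u), with n = d_b m + j and 0 <= j < d_b. *)
Definition Sterm (b : 'I_r) (n : nat) (k : int) : rterm Tgen :=
  let m := (n %/ d b)%N in let j := (n %% d b)%N in
  RMul
    (\rprod_(1 <= i < j.+1) Tterm b m.+1 (k + j%:Z + 1 - 2 * i%:Z))
    (\rprod_(1 <= i < (d b - j).+1)
       Tterm b m (k + (d b)%:Z - j%:Z + 1 - 2 * i%:Z)).

Definition Trhs (a : 'I_r) (m : nat) (k : int) : rterm Tgen :=
  RAdd
    (RMul (Tterm a m.-1 k) (Tterm a m.+1 k))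
    (if (1 < d a)%N then \rprod_(b | adj C a b) Tterm b (d a * m %/ d b)%N k
     else \rprod_(b | adj C a b) Sterm b m k).

Inductive Trel : rterm Tgen -> rterm Tgen -> Prop :=
  | Trel_inv g : Trel (RMul (RGen (Tpos g)) (RGen (Tneg g))) ROne
  | Trel_sys a m (k : int) : in_range a m ->
      Trel (RMul (Tterm a m (k - (d a)%:Z)) (Tterm a m (k + (d a)%:Z)))
           (Trhs a m k).

Definition Tring : comPzRingType := pring Trel.

Definition Tvar (a : 'I_r) (m : nat) (k : int) : Tring :=
  pr_class Trel (Tterm a m k).

Definition Tcirc_plus : comPzRingType :=
  gen_subring (fun x : Tring =>
    exists a m k, [/\ in_range a m, Qplus a m k & x = Tvar a m k]).

(* Y^{(a)}_m(u); the value outside of the range is irrelevant. *)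
Definition Yterm (a : 'I_r) (m : nat) (k : int) : sterm Iell :=
  if insub (a, m, k) is Some g then SGen g else SOne.

(* 1 + Y^{(a)}_m(u)^{-1}, with Y^{(a)}_0(u)^{-1} = Y^{(a)}_{t_a l}(u)^{-1} = 0. *)
Definition Yden (a : 'I_r) (m : nat) (k : int) : sterm Iell :=
  if in_range a m then SAdd SOne (SInv (Yterm a m k)) else SOne.

Local Notation "\sprod_ ( i | P ) F" := (\big[@SMul Iell/SOne]_(i | P) F)
  (at level 36, F at level 36, i at level 50).
Local Notation "\sprod_ ( m <= i < n ) F" :=
  (\big[@SMul Iell/SOne]_(m%N <= i < n%N) F)
  (at level 36, F at level 36, i, m, n at level 50).

(* The index j, which runs from -p+1 to p-1, is written as i - (p - 1). *)
Definition Zterm (b : 'I_r) (p m : nat) (k : int) : sterm Iell :=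
  \sprod_(0 <= i < (2 * p).-1)
    (let j : int := i%:Z - p%:Z + 1 in
     \sprod_(1 <= q < (p - `|j|%N).+1)
       SAdd SOne (Yterm b `|(p%:Z * m%:Z + j)%R|%N
                          (k + p%:Z - `|j| + 1 - 2 * q%:Z))).

Definition Ynum (a : 'I_r) (m : nat) (k : int) : sterm Iell :=
  if (1 < d a)%N then \sprod_(b | adj C a b) Zterm b (d a %/ d b) m k
  else \sprod_(b | adj C a b && (d b %| m)%N)
         SAdd SOne (Yterm b (m %/ d b)%N k).

Inductive Yrel : sterm Iell -> sterm Iell -> Prop :=
  | Yrel_sys a m (k : int) : in_range a m ->
      Yrel (SMul (Yterm a m (k - (d a)%:Z)) (Yterm a m (k + (d a)%:Z)))
           (SMul (Ynum a m k) (SInv (SMul (Yden a m.-1 k) (Yden a m.+1 k)))).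

Definition Ysemifield : semifieldType := psemifield Yrel.

Definition Yvar (a : 'I_r) (m : nat) (k : int) : Ysemifield :=
  ps_class Yrel (Yterm a m k).

Definition Ycirc_plus : groupType :=
  gen_subgroup (fun x : Ysemifield =>
    exists a m k, [/\ in_range a m, Qplus' a m k &
      x = Yvar a m k \/ x = sadd 1%g (Yvar a m k)]).

End TYsystems.

Variant colour : Type := alpha | beta.

Section Quiver.
Variables (r : nat) (C : 'M[int]_r) (d : 'I_r -> nat).

(* The vertices of the diagram ~X(C).  A vertex a in a nonbipartite even block
   gives a_+ = (a, true) and a_- = (a, false); any other vertex a is represented
   by (a, true). *)
Definition J : Type := {v : 'I_r * bool | ~~ v.2 ==> nonbip C d v.1}.
HB.instance Definition _ := Finite.on J.

Definition base (v : J) : 'I_r := (val v).1.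
Definition eps (v : J) : bool := (val v).2.
Definition dJ (v : J) : nat := d (base v).
Definition tJ (v : J) : nat := codeg d (base v).
Definition doubled (v : J) : bool := nonbip C d (base v).

Definition adjJ : rel J := fun v w =>
  adj C (base v) (base w) &&
  (doubled v && (base w \in even_block C d (base v)) ==> (eps v != eps w)).

Definition proper_colouring (c : J -> colour) : Prop :=
  forall v w, ~~ odd (dJ v) -> ~~ odd (dJ w) -> adjJ v w -> c v <> c w.

Variables (ell : nat) (Ip : pred 'I_r) (c : J -> colour).

Definition inN (v : J) (i : nat) : bool :=
  if doubled v then odd i && (i <= (dJ v).-1)%N else (0 < i <= dJ v)%N.

(* The vertices (v, i, m) of the quiver; the bounds on the ordinals are not
   restrictive, since d_v and t_v divide t. *)
Definition QI : Type :=
  {x : J * 'I_(lcmd d).+1 * 'I_(lcmd d * ell).+1 |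
    inN x.1.1 x.1.2 && (0 < x.2 < tJ x.1.1 * ell)%N}.
HB.instance Definition _ := Finite.on QI.

Definition qv (x : QI) : J := (val x).1.1.
Definition qi (x : QI) : nat := (val x).1.2.
Definition qm (x : QI) : nat := (val x).2.

Definition inJp (v : J) : bool := Ip (base v).

(* true stands for the sign +. *)
Definition sgn (x : QI) : bool :=
  let v := qv x in
  if odd (dJ v) then odd (qi x + qm x) == ~~ inJp v
  else if c v is beta then ~~ odd (qi x + qm x) else odd (qi x + qm x).

Definition rho (x : QI) : nat :=
  let v := qv x in let i := qi x in let m := qm x in let d := dJ v in
  let i' := if odd i then i.+1 else i.-1 in
  let opt1 j := if odd m then (d - j)%N else j.-1 in
  let opt2 j := if odd m then j.-1 else (d - j)%N in
  if odd d then (if inJp v then opt2 i else opt1 i)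
  else match c v with
       | alpha => if inJp v then opt1 i else opt1 i'
       | beta => if inJp v then opt2 i else opt2 i'
       end.

Definition arrowA1 (x y : QI) : bool :=
  [&& qv x == qv y, qi x == qi y, (qm y == (qm x).+1) || (qm x == (qm y).+1),
      sgn x & ~~ sgn y].

Definition arrowA2 (x y : QI) : bool :=
  [&& adjJ (qv x) (qv y), dJ (qv x) == dJ (qv y), qi x == qi y, qm x == qm y,
      ~~ sgn x & sgn y].

Definition joinedA3 (x y : QI) : bool :=
  [&& adjJ (qv x) (qv y), (1 < dJ (qv x))%N, dJ (qv y) == 1%N &
      (`|(qm y)%:Z - (dJ (qv x) * qm x)%:Z| <= (rho x)%:Z)].

Definition arrowA3 (x y : QI) : bool :=
  (joinedA3 x y && sgn y) || (joinedA3 y x && ~~ sgn x).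

Definition arrow (x y : QI) : bool :=
  [|| arrowA1 x y, arrowA2 x y | arrowA3 x y].

Definition Bmat (x y : QI) : int := (arrow x y)%:Z - (arrow y x)%:Z.

Definition Ivset (v : J) (s : bool) (i : nat) : {set QI} :=
  [set x | [&& qv x == v, sgn x == s & qi x == i]].

Definition Mv (v : J) (k : int) : {set QI} :=
  let d := dJ v in
  if odd d then
    let p := `|(k %% (2 * d)%:Z)%Z|%N in
    if (p < d)%N then
      if odd p then Ivset v true (d - p) else Ivset v true p.+1
    else
      if odd p then Ivset v false (p.+1 - d) else Ivset v false (2 * d - p)
  else
    let k' : int := if inJp v then k else k - 1 in
    let p := `|(k' %% (2 * d)%:Z)%Z|%N in
    if odd p then set0
    else if (p < d)%N then Ivset v true p.+1 :|: Ivset v true (d - p)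
    else Ivset v false (p.+1 - d) :|: Ivset v false (2 * d - p).

Definition Mset (k : int) : {set QI} := \bigcup_v Mv v k.

End Quiver.

Section Mutation.
Variable I : finType.

Section Seeds.
Variables (P : semifieldType) (F : fieldType) (iota : P -> F).

Record yseed : Type := YSeed { yB : I -> I -> int; yy : I -> P }.
Record seed : Type := Seed { seed_y : yseed; seed_x : I -> F }.

Definition mutB (k : I) (B : I -> I -> int) (i j : I) : int :=
  if (i == k) || (j == k) then - B i j
  else B i j + ((`|B i k| * B k j + B i k * `|B k j|) %/ 2)%Z.

Definition muty (k : I) (B : I -> I -> int) (y : I -> P) (i : I) : P :=
  (if i == k then (y k)^-1
   else if 0 <= B k i then y i * (y k / sadd 1 (y k)) ^+ `|B k i|%N
   else y i * (sadd 1 (y k)) ^+ `|B k i|%N)%g.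

Definition mutx (k : I) (s : yseed) (x : I -> F) (i : I) : F :=
  if i == k then
    (iota (yy s k) * \prod_(j | 0 < yB s j k) x j ^+ `|yB s j k|%N
     + \prod_(j | yB s j k < 0) x j ^+ `|yB s j k|%N)
    / (iota (sadd 1%g (yy s k)) * x k)
  else x i.

Definition mutate_y (k : I) (s : yseed) : yseed :=
  YSeed (mutB k (yB s)) (muty k (yB s) (yy s)).

Definition mutate (k : I) (s : seed) : seed :=
  Seed (mutate_y k (seed_y s)) (mutx k (seed_y s) (seed_x s)).

End Seeds.

Section Evolution.
Variables (S : Type) (mu : I -> S -> S) (M : int -> {set I}) (s0 : S).

Definition mutate_seq (l : seq I) (s : S) : S := foldl (fun s' i => mu i s') s l.

Fixpoint forward (n : nat) : S :=
  if n is n'.+1 then mutate_seq (enum (M n'%:Z)) (forward n') else s0.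

(* The inverse of a composition of involutive mutations is the composition in
   the reverse order. *)
Fixpoint backward (n : nat) : S :=
  if n is n'.+1 then mutate_seq (rev (enum (M (- n%:Z)))) (backward n') else s0.

Definition evolve (k : int) : S :=
  match k with Posz n => forward n | Negz n => backward n.+1 end.

End Evolution.

End Mutation.

Section RationalFunctions.
Variable I : finType.

Definition ratfun : fieldType := {fraction {mpoly rat[#|I|]}}.

Definition ratvar (i : I) : ratfun := tofrac ('X_(enum_rank i)).

Inductive subfree : ratfun -> Prop :=
  | subfree_var i : subfree (ratvar i)
  | subfree1 : subfree 1
  | subfreeD f g : subfree f -> subfree g -> subfree (f + g)
  | subfreeM f g : subfree f -> subfree g -> subfree (f * g)
  | subfreeV f : subfree f -> subfree f^-1.

(* A subtraction-free rational function is a quotient of polynomials that are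
   positive at (1, ..., 1), hence is nonzero. *)
Fact subfree_pos f : subfree f ->
  exists p q : {mpoly rat[#|I|]},
    [/\ 0 < p.@[fun=> 1], 0 < q.@[fun=> 1] & f = tofrac p / tofrac q].
Proof.
have nz (p : {mpoly rat[#|I|]}) : 0 < p.@[fun=> 1] -> tofrac p != 0.
  by rewrite tofrac_eq0; apply: contraTneq => ->; rewrite meval0 ltxx.
elim=> {f} [i||f g _ [p [q [p0 q0 ->]]] _ [p' [q' [p'0 q'0 ->]]]
  |f g _ [p [q [p0 q0 ->]]] _ [p' [q' [p'0 q'0 ->]]]|f _ [p [q [p0 q0 ->]]]].
- by exists 'X_(enum_rank i), 1; rewrite mevalXU meval1 tofrac1 divr1.
- by exists 1, 1; rewrite meval1 tofrac1 divr1.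
- exists (p * q' + p' * q), (q * q'); rewrite mevalD !mevalM.
  rewrite addr_gt0 ?mulr_gt0 //; split=> //.
  by rewrite addf_div ?nz // tofracD !tofracM.
- exists (p * p'), (q * q'); rewrite !mevalM !mulr_gt0 //; split=> //.
  by rewrite mulf_div !tofracM.
- by exists q, p; rewrite invf_div.
Qed.

Fact subfree_neq0 f : subfree f -> f != 0.
Proof.
case/subfree_pos=> p [q [p0 q0 ->]]; rewrite mulf_neq0 // ?invr_eq0 tofrac_eq0.
  by apply: contraTneq p0 => ->; rewrite meval0 ltxx.
by apply: contraTneq q0 => ->; rewrite meval0 ltxx.
Qed.

Definition Qsf : Type := {f : ratfun | `[< subfree f >]}.
HB.instance Definition _ := Choice.on Qsf.

Fact Qsf_subfree (f : Qsf) : subfree (val f).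
Proof. exact/asboolP/(valP f). Qed.

Definition Qsf_of f (sf : subfree f) : Qsf := exist _ f (asboolT sf).

Definition Qsf_var (i : I) : Qsf := Qsf_of (subfree_var i).
Definition Qsf_one : Qsf := Qsf_of subfree1.
Definition Qsf_inv (f : Qsf) : Qsf := Qsf_of (subfreeV (Qsf_subfree f)).
Definition Qsf_mul (f g : Qsf) : Qsf :=
  Qsf_of (subfreeM (Qsf_subfree f) (Qsf_subfree g)).
Definition Qsf_add (f g : Qsf) : Qsf :=
  Qsf_of (subfreeD (Qsf_subfree f) (Qsf_subfree g)).

Fact Qsf_mulA : associative Qsf_mul.
Proof. by move=> f g h; apply: val_inj; exact: mulrA. Qed.
Fact Qsf_mulC : commutative Qsf_mul.
Proof. by move=> f g; apply: val_inj; exact: mulrC. Qed.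
Fact Qsf_mul1 : left_id Qsf_one Qsf_mul.
Proof. by move=> f; apply: val_inj; exact: mul1r. Qed.
Fact Qsf_mul1r : right_id Qsf_one Qsf_mul.
Proof. by move=> f; apply: val_inj; exact: mulr1. Qed.
Fact Qsf_mulV : left_inverse Qsf_one Qsf_inv Qsf_mul.
Proof.
by move=> f; apply: val_inj; exact/mulVf/subfree_neq0/Qsf_subfree.
Qed.
Fact Qsf_mulVr : right_inverse Qsf_one Qsf_inv Qsf_mul.
Proof. by move=> f; rewrite Qsf_mulC Qsf_mulV. Qed.

HB.instance Definition _ := isGroup.Build Qsf
  Qsf_mulA Qsf_mul1 Qsf_mul1r Qsf_mulV Qsf_mulVr.

Fact Qsf_addA : associative Qsf_add.
Proof. by move=> f g h; apply: val_inj; exact: addrA. Qed.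
Fact Qsf_addC : commutative Qsf_add.
Proof. by move=> f g; apply: val_inj; exact: addrC. Qed.
Fact Qsf_mulDr f g h :
  Qsf_mul f (Qsf_add g h) = Qsf_add (Qsf_mul f g) (Qsf_mul f h).
Proof. by apply: val_inj; exact: mulrDr. Qed.

HB.instance Definition _ := Group_isSemifield.Build Qsf
  Qsf_mulC Qsf_addC Qsf_addA Qsf_mulDr.

End RationalFunctions.

Section Cluster.
Variables (I : finType) (B : I -> I -> int) (M : int -> {set I}).

(* Trivial evaluation: the mutations are carried out over the semifield {1}. *)
Definition triv_x (i : I) (k : int) : ratfun I :=
  seed_x (evolve (mutate (fun _ : triv_sf => 1)) M
            (Seed (YSeed B (fun _ => Triv)) (@ratvar I)) k) i.

(* y_i(u); the mutation of (B, y) does not involve x. *)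
Definition coef_y (i : I) (k : int) : Qsf I :=
  yy (evolve (@mutate_y I (Qsf I)) M (YSeed B (@Qsf_var I)) k) i.

Definition A_T : comPzRingType :=
  gen_subring (fun f : ratfun I => exists i k, f = triv_x i k).

Definition G_Y : groupType :=
  gen_subgroup (fun g : Qsf I =>
    exists i k, g = coef_y i k \/
      (i \in M k \/ i \in M (k - 1)) /\ g = sadd 1%g (coef_y i k)).

End Cluster.

(* Main.v *)
(* The vertices of the quiver over a in I are reparametrized as triples (a, m, s),
   where s mod 2 d_a is the first time at which the vertex is mutated; these are
   exactly the classes satisfying Q'_+.  In the coordinates (a, m, time left until
   the next mutation) the quiver at time u does not depend on u, so that the
   exchange relations at the mutated vertices are the T-system and the
   y-mutations are the Y-system.
   The resulting maps are injective.  The T^{(a)}_m(u) and the x_i(u) are given by the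
   same fractions in the initial variables, with denominators that are units of the
   T-ring; an identity between such fractions in the rational functions is one
   between integer polynomials, hence holds in the T-ring.  On the Y-side, the
   universal property of Q_sf(y) gives a morphism to the Y-semifield sending each
   y_i(u) back to its Y-variable. *)
From HB Require Import structures.
Require Import Defs.
From mathcomp Require Import all_boot all_order all_algebra.
From mathcomp Require Import generic_quotient fraction.
From mathcomp.classical Require Import boolp.
From mathcomp.multinomials Require Import mpoly.
From mathcomp Require Import zify ring.

Set Implicit Arguments.
Unset Strict Implicit.
Unset Printing Implicit Defensive.

Import Order.TTheory GRing.Theory Num.Theory.

Local Open Scope quotient_scope.
Local Open Scope ring_scope.

(** * Presented rings and semifields *)

(** The relations run over all [u], while the quiver sees only one parity; yet a morphism out of the
    presented ring or semifield must respect every relation. All factors of a relation of the wrong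
    parity are of the wrong parity, and a shift of time by one unit exchanges the two parities, so a
    variable of the wrong parity can be given the value of the right one at the next time. An
    x-variable is constant between two mutations of its vertex and is dated by the midpoint of that
    interval, a y-variable by the mutation itself: this is the shift by [d a] between the two parity
    conditions. The time invariance of the quiver has one delicate case, an edge between [d > 1] and
    1, where the range of joined heights widens and narrows with the waiting time. For even [d],
    columns with [i] odd and [i] even share their mutation times and are told apart by the parity of
    the height; in a doubled block the copies [a_+] and [a_-], of opposite colours, take their
    place. On the ring side fractions are compared because no morphism from the field of rational
    functions back to the T-ring is available. *)

HB.instance Definition _ (P : semifieldType) :=
  Monoid.isComLaw.Build P 1%g *%g (@mulgA P) (@smulC P) (@mul1g P).

Section RingLift.
Variables (X : Type) (E : rterm X -> rterm X -> Prop) (R : comPzRingType).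
Variable g : X -> R.

Fixpoint reval (t : rterm X) : R :=
  match t with
  | RGen x => g x
  | RZero => 0
  | ROne => 1
  | ROpp t => - reval t
  | RAdd t t' => reval t + reval t'
  | RMul t t' => reval t * reval t'
  end.

Lemma reval_prod (J : Type) (s : seq J) (P : pred J) (F : J -> rterm X) :
  reval (\big[@RMul X/ROne]_(j <- s | P j) F j) = \prod_(j <- s | P j) reval (F j).
Proof. exact: (big_morph reval (id1 := 1) (op1 := *%R)). Qed.

Hypothesis gE : forall a b, E a b -> reval a = reval b.

Lemma reval_cong a b : rcong E a b -> reval a = reval b.
Proof.
elim=> //=; try by move=> *; congruence.
- by move=> *; exact: addrA.
- by move=> *; exact: addrC.
- by move=> *; exact: add0r.
- by move=> *; exact: addNr.
- by move=> *; exact: mulrA.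
- by move=> *; exact: mulrC.
- by move=> *; exact: mul1r.
- by move=> *; exact: mulrDl.
Qed.

Lemma pring_lift :
  exists f : {rmorphism pring E -> R}, forall t, f (pr_class E t) = reval t.
Proof.
pose f (x : pring E) := reval (repr x).
have fE t : f (pr_class E t) = reval t by apply/reval_cong/pr_repr.
have fB : zmod_morphism f.
  have eB a b : (pr_class E a : pring E) - pr_class E b
      = pr_class E (RAdd a (ROpp b)) by rewrite -pr_addE -pr_oppE.
  by move=> x y; rewrite -(pr_reprK x) -(pr_reprK y) eB !fE.
have fM : monoid_morphism f.
  split=> [|x y]; first by rewrite -[1]/(pr_class E ROne) fE.
  have eM a b : (pr_class E a : pring E) * pr_class E b = pr_class E (RMul a b).
    by rewrite -pr_mulE.
  by rewrite -(pr_reprK x) -(pr_reprK y) eM !fE.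
pose fa := GRing.isZmodMorphism.Build _ _ f fB.
pose fm := GRing.isMonoidMorphism.Build _ _ f fM.
pose F : {rmorphism pring E -> R} := HB.pack f fa fm.
by exists F.
Qed.

End RingLift.

(** Makes identities proved for [reval] under an arbitrary assignment applicable inside the
    presented ring itself, so that one computation of the exchange polynomials serves both rings. *)
Lemma pr_class_reval (X : Type) (E : rterm X -> rterm X -> Prop) t :
  pr_class E t = reval (fun x => pr_class E (RGen x)) t.
Proof.
elim: t => //= [t <-|t <- t' <-|t <- t' <-].
- by rewrite -pr_oppE.
- by rewrite -pr_addE.
- by rewrite -pr_mulE.
Qed.

Definition sfhom (P P' : semifieldType) (f : P -> P') : Prop :=
  {morph f : x y / (x * y)%g} /\ {morph f : x y / sadd x y}.

Section SemifieldMorphism.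
Variables (P P' : semifieldType) (f : P -> P').
Hypothesis fh : sfhom f.

Lemma sfhomM : {morph f : x y / (x * y)%g}. Proof. by case: fh. Qed.
Lemma sfhomD : {morph f : x y / sadd x y}. Proof. by case: fh. Qed.
Lemma sfhom1 : f 1%g = 1%g.
Proof. by apply: (mulgI (f 1%g)); rewrite -sfhomM !mulg1. Qed.
Lemma sfhomV : {morph f : x / (x^-1)%g}.
Proof. by move=> x; symmetry; apply: mulg1_eq; rewrite -sfhomM mulgV sfhom1. Qed.
Lemma sfhomX n : {morph f : x / (x ^+ n)%g}.
Proof. by move=> x; elim: n => [|n IH]; rewrite ?sfhom1 // !expgS sfhomM IH. Qed.
Lemma sfhom_prod (J : Type) (s : seq J) (Q : pred J) (F : J -> P) :
  f (\big[*%g/1%g]_(j <- s | Q j) F j) = \big[*%g/1%g]_(j <- s | Q j) f (F j).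
Proof. exact: (big_morph f sfhomM sfhom1). Qed.

End SemifieldMorphism.

Section SemifieldLift.
Variables (X : Type) (E : sterm X -> sterm X -> Prop) (P : semifieldType).
Variable g : X -> P.

Fixpoint seval (t : sterm X) : P :=
  match t with
  | SGen x => g x
  | SOne => 1%g
  | SInv t => ((seval t)^-1)%g
  | SMul t t' => (seval t * seval t')%g
  | SAdd t t' => sadd (seval t) (seval t')
  end.

Lemma seval_prod (J : Type) (s : seq J) (Q : pred J) (F : J -> sterm X) :
  seval (\big[@SMul X/SOne]_(j <- s | Q j) F j)
  = \big[*%g/1%g]_(j <- s | Q j) seval (F j).
Proof. exact: (big_morph seval (id1 := 1%g) (op1 := *%g)). Qed.

Hypothesis gE : forall a b, E a b -> seval a = seval b.

Lemma seval_cong a b : scong E a b -> seval a = seval b.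
Proof.
elim=> //=; try by move=> *; congruence.
- by move=> *; exact: mulgA.
- by move=> *; exact: smulC.
- by move=> *; exact: mul1g.
- by move=> *; exact: mulVg.
- by move=> *; exact: saddA.
- by move=> *; exact: saddC.
- by move=> *; exact: smulDr.
Qed.

Lemma psemifield_lift :
  exists2 f : psemifield E -> P, sfhom f & forall t, f (ps_class E t) = seval t.
Proof.
pose f (x : psemifield E) := seval (repr x).
have fE t : f (ps_class E t) = seval t by apply/seval_cong/ps_repr.
have eM a b : ((ps_class E a : psemifield E) * ps_class E b)%g
    = ps_class E (SMul a b) by rewrite -ps_mulE.
have eD a b : sadd (ps_class E a : psemifield E) (ps_class E b)
    = ps_class E (SAdd a b) by rewrite -ps_addE.
by exists f => //; split=> x y; rewrite -(ps_reprK x) -(ps_reprK y) ?eM ?eD !fE.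
Qed.

End SemifieldLift.

Lemma ps_class_seval (X : Type) (E : sterm X -> sterm X -> Prop) t :
  ps_class E t = seval (fun x => ps_class E (SGen x)) t.
Proof.
elim: t => //= [t <-|t <- t' <-|t <- t' <-].
- by rewrite -ps_invE.
- by rewrite -ps_mulE.
- by rewrite -ps_addE.
Qed.

(** * Universal property of the semifield of subtraction-free rational functions *)

Section UniversalSemifield.
Variables (I : finType) (P : semifieldType) (p : I -> P).

Let n := #|I|.

Let mon (m : 'X_{1..n}) : P := \big[*%g/1%g]_(i < n) (p (enum_val i) ^+ m i)%g.

Let monD m m' : mon (m + m')%MM = (mon m * mon m')%g.
Proof.
by rewrite /mon -big_split; apply: eq_bigr => i _; rewrite mnmDE expgnDr.
Qed.

(** A list of monomials stands for a polynomial with natural-number coefficients; [mpol] reads the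
    same list over the rationals. A semifield has no zero, hence the value [None] for the empty
    list. *)
Let osum (L : seq 'X_{1..n}) : option P :=
  \big[oAC (@saddA P) (@saddC P)/None]_(m <- L) Some (mon m).

Let mpol (L : seq 'X_{1..n}) : {mpoly rat[n]} := \sum_(m <- L) 'X_[m].

Let osum_cat L L' z z' : osum L = Some z -> osum L' = Some z' ->
  osum (L ++ L') = Some (sadd z z').
Proof. by move=> e e'; rewrite /osum big_cat -/(osum L) -/(osum L') e e'. Qed.

Let osum_shift m L z : osum L = Some z ->
  osum [seq (m + m')%MM | m' <- L] = Some (mon m * z)%g.
Proof.
move=> e; rewrite /osum big_map.
have -> : Some (mon m * z)%g = omap (fun t => (mon m * t)%g) (osum L) by rewrite e.
rewrite (big_morph (omap (fun t => (mon m * t)%g))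
  (id1 := None) (op1 := oAC (@saddA P) (@saddC P))) //=.
  by apply: eq_bigr => m' _; rewrite monD.
by case=> [a|] [b|] //=; rewrite !oACE /= smulDr.
Qed.

Let osum_mul L L' z z' : osum L = Some z -> osum L' = Some z' ->
  osum [seq (m + m')%MM | m <- L, m' <- L'] = Some (z * z')%g.
Proof.
move=> + e'; elim: L z => [|m L IH] z /=; first by rewrite /osum big_nil.
rewrite {1}/osum big_cons -/(osum L); case e: (osum L) => [w|] /= [<-].
  rewrite (osum_cat (osum_shift m e') (IH _ e)); congr Some.
  by rewrite ![(_ * z')%g]smulC smulDr.
(* Only the empty list has the value [None]. *)
have -> : L = [::].
  case: L e {IH} => // m' L; rewrite /osum big_cons.
  by case: (\big[_/_]_(_ <- _) _).
by rewrite /= cats0; exact: osum_shift.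
Qed.

Let mpol_cat L L' : mpol (L ++ L') = mpol L + mpol L'.
Proof. exact: big_cat. Qed.

Let mpol_mul L L' : mpol [seq (m + m')%MM | m <- L, m' <- L'] = mpol L * mpol L'.
Proof.
elim: L => [|m L IH] /=; first by rewrite /mpol big_nil mul0r.
rewrite mpol_cat IH /mpol big_cons mulrDl; congr (_ + _).
by rewrite big_map mulr_sumr; apply: eq_bigr => m' _; rewrite mpolyXD.
Qed.

Let mpol_coeff L m : (mpol L)@_m = (count_mem m L)%:R.
Proof.
rewrite /mpol raddf_sum -sum1_count natr_sum [RHS]big_mkcond /=.
by apply: eq_bigr => m' _; rewrite mcoeffX; case: eqP.
Qed.

(** Coefficients are multiplicities, so equal polynomials come from lists that are permutations of
    each other, and the sum in [P] does not depend on the order. *)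
Let mpol_inj L L' : mpol L = mpol L' -> osum L = osum L'.
Proof.
move=> e; apply: perm_big; apply/permP=> a.
suff /permP : perm_eq L L' by [].
apply/allP => m _; apply/eqP/(mulrIn (oner_neq0 rat)).
by rewrite -!mpol_coeff e.
Qed.

(** The same two lists represent the term in [P] and among the rational functions. Each operation on
    terms is the usual one on fractions and keeps both lists nonempty, as [Some] records. *)
Let fraction_form (t : sterm I) : exists N D zN zD,
  [/\ osum N = Some zN, osum D = Some zD, (seval p t * zD)%g = zN &
      val (seval (@Qsf_var I) t) * tofrac (mpol D) = tofrac (mpol N)].
Proof.
have o1 : osum [:: 0%MM] = Some 1%g.
  rewrite /osum big_seq1 /mon big1 // => i _.
  by rewrite mnm0E.
have m1 : mpol [:: 0%MM] = 1 by rewrite /mpol big_seq1 mpolyX0.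
elim: t => [i||t [N [D [zN [zD [eN eD e e']]]]]
  |t [N [D [zN [zD [eN eD e e']]]]] s [M [F [zM [zF [eM eF h h']]]]]
  |t [N [D [zN [zD [eN eD e e']]]]] s [M [F [zM [zF [eM eF h h']]]]]] /=.
- exists [:: U_(enum_rank i)]%MM, [:: 0%MM], (p i), 1%g; split=> //.
  + rewrite /osum big_seq1 /mon (bigD1 (enum_rank i)) //= big1 ?mulg1.
      by rewrite mnm1E eqxx enum_rankK.
    by move=> j ji; rewrite mnm1E eq_sym (negbTE ji).
  + by rewrite mulg1.
  + by rewrite m1 tofrac1 mulr1 /mpol big_seq1.
- exists [:: 0%MM], [:: 0%MM], 1%g, 1%g; split=> //; first by rewrite mulg1.
  by rewrite mul1r.
- exists D, N, zD, zN; split=> //; first by rewrite -e mulKg.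
  by rewrite -e' mulrA mulVf ?mul1r //; exact/subfree_neq0/Qsf_subfree.
- exists [seq (m + m')%MM | m <- N, m' <- M], [seq (m + m')%MM | m <- D, m' <- F].
  exists (zN * zM)%g, (zD * zF)%g; rewrite (osum_mul eN eM) (osum_mul eD eF).
  split=> //; last by rewrite !mpol_mul !tofracM mulrACA e' h'.
  by rewrite -e -h -!mulgA; congr (_ * _)%g; rewrite !mulgA [(_ * zD)%g]smulC.
exists ([seq (m + m')%MM | m <- N, m' <- F] ++ [seq (m + m')%MM | m <- D, m' <- M]).
exists [seq (m + m')%MM | m <- D, m' <- F].
exists (sadd (zN * zF) (zD * zM))%g, (zD * zF)%g; split.
- by apply: osum_cat; exact: osum_mul.
- exact: osum_mul.
- rewrite -e -h smulC smulDr; congr sadd; first by rewrite smulC mulgA.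
  by rewrite -!mulgA; congr (_ * _)%g; exact: smulC.
- rewrite mpol_cat !mpol_mul tofracD !tofracM -e' -h' mulrDl.
  by congr (_ + _); [exact: mulrA | exact: mulrCA].
Qed.

Let seval_Qsf_inj t t' :
  seval (@Qsf_var I) t = seval (@Qsf_var I) t' -> seval p t = seval p t'.
Proof.
have [N [D [zN [zD [eN eD e e']]]]] := fraction_form t.
have [M [F [zM [zF [eM eF h h']]]]] := fraction_form t'.
move=> E; rewrite {}E in e'.
have : mpol [seq (m + m')%MM | m <- N, m' <- F]
     = mpol [seq (m + m')%MM | m <- M, m' <- D].
  apply/eqP; rewrite -tofrac_eq !mpol_mul !tofracM -e' -h'; apply/eqP; ring.
move/mpol_inj; rewrite (osum_mul eN eF) (osum_mul eM eD) => -[].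
rewrite -e -h -!mulgA [(zD * _)%g]smulC => /mulIg; exact.
Qed.

(** The equality is boolean so that [xchoose] can select a term for every function. *)
Let seval_Qsf_surj (f : Qsf I) : exists t, seval (@Qsf_var I) t == f.
Proof.
have E (h : Qsf I) t : val (seval (@Qsf_var I) t) = val h ->
    seval (@Qsf_var I) t == h by move=> e; apply/eqP/val_inj.
suff [t /E] : exists t, val (seval (@Qsf_var I) t) = val f by exists t.
elim: (Qsf_subfree f) => {f} [i||f g _ [t <-] _ [t' <-]|f g _ [t <-] _ [t' <-]
  |f _ [t <-]].
- by exists (SGen i).
- by exists SOne.
- by exists (SAdd t t').
- by exists (SMul t t').
- by exists (SInv t).
Qed.

(* Clearing denominators, an equality between subtraction-free expressions in
   rational functions becomes one between polynomials with coefficients in the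
   natural numbers, which holds in every semifield. *)
Lemma Qsf_lift :
  exists2 f : Qsf I -> P, sfhom f & forall i, f (Qsf_var i) = p i.
Proof.
pose t f := xchoose (seval_Qsf_surj f).
have tP f : seval (@Qsf_var I) (t f) = f := eqP (xchooseP (seval_Qsf_surj f)).
exists (fun f => seval p (t f)).
  split=> f g.
    by rewrite -[RHS]/(seval p (SMul _ _)); apply: seval_Qsf_inj; rewrite /= !tP.
  by rewrite -[RHS]/(seval p (SAdd _ _)); apply: seval_Qsf_inj; rewrite /= !tP.
move=> i; rewrite -[RHS]/(seval p (SGen i)); apply: seval_Qsf_inj.
by rewrite /= tP.
Qed.

End UniversalSemifield.

(** * Fractions *)

Lemma reval_rmorph (X : Type) (R S : comPzRingType) (f : {rmorphism R -> S})
    (g : X -> R) (h : X -> S) (t : rterm X) :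
  (forall x, f (g x) = h x) -> f (reval g t) = reval h t.
Proof.
move=> fg; elim: t => //= [||t <-|t <- t' <-|t <- t' <-].
- exact: rmorph0.
- exact: rmorph1.
- exact: rmorphN.
- exact: rmorphD.
- exact: rmorphM.
Qed.

Lemma reval_ratvar_eq0 (I : finType) (R : comPzRingType) (z : I -> R)
    (t : rterm I) :
  reval (@ratvar I) t = 0 -> reval z t = 0.
Proof.
(* [R] may be the zero ring, where the claim is trivial; the evaluation of integer polynomials below
   takes place in a nonzero ring. *)
have [R10|R10] := eqVneq (1 : R) 0; first by rewrite -[reval z t]mulr1 R10 mulr0.
pose mix := GRing.PzSemiRing_isNonZero.Build R R10.
pose S : comNzRingType := HB.pack R mix.
pose M := reval (fun i : I => 'X_(enum_rank i) : {mpoly int[#|I|]}) t.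
have -> : reval (@ratvar I) t = tofrac (map_mpoly intr M).
  pose f : {rmorphism {mpoly int[#|I|]} -> ratfun I} :=
    (@tofrac _ : {rmorphism {mpoly rat[#|I|]} -> ratfun I})
    \o map_mpoly (intr : {rmorphism int -> rat}).
  rewrite -(@reval_rmorph _ _ _ f (fun i => 'X_(enum_rank i))) // => i.
  by rewrite /f /= map_mpolyX.
move/eqP; rewrite tofrac_eq0 => /eqP M0.
have {}M0 : M = 0.
  apply/mpolyP => m; rewrite mcoeff0; apply: (intr_inj (R := rat)).
  by rewrite -mcoeff_map_mpoly M0 mcoeff0.
pose h (i : 'I_#|I|) : S := z (enum_val i).
pose g : {rmorphism {mpoly int[#|I|]} -> S} := mmap (intr : {rmorphism int -> S}) h.
have -> : reval z t = g M.
  rewrite /M (@reval_rmorph _ _ _ g _ z) // => i.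
  by rewrite /g /= mmapX mmap1U /h enum_rankK.
by rewrite M0 rmorph0.
Qed.

Section Fractions.
Variables (I : Type) (R : comPzRingType) (z : I -> R) (F : fieldType) (x : I -> F).

(* The element a of R and the element w of F are given by the same fraction
   in the z i and in the x i. *)
Definition same_fraction (a : R) (w : F) : Prop :=
  exists p q : rterm I, [/\ exists u, u * reval z q = 1,
    reval x q != 0, a * reval z q = reval z p &
    w * reval x q = reval x p].

Lemma same_fraction_var i : same_fraction (z i) (x i).
Proof.
exists (RGen i), ROne; split=> //=; rewrite ?mulr1 ?oner_eq0 //.
by exists 1; rewrite mulr1.
Qed.

Lemma same_fraction1 : same_fraction 1 1.
Proof.
exists ROne, ROne; split=> //=; rewrite ?mulr1 ?oner_eq0 //.
by exists 1; rewrite mulr1.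
Qed.

Lemma same_fractionM a w b v :
  same_fraction a w -> same_fraction b v -> same_fraction (a * b) (w * v).
Proof.
move=> [p [q [[u uG] nG aG wG]]] [p' [q' [[u' uG'] nG' bG' vG']]].
exists (RMul p p'), (RMul q q'); split=> /=.
- by exists (u * u'); rewrite mulrACA uG uG' mulr1.
- exact: mulf_neq0.
- by rewrite mulrACA aG bG'.
- by rewrite mulrACA wG vG'.
Qed.

Lemma same_fractionB a w b v :
  same_fraction a w -> same_fraction b v -> same_fraction (a - b) (w - v).
Proof.
move=> [p [q [[u uG] nG aG wG]]] [p' [q' [[u' uG'] nG' bG' vG']]].
have key (K : comPzRingType) (s t g g' f f' : K) :
    s * g = f -> t * g' = f' -> (s - t) * (g * g') = f * g' + - (f' * g).
  by move=> <- <-; ring.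
exists (RAdd (RMul p q') (ROpp (RMul p' q))), (RMul q q'); split=> /=.
- by exists (u * u'); rewrite mulrACA uG uG' mulr1.
- exact: mulf_neq0.
- exact: key.
- exact: key.
Qed.

Lemma same_fractionD a w b v :
  same_fraction a w -> same_fraction b v -> same_fraction (a + b) (w + v).
Proof.
move=> sa sb; have s0 : same_fraction 0 0.
  by rewrite -[0](subrr 1) -[X in same_fraction _ X](subrr 1);
     apply: same_fractionB; exact: same_fraction1.
rewrite -[b]opprK -[v]opprK; apply: same_fractionB => //.
by rewrite -[- b]add0r -[- v]add0r; exact: same_fractionB.
Qed.

Lemma same_fraction_prod (J : Type) (s : seq J) (Q : pred J) (G : J -> R) H :
  (forall j, Q j -> same_fraction (G j) (H j)) ->
  same_fraction (\prod_(j <- s | Q j) G j) (\prod_(j <- s | Q j) H j).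
Proof.
move=> GH; elim/big_ind2: _ => //; first exact: same_fraction1.
by move=> *; exact: same_fractionM.
Qed.

(** Inversion swaps numerator and denominator, so the numerator must become invertible in [R], by
    [b * a = 1], and nonzero in [F], by [w != 0]. *)
Lemma same_fractionV a b w :
  b * a = 1 -> w != 0 -> same_fraction a w -> same_fraction b w^-1.
Proof.
move=> ba w0 [p [q [[u uG] nG aG wG]]].
exists q, p; split.
- exists (u * b); rewrite -aG; transitivity ((b * a) * (u * reval z q)).
    by ring.
  by rewrite ba uG mulr1.
- by rewrite -wG mulf_neq0.
- by rewrite -aG mulrA ba mul1r.
- by rewrite -wG mulKf.
Qed.

Hypothesis reval_eq0 : forall t, reval x t = 0 -> reval z t = 0.

Lemma same_fraction_eq0 a : same_fraction a 0 -> a = 0.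
Proof.
case=> p [q [[u uG] nG aG]]; rewrite mul0r => /esym /reval_eq0 F0.
by rewrite -[a]mulr1 -uG mulrCA aG F0 mulr0.
Qed.

End Fractions.

(** Injectivity is only asked on the generated subring: on the whole T-ring the morphism used later
    gives a variable of the wrong parity the value of one of the right parity. *)
Lemma gen_subring_iso (R S : comPzRingType) (G : R -> Prop) (G' : S -> Prop)
    (f : {rmorphism R -> S}) :
  (forall x, G x -> subring_gen G' (f x)) ->
  (forall y, G' y -> exists2 x, subring_gen G x & f x = y) ->
  (forall x, subring_gen G x -> f x = 0 -> x = 0) ->
  exists h : {rmorphism gen_subring G -> gen_subring G'}, bijective h.
Proof.
move=> Gf fG f0.
have fS x : subring_gen G x -> subring_gen G' (f x).
  elim=> [y /Gf //||y z _ yG _ zG|y z _ yG _ zG].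
  - by rewrite rmorph1; exact: subring_gen1.
  - by rewrite rmorphB; exact: subring_genB.
  - by rewrite rmorphM; exact: subring_genM.
have fP (x : gen_subring G) : f (val x) \in subring_pred G'.
  by apply/asboolP/fS; exact/asboolP/(valP x).
have lift y : subring_gen G' y -> exists2 x, subring_gen G x & f x = y.
  elim=> [z /fG //||z w _ [x xG <-] _ [x' x'G <-]|z w _ [x xG <-] _ [x' x'G <-]].
  - by exists 1; [exact: subring_gen1 | rewrite rmorph1].
  - by exists (x - x'); [exact: subring_genB | rewrite rmorphB].
  - by exists (x * x'); [exact: subring_genM | rewrite rmorphM].
pose h (x : gen_subring G) : gen_subring G' := exist _ (f (val x)) (fP x).
have hB : zmod_morphism h by move=> x y; apply: val_inj; exact: (rmorphB f (val x) (val y)).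
have hM : monoid_morphism h.
  split=> [|x y]; apply: val_inj; first exact: (rmorph1 f).
  exact: (rmorphM f (val x) (val y)).
pose ha := GRing.isZmodMorphism.Build _ _ h hB.
pose hm := GRing.isMonoidMorphism.Build _ _ h hM.
pose H : {rmorphism gen_subring G -> gen_subring G'} := HB.pack h ha hm.
have inv (y : gen_subring G') : exists x, H x = y.
  have [x xG fx] := lift _ (asboolW (valP y)).
  by exists (exist _ x (asboolT xG)); apply: val_inj.
(* [k] is a mere choice of preimages; injectivity on the subring, applied to a difference, makes it
   a two-sided inverse. *)
have [k kP] := choice inv.
exists H, k => // x.
have /(congr1 val) e : H (k (H x)) = H x := kP (H x).
have xG : subring_gen G (val x) by exact/asboolP/(valP x).
have kG : subring_gen G (val (k (H x))) by exact/asboolP/(valP (k (H x))).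
apply/val_inj/subr0_eq/f0; first exact: subring_genB.
by rewrite rmorphB; apply/eqP; rewrite subr_eq0; apply/eqP.
Qed.

Lemma gen_subgroup_iso (H K : groupType) (G : H -> Prop) (G' : K -> Prop)
    (f : H -> K) (k : K -> H) :
  {morph f : x y / (x * y)%g} -> {morph f : x / (x^-1)%g} -> f 1%g = 1%g ->
  {morph k : x y / (x * y)%g} -> {morph k : x / (x^-1)%g} -> k 1%g = 1%g ->
  (forall x, G x -> subgroup_gen G' (f x)) ->
  (forall y, G' y -> exists2 x, subgroup_gen G x & f x = y) ->
  (forall x, G x -> k (f x) = x) ->
  exists h : {multiplicative gen_subgroup G -> gen_subgroup G'}, bijective h.
Proof.
move=> fM fV f1 kM kV k1 Gf fG kf.
have fS x : subgroup_gen G x -> subgroup_gen G' (f x).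
  elim=> [y /Gf //||y z _ yG _ zG|y _ yG].
  - by rewrite f1; exact: subgroup_gen1.
  - by rewrite fM; exact: subgroup_genM.
  - by rewrite fV; exact: subgroup_genV.
have kS x : subgroup_gen G x -> k (f x) = x.
  elim=> [y /kf //||y z _ yG _ zG|y _ yG]; first by rewrite f1 k1.
    by rewrite fM kM yG zG.
  by rewrite fV kV yG.
have lift y : subgroup_gen G' y -> exists2 x, subgroup_gen G x & f x = y.
  elim=> [z /fG //||z w _ [x xG <-] _ [x' x'G <-]|z _ [x xG <-]].
  - by exists 1%g; [exact: subgroup_gen1 | rewrite f1].
  - by exists (x * x')%g; [exact: subgroup_genM | rewrite fM].
  - by exists (x^-1)%g; [exact: subgroup_genV | rewrite fV].
have fP (x : gen_subgroup G) : f (val x) \in subgroup_pred G'.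
  by apply/asboolP/fS; exact/asboolP/(valP x).
have kP (y : gen_subgroup G') : k (val y) \in subgroup_pred G.
  have [x xG fx] := lift _ (asboolW (valP y)).
  by apply/asboolP; rewrite -fx kS.
pose h (x : gen_subgroup G) : gen_subgroup G' := exist _ (f (val x)) (fP x).
have hM : {morph h : x y / (x * y)%g} by move=> x y; apply: val_inj; exact: fM.
pose hm := isMultiplicative.Build _ _ h hM.
pose h' : {multiplicative gen_subgroup G -> gen_subgroup G'} := HB.pack h hm.
exists h', (fun y => exist _ (k (val y)) (kP y)) => [x|y]; apply: val_inj => /=.
  by apply: kS; exact/asboolP/(valP x).
by have [x xG <-] := lift _ (asboolW (valP y)); rewrite kS.
Qed.

(** * Simultaneous mutations *)

Section CompositeMutation.
Variable I : finType.
Implicit Types (A : {set I}) (B : I -> I -> int).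

Definition independent A B : Prop := {in A &, forall i j, B i j = 0}.

Definition mutB_set A B (i j : I) : int :=
  if (i \in A) || (j \in A) then - B i j
  else B i j + \sum_(k in A) ((`|B i k| * B k j + B i k * `|B k j|) %/ 2)%Z.

Definition y_factor (P : semifieldType) (b : int) (y : P) : P :=
  if 0 <= b then ((y / sadd 1 y) ^+ `|b|%N)%g else (sadd 1 y ^+ `|b|%N)%g.

Definition muty_set (P : semifieldType) A B (y : I -> P) (i : I) : P :=
  if i \in A then ((y i)^-1)%g
  else (y i * \big[*%g/1%g]_(k in A) y_factor (B k i) (y k))%g.

Definition exchange (F : comPzRingType) B (x : I -> F) (i : I) : F :=
  \prod_(j | 0 < B j i) x j ^+ `|B j i|%N
  + \prod_(j | B j i < 0) x j ^+ `|B j i|%N.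

Definition mutx_set (F : fieldType) A B (x : I -> F) (i : I) : F :=
  if i \in A then exchange B x i / x i else x i.

Lemma y_factor0 (P : semifieldType) (y : P) : y_factor 0 y = 1%g.
Proof. by []. Qed.

(** The involutivity of a y-mutation seen from a neighbour: after the first mutation the matrix
    entry has changed sign and [y] is inverted. *)
Lemma y_factorN (P : semifieldType) (b : int) (y : P) :
  (y_factor b y * y_factor (- b) y^-1)%g = 1%g.
Proof.
have e : sadd 1%g (y^-1)%g = (sadd 1 y / y)%g.
  by rewrite smulC smulDr mulg1 mulVg saddC.
have inv z n : ((z ^+ n) * (z^-1) ^+ n)%g = 1%g :> P.
  by rewrite expVgn mulgV.
rewrite /y_factor abszN; case: ltrgt0P => [b0|b0|->].
- by rewrite oppr_ge0 leNgt b0 /= e -[(sadd 1 y / y)%g]invgF inv.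
- by rewrite oppr_ge0 (ltW b0) /= e invgF mulgA mulVg mul1g inv.
- by rewrite oppr0 lexx /= mulg1.
Qed.

Section Independent.
Variables (A : {set I}) (B : I -> I -> int).
Hypothesis indA : independent A B.

Lemma mutB_setN i j : (i \in A) || (j \in A) -> mutB_set A B i j = - B i j.
Proof. by rewrite /mutB_set => ->. Qed.

Lemma mutB_set_independent : independent A (mutB_set A B).
Proof. by move=> i j iA jA; rewrite mutB_setN ?iA // indA // oppr0. Qed.

Lemma mutB_setK i j : mutB_set A (mutB_set A B) i j = B i j.
Proof.
rewrite {1}/mutB_set; case: ifP => [ijA|/negbT]; first by rewrite mutB_setN // opprK.
rewrite negb_or => /andP [niA njA].
rewrite {1}/mutB_set (negbTE niA) (negbTE njA) /= -addrA -big_split /= big1 ?addr0 //.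
move=> k kA; rewrite !mutB_setN ?kA ?orbT // !normrN.
(* |a|b + a|b| is 0 or twice a product, so the division by 2 is exact and the correction changes
   sign with both entries. *)
by case: (leP 0 (B i k)) => ?; case: (leP 0 (B k j)) => ?; lia.
Qed.

Lemma muty_setK (P : semifieldType) (y : I -> P) i :
  muty_set A (mutB_set A B) (muty_set A B y) i = y i.
Proof.
rewrite {1}/muty_set; case: ifP => iA; first by rewrite /muty_set iA invgK.
rewrite {1}/muty_set iA -mulgA -big_split big1 ?mulg1 // => k kA /=.
by rewrite mutB_setN ?kA // /muty_set kA y_factorN.
Qed.

Lemma mutx_setK (F : fieldType) (x : I -> F) i :
  (forall j, x j != 0) -> (i \in A -> exchange B x i != 0) ->
  mutx_set A (mutB_set A B) (mutx_set A B x) i = x i.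
Proof.
move=> x0; rewrite {1}/mutx_set; case: ifP => iA; last by rewrite /mutx_set iA.
move=> /(_ isT) e0; rewrite [X in _ / X]/mutx_set iA.
suff -> : exchange (mutB_set A B) (mutx_set A B x) i = exchange B x i.
  by rewrite invf_div mulrA mulrC mulrA mulVf ?mul1r.
(* By independence no variable occurring in the exchange polynomial at [i] has been altered; the
   sign change of the column only swaps its two monomials. *)
have xE j : B j i != 0 -> mutx_set A B x j = x j.
  by rewrite /mutx_set; case: ifP => // jA; rewrite indA ?eqxx.
rewrite /exchange addrC; congr (_ + _).
  apply: eq_big => [j|j]; rewrite mutB_setN ?iA ?orbT // ?oppr_lt0 //.
  by move=> Bji; rewrite abszN xE // gt_eqF.
apply: eq_big => [j|j]; rewrite mutB_setN ?iA ?orbT // ?oppr_gt0 //.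
by move=> Bji; rewrite abszN xE // lt_eqF.
Qed.

End Independent.

(** The vertices of [l] are pairwise not joined. When the last one is mutated, its row, its column
    and its [y] are therefore still the initial ones, and all corrections are read off the initial
    seed. *)
Lemma mutate_seq_y (P : semifieldType) (l : seq I) B (y : I -> P) :
  uniq l -> independent [set k in l] B ->
  mutate_seq (@mutate_y I P) l (YSeed B y)
  = YSeed (mutB_set [set k in l] B) (muty_set [set k in l] B y).
Proof.
elim/last_ind: l => [_ _|l k IH].
  rewrite /=; congr YSeed; apply/funext => i; rewrite ?/muty_set ?inE /=.
    by apply/funext=> j; rewrite /mutB_set !inE big1 ?addr0 // => k; rewrite inE.
  by rewrite big1 ?mulg1 // => k; rewrite inE.
rewrite rcons_uniq => /andP [kl ul] ind.
have eA : [set j in rcons l k] = k |: [set j in l].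
  by apply/setP=> j; rewrite !inE mem_rcons.
rewrite {}eA in ind *; set A := [set j in l] in ind *.
have kA : k \notin A by rewrite inE.
have kk : k \in k |: A by rewrite setU11.
have Ak j : j \in A -> j \in k |: A by move=> jA; rewrite inE jA orbT.
have indA : independent A B by move=> i j iA jA; apply: ind; exact: Ak.
rewrite /mutate_seq foldl_rcons -/(mutate_seq _ _ _) IH //=.
have Bk i : mutB_set A B i k = B i k.
  rewrite /mutB_set (negbTE kA) orbF; case: ifP => iA.
    by rewrite ind ?kk ?Ak ?oppr0.
  rewrite big1 ?addr0 // => j jA; rewrite [B j k]ind ?kk ?Ak //.
  by rewrite normr0 !mulr0 addr0 div0z.
have kB i : mutB_set A B k i = B k i.
  rewrite /mutB_set (negbTE kA) /=; case: ifP => iA.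
    by rewrite ind ?kk ?Ak ?oppr0.
  rewrite big1 ?addr0 // => j jA; rewrite [B k j]ind ?kk ?Ak //.
  by rewrite normr0 !mul0r addr0 div0z.
have yk : muty_set A B y k = y k.
  rewrite /muty_set (negbTE kA) big1 ?mulg1 // => j jA.
  by rewrite ind ?kk ?Ak // y_factor0.
congr YSeed; apply/funext=> i.
  apply/funext=> j; rewrite /mutB /=; case: ifP => [/orP [/eqP->|/eqP->]|].
  - by rewrite kB mutB_setN // kk.
  - by rewrite Bk mutB_setN // kk orbT.
  move/negbT; rewrite negb_or => /andP [ik jk]; rewrite Bk kB /mutB_set.
  rewrite !in_setU1 (negbTE ik) (negbTE jk) /=.
  case: ifP => ijA; last by rewrite big_setU1 //= [RHS]addrCA addrC.
  case/orP: ijA => [iA|jA].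
    by rewrite [B i k]ind ?kk ?Ak // normr0 !mul0r addr0 ?div0z ?addr0.
  by rewrite [B k j]ind ?kk ?Ak // normr0 !mulr0 addr0 ?div0z ?addr0.
rewrite /muty /= yk kB; case: eqP => [->|/eqP ik].
  by rewrite /muty_set kk.
transitivity (muty_set A B y i * y_factor (B k i) (y k))%g.
  by rewrite /y_factor; case: ifP.
rewrite /muty_set in_setU1 (negbTE ik) /=; case: ifP => iA.
  by rewrite ind ?kk ?Ak // y_factor0 mulg1.
by rewrite big_setU1 //= -mulgA; congr (_ * _)%g; rewrite smulC.
Qed.

Lemma mutate_seq_triv (F : fieldType) (l : seq I) B (x : I -> F) :
  uniq l -> independent [set k in l] B ->
  mutate_seq (mutate (fun _ : triv_sf => 1)) l (Seed (YSeed B (fun=> Triv)) x)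
  = Seed (YSeed (mutB_set [set k in l] B) (fun=> Triv)) (mutx_set [set k in l] B x).
Proof.
elim/last_ind: l => [_ _|l k IH].
  rewrite /=; congr Seed; last by apply/funext=> i; rewrite /mutx_set inE.
  congr YSeed; apply/funext => i; apply/funext=> j.
  by rewrite /mutB_set !inE big1 ?addr0 // => k; rewrite inE.
move=> ulk ind; move: (ulk); rewrite rcons_uniq => /andP [kl ul].
have sub j : j \in [set j in l] -> j \in [set j in rcons l k].
  by rewrite !inE mem_rcons inE => ->; rewrite orbT.
have indA : independent [set j in l] B.
  by move=> i j iA jA; apply: ind; exact: sub.
have kk : k \in [set j in rcons l k] by rewrite inE mem_rcons inE eqxx.
have := mutate_seq_y (fun=> Triv) ulk ind.
rewrite /mutate_seq !foldl_rcons -!/(mutate_seq _ _ _) IH //.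
rewrite mutate_seq_y //.
have triv (y : I -> triv_sf) : y = fun=> Triv by apply/funext => i; case: (y i).
rewrite ![muty_set _ _ _]triv /mutate /= => e; rewrite e; congr Seed.
apply/funext=> i; rewrite /mutx /= !mul1r; case: eqP => [->|/eqP ik]; last first.
  by rewrite /mutx_set !inE mem_rcons inE (negbTE ik).
have xk : mutx_set [set j in l] B x k = x k by rewrite /mutx_set inE (negbTE kl).
rewrite xk [RHS]/mutx_set kk; congr (_ / _).
have Bk j : mutB_set [set j in l] B j k = B j k.
  rewrite /mutB_set [k \in _]inE (negbTE kl) orbF; case: ifP => iA.
    by rewrite ind ?kk ?sub ?oppr0.
  rewrite big1 ?addr0 // => m mA; rewrite [B m k]ind ?kk ?sub //.
  by rewrite normr0 !mulr0 addr0 div0z.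
have xE j : B j k != 0 -> mutx_set [set j in l] B x j = x j.
  by rewrite /mutx_set; case: ifP => // jA; rewrite ind ?eqxx ?kk ?sub.
rewrite /exchange; congr (_ + _).
  by apply: eq_big => [j|j]; rewrite Bk // => Bjk; rewrite xE // gt_eqF.
by apply: eq_big => [j|j]; rewrite Bk // => Bjk; rewrite xE // lt_eqF.
Qed.

End CompositeMutation.

(** [c k] is the composite mutation at time [k] in closed form and [V] an invariant. At negative
    times [evolve] is built from time [k + 1] down to [k]; the involutivity in the last hypothesis
    turns this back into a step from [k] to [k + 1]. *)
Lemma evolveP (I : finType) (S : Type) (mu : I -> S -> S) (M : int -> {set I})
    (s0 : S) (V : int -> S -> Prop) (c : int -> S -> S) :
  V 0 s0 ->
  (forall k s, V k s -> mutate_seq mu (enum (M k)) s = c k s /\ V (k + 1) (c k s)) ->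
  (forall k s, V (k + 1) s ->
     [/\ mutate_seq mu (rev (enum (M k))) s = c k s, V k (c k s) &
         c k (c k s) = s]) ->
  forall k, V k (evolve mu M s0 k) /\
            evolve mu M s0 (k + 1) = c k (evolve mu M s0 k).
Proof.
move=> V0 Vf Vb.
have fw n : V n%:Z (forward mu M s0 n).
  elim: n => //= n IH; have [-> +] := Vf _ _ IH.
  by congr (V _ _); rewrite -addn1 PoszD.
have eN n : - n%:Z = - n.+1%:Z + 1 by lia.
have bw n : V (- n%:Z) (backward mu M s0 n).
  elim: n => //= n IH; rewrite eN in IH.
  by have [-> + _] := Vb _ _ IH.
case=> n; first split=> //=.
  rewrite addn1 /=; by have [] := Vf _ _ (fw n).
rewrite NegzE; split; first exact: bw n.+1.
have := bw n; rewrite {1}eN => /Vb [e1 _ e2].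
have -> : evolve mu M s0 (- n.+1%:Z + 1) = backward mu M s0 n.
  by rewrite -eN; case: n {e1 e2}.
by rewrite -NegzE /= e1 e2.
Qed.

(** * The quiver in terms of waiting times *)

Lemma odd_abszD (x y : int) : odd `|(x + y)%R| = odd `|x| (+) odd `|y|.
Proof. by lia. Qed.

Lemma odd_abszM (x y : int) : odd `|(x * y)%R| = odd `|x| && odd `|y|.
Proof. by rewrite abszM oddM. Qed.

Definition odd_abszE := (odd_abszD, odd_abszM, abszN, absz_nat).

Section CartanFacts.
Variables (r : nat) (C : 'M[int]_r) (d : 'I_r -> nat) (ell : nat).
Variable Ip : pred 'I_r.
Hypotheses (HC : gen_cartan C) (HD : symmetrizer C d) (HT : tamely_laced C d).
Hypothesis HP : parity_decomposition C d Ip.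

Lemma d_gt0 a : (0 < d a)%N. Proof. by case: HD. Qed.

Lemma adj_sym : ssrbool.symmetric (adj C).
Proof.
move=> a b; rewrite /adj eq_sym; apply: andb_id2l => ba.
have [_ neg zero] := HC; move: (neg a b) (neg b a) (zero a b).
rewrite eq_sym ba => /(_ isT) n1 /(_ isT) n2 z.
rewrite !lt_neqAle n1 n2 !andbT; congr negb.
by apply/eqP/eqP; tauto.
Qed.

Lemma adj_irr a : adj C a a = false. Proof. by rewrite /adj eqxx. Qed.

(** If one of the entries is below -1, tameness makes the corresponding [d] equal to 1; otherwise
    both are -1 and the symmetry of DC gives [d a = d b]. *)
Lemma adj_d a b : adj C a b -> [\/ d a = d b, d a = 1%N | d b = 1%N].
Proof.
move=> /[dup] ab; rewrite adj_sym => /andP [_ ba]; case/andP: ab => _ ab.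
have [_ /(_ a b) e _] := HD.
case: (ltrP (C a b) (-1)) => [/HT [] da _|Cab]; first by constructor 2.
case: (ltrP (C b a) (-1)) => [/HT [] db _|Cba]; first by constructor 3.
by constructor 1; move: e; have -> : C a b = -1 by [lia]; have -> : C b a = -1 by [lia]; lia.
Qed.

Lemma codeg_mul a : (d a * codeg d a)%N = lcmd d.
Proof.
by rewrite mulnC divnK // /lcmd (bigD1 a) //= dvdn_lcml.
Qed.

Lemma codeg_eq a b : d a = d b -> codeg d a = codeg d b.
Proof. by move=> e; rewrite /codeg e. Qed.

Lemma in_range_eq a b m : d a = d b -> in_range d ell a m = in_range d ell b m.
Proof. by move=> e; rewrite /in_range (codeg_eq e). Qed.

Lemma in_range_mul a b m :
  d b = 1%N -> in_range d ell b (d a * m) = in_range d ell a m.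
Proof.
move=> db; rewrite /in_range muln_gt0 d_gt0 /=.
have -> : codeg d b = (d a * codeg d a)%N by rewrite codeg_mul -(codeg_mul b) db mul1n.
by rewrite -mulnA ltn_pmul2l ?d_gt0.
Qed.

(** Both ends of the column over [b] are multiples of [d a], hence at distance at least [d a] from
    [d a * m]: a window of smaller radius is never cut off. *)
Lemma in_range_near a b m n : d b = 1%N -> in_range d ell a m ->
  `|n%:Z - (d a * m)%:Z| < (d a)%:Z -> in_range d ell b n.
Proof.
rewrite /in_range => db /andP [m0 mt].
have -> : codeg d b = (d a * codeg d a)%N by rewrite codeg_mul -(codeg_mul b) db mul1n.
have h1 : (d a <= d a * m)%N by rewrite leq_pmulr.
have h2 : (d a * m.+1 <= d a * (codeg d a * ell))%N by rewrite leq_mul2l mt orbT.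
rewrite mulnS in h2; rewrite -mulnA; set t := (_ * (_ * ell))%N in h2 *.
by set q := (_ * m)%N in h1 h2 *; lia.
Qed.

Lemma Qplus'_period a m k q : Qplus' d Ip a m (k + q * (2 * d a)%:Z) = Qplus' d Ip a m k.
Proof.
by rewrite /Qplus' /Qplus; case: ifP => _; rewrite !odd_abszE oddM andbF addbF.
Qed.

Lemma Qplus'_same a m n k : n = m.+1 \/ m = n.+1 ->
  Qplus' d Ip a n (k + (d a)%:Z) = Qplus' d Ip a m k.
Proof.
rewrite /Qplus' /Qplus; case: ifP => od h; last by rewrite !odd_abszE od addbF.
case: h => ->; rewrite !odd_abszE od /=.
all: by move: (odd m) (odd n) (odd `|k|) (Ip a) => [] [] [] [].
Qed.

Lemma Qplus'_eqd a b m k : adj C a b -> d a = d b ->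
  Qplus' d Ip b m (k + (d a)%:Z) = Qplus' d Ip a m k.
Proof.
rewrite /Qplus' /Qplus => /HP + e; rewrite -!e andbb.
case: ifP => od /=; last by move/eqP->; rewrite !odd_abszE od !addbF.
rewrite !odd_abszE od.
by move: (odd m) (odd `|k|) (Ip a) (Ip b) => [] [] [] [].
Qed.

(** For odd [d a] the height [m] counts and the shift by [d a] is odd, which the different parts
    compensate; for even [d a] neither counts and the parts agree. Both rules for the parts thus
    lead to the same formula. *)
Lemma Qplus'_eq_edge a b m n k k' : adj C a b -> d b = 1%N ->
  (Qplus' d Ip a m k == Qplus' d Ip b n k')
  = odd `|(n%:Z - (d a * m)%:Z + k + k')%R|.
Proof.
rewrite /Qplus' /Qplus => /HP + e; rewrite !e /= andbT.
rewrite (fun_if absz) (fun_if odd) !odd_abszE oddM.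
move: (odd (d a)) (odd m) (odd n) (odd `|k|) (odd `|k'|) (Ip a) (Ip b).
by do 7! case.
Qed.

Lemma Qplus'_edge a b m n k k' : adj C a b -> d b = 1%N ->
  Qplus' d Ip a m k -> Qplus' d Ip b n k' = odd `|(n%:Z - (d a * m)%:Z + k + k')%R|.
Proof. by move=> ab e Qa; rewrite -(Qplus'_eq_edge _ _ _ _ ab e) Qa. Qed.

Lemma Qplus'_edge_long a b m n k k' : adj C a b -> d b = 1%N ->
  Qplus' d Ip b n k' -> Qplus' d Ip a m k = odd `|(n%:Z - (d a * m)%:Z + k + k')%R|.
Proof. by move=> ab e Qb; rewrite -(Qplus'_eq_edge _ _ _ _ ab e) Qb eqb_id. Qed.

End CartanFacts.

(** The matrix mutation at an edge between a long vertex, with [D] and waiting time [w], and a short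
    one at offset [x] that waits 1. The left side is the new entry. On the right, the first two
    terms count paths through the neighbours of the short vertex in its column, the third is the old
    entry up to sign, and the last counts paths through the long column, which exist only at half
    period. *)
Lemma window_step (D w x : int) : 1 < D -> 0 < w < 2 * D -> odd `|(x + w + 1)%R| ->
  (`|x| <= Num.min (w - 1) (2 * D - 1 - (w - 1)))%R%:Z
  = (`|x + 1| <= Num.min w (2 * D - 1 - w))%R%:Z
    + (`|x - 1| <= Num.min w (2 * D - 1 - w))%R%:Z
    - (`|x| <= Num.min w (2 * D - 1 - w))%R%:Z
    - (if w == D then (x == D)%:Z + (x == - D)%:Z else 0).
Proof.
move=> D1 w0 par.
case: eqP => wD.
  have -> : Num.min (w - 1) (2 * D - 1 - (w - 1)) = D - 1 by lia.
  have -> : Num.min w (2 * D - 1 - w) = D - 1 by lia.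
  case: eqP => [->|?]; first by case: (lerP `|D + 1| _) => ?;
    case: (lerP `|D - 1| _) => ?; case: lerP => ?; lia.
  case: eqP => [->|?]; first by case: (lerP `|- D + 1| _) => ?;
    case: (lerP `|- D - 1| _) => ?; case: lerP => ?; lia.
  by case: (lerP `|x + 1| _) => ?; case: (lerP `|x - 1| _) => ?;
    case: (lerP `|x| _) => ?; lia.
have {wD} [wD|wD] : w < D \/ D < w by lia.
  have -> : Num.min (w - 1) (2 * D - 1 - (w - 1)) = w - 1 by lia.
  have -> : Num.min w (2 * D - 1 - w) = w by lia.
  by case: (lerP `|x| (w - 1)) => ?; case: (lerP `|x + 1| _) => ?; case: (lerP `|x - 1| _) => ?;
    case: (lerP `|x| w) => ?; lia.
have -> : Num.min (w - 1) (2 * D - 1 - (w - 1)) = 2 * D - w by lia.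
have -> : Num.min w (2 * D - 1 - w) = 2 * D - 1 - w by lia.
by case: (lerP `|x| (2 * D - w)) => ?; case: (lerP `|x + 1| _) => ?; case: (lerP `|x - 1| _) => ?;
    case: (lerP `|x| (2 * D - 1 - w)) => ?; lia.
Qed.

Section Coordinates.
Variables (r : nat) (C : 'M[int]_r) (d : 'I_r -> nat) (ell : nat).
Variable Ip : pred 'I_r.

(* A vertex i over a = pa i at height m = pm i is mutated at the times congruent
   to ps i modulo 2 d_a; the coordinates (a, m, ps i mod 2 d_a) range bijectively
   over the triples satisfying Q'_+. *)
Record coordinates (I : finType) (pa : I -> 'I_r) (pm : I -> nat)
    (ps : I -> int) : Prop := {
  coord_range : forall i, in_range d ell (pa i) (pm i);
  coord_parity : forall i, Qplus' d Ip (pa i) (pm i) (ps i);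
  coord_inj : forall i j, pa i = pa j -> pm i = pm j ->
    (ps i = ps j %[mod (2 * d (pa i))%:Z])%Z -> i = j;
  coord_surj : forall a m k, in_range d ell a m -> Qplus' d Ip a m k ->
    exists i, [/\ pa i = a, pm i = m & (ps i = k %[mod (2 * d a)%:Z])%Z] }.

Hypotheses (HC : gen_cartan C) (HD : symmetrizer C d) (HT : tamely_laced C d).
Hypothesis HP : parity_decomposition C d Ip.
Variables (I : finType) (pa : I -> 'I_r) (pm : I -> nat) (ps : I -> int).
Hypothesis co : coordinates pa pm ps.

Let dpos := d_gt0 HD.

(* The waiting time until the next mutation at i. *)
Definition wait (u : int) (i : I) : int := ((ps i - u) %% (2 * d (pa i))%:Z)%Z.

Definition mut_at (u : int) : {set I} := [set i | wait u i == 0].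

(* The quiver at time u; it depends on u only through the waiting times. *)
Definition step_arrow (u : int) (i j : I) : bool :=
  [&& pa i == pa j, (pm j == (pm i).+1) || (pm i == (pm j).+1) &
      wait u j == wait u i + (d (pa i))%:Z].

Definition flat_arrow (u : int) (i j : I) : bool :=
  [&& adj C (pa i) (pa j), d (pa i) == d (pa j), pm i == pm j &
      wait u i == wait u j + (d (pa i))%:Z].

(** On the initial quiver the bound is [rho]. While the waiting time runs down from 2d - 1 to 0, it
    rises from 0 to d - 1 and falls back to 0. *)
Definition joined (u : int) (i j : I) : bool :=
  [&& adj C (pa i) (pa j), (1 < d (pa i))%N, d (pa j) == 1%N &
      `|(pm j)%:Z - (d (pa i) * pm i)%:Z|
        <= Num.min (wait u i) ((2 * d (pa i))%:Z - 1 - wait u i)].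

Definition lace_arrow (u : int) (i j : I) : bool :=
  (joined u i j && (wait u j == 0)) || (joined u j i && (wait u i == 1)).

Definition arrow_at (u : int) (i j : I) : bool :=
  [|| step_arrow u i j, flat_arrow u i j | lace_arrow u i j].

Definition B_at (u : int) (i j : I) : int :=
  (arrow_at u i j)%:Z - (arrow_at u j i)%:Z.

Lemma wait_ge0 u i : 0 <= wait u i.
Proof. by apply: modz_ge0; move: (dpos (pa i)); lia. Qed.

Lemma wait_lt u i : wait u i < (2 * d (pa i))%:Z.
Proof. by apply: ltz_pmod; move: (dpos (pa i)); lia. Qed.

Lemma wait_div u i : exists q, ps i = u + wait u i + q * (2 * d (pa i))%:Z.
Proof.
exists ((ps i - u) %/ (2 * d (pa i))%:Z)%Z.
by rewrite -addrA [wait u i + _]addrC -divz_eq; lia.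
Qed.

Lemma wait_eq u i s q : ps i = u + s + q * (2 * d (pa i))%:Z ->
  0 <= s < (2 * d (pa i))%:Z -> wait u i = s.
Proof.
move=> e s_lt; rewrite /wait e.
have -> : u + s + q * (2 * d (pa i))%:Z - u = q * (2 * d (pa i))%:Z + s by ring.
by rewrite modzMDl modz_small.
Qed.

Lemma waitS u i :
  wait (u + 1) i = if wait u i == 0 then (2 * d (pa i))%:Z - 1 else wait u i - 1.
Proof.
have [q e] := wait_div u i; have := wait_ge0 u i; have := wait_lt u i.
have := dpos (pa i); case: eqP => w0 d0 wl wg.
  apply: (@wait_eq _ _ _ (q - 1)); last by lia.
  by rewrite e w0; ring.
by apply: (@wait_eq _ _ _ q); last lia; rewrite e; ring.
Qed.

Lemma wait_parity u i : Qplus' d Ip (pa i) (pm i) (u + wait u i).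
Proof.
by have [q e] := wait_div u i; have := coord_parity co i; rewrite e Qplus'_period.
Qed.

Lemma edge_parity u i j : adj C (pa i) (pa j) -> d (pa j) = 1%N ->
  odd `|((pm j)%:Z - (d (pa i) * pm i)%:Z + wait u i + wait u j)%R|.
Proof.
move=> ij dj.
have := wait_parity u j; rewrite (Qplus'_edge HP _ _ ij dj (wait_parity u i)).
by move: (d (pa i) * pm i)%N => x; lia.
Qed.

(** By bijectivity of the coordinates there is at most one index. The neutral value out of range is
    what realises the boundary conventions at the two ends of a column. *)
Lemma big_vertex (K : Type) (idx : K) (op : Monoid.com_law idx)
    (H : 'I_r -> nat -> int -> K) u b n s :
  0 <= s < (2 * d b)%:Z -> Qplus' d Ip b n (u + s) ->
  \big[op/idx]_(i | [&& pa i == b, pm i == n & wait u i == s]) H (pa i) (pm i) (wait u i)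
  = if in_range d ell b n then H b n s else idx.
Proof.
move=> s_lt par; case: ifP => [rg|nrg]; last first.
  rewrite big1 // => i /and3P [/eqP ib /eqP im _].
  by have := coord_range co i; rewrite ib im nrg.
have [i [ib im ik]] := coord_surj co rg par.
have iw : wait u i = s.
  move/eqP: ik; rewrite eqz_mod_dvd => /dvdzP [q e].
  by apply: (@wait_eq _ _ _ q); rewrite ib //; rewrite -e; ring.
rewrite (big_pred1 i) => [|j]; first by rewrite ib im iw.
apply/and3P/eqP => [[/eqP jb /eqP jm /eqP jw]|->]; last by rewrite ib im iw !eqxx.
apply: (coord_inj co); rewrite ?ib ?im //.
have [q ->] := wait_div u i; have [q' ->] := wait_div u j.
rewrite jb ib iw jw; apply/eqP; rewrite eqz_mod_dvd.
apply/dvdzP; exists (q' - q); ring.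
Qed.

(** The arrow condition into a vertex under mutation, in terms of its coordinates only, so that it
    makes sense for heights beyond the ends of a column. *)
Definition enters (u : int) (i : I) (b : 'I_r) (n : nat) : bool :=
  adj C (pa i) b &&
  [|| [&& d (pa i) == d b, pm i == n & wait u i == (d b)%:Z],
      [&& (1 < d (pa i))%N, d b == 1%N &
        `|n%:Z - (d (pa i) * pm i)%:Z|
          <= Num.min (wait u i) ((2 * d (pa i))%:Z - 1 - wait u i)] |
      [&& (1 < d b)%N, d (pa i) == 1%N, pm i == (d b * n)%N & wait u i == 1]].

(** A flat arrow starts at a vertex with positive waiting time. A long [k] with waiting time 0 is
    joined only at offset 0, where [edge_parity] makes the waiting time of the short vertex odd, so
    the lace does not leave [k]. *)
Lemma arrow_out u k j : wait u k = 0 ->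
  arrow_at u k j = [&& pa k == pa j, (pm j == (pm k).+1) || (pm k == (pm j).+1) &
                       wait u j == (d (pa k))%:Z].
Proof.
move=> k0; rewrite /arrow_at /step_arrow k0 add0r.
have -> : flat_arrow u k j = false.
  by have := dpos (pa k); have := wait_ge0 u j; rewrite /flat_arrow k0;
     case: eqP => [?|_]; rewrite ?andbF //; lia.
rewrite /lace_arrow k0 /= andbF !orbF.
case jkj: (joined u k j); last by rewrite orbF.
case/and4P: jkj => kj _ /eqP dj; have := edge_parity u kj dj; rewrite k0 => o h.
suff -> : (wait u j == 0) = false by rewrite orbF.
by move: h o; move: (d (pa k) * pm k)%N (2 * d (pa k))%N => x y; lia.
Qed.

Lemma arrow_in u i k : wait u k = 0 -> arrow_at u i k = enters u i (pa k) (pm k).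
Proof.
move=> k0; rewrite /arrow_at /enters.
have -> : step_arrow u i k = false.
  have := dpos (pa i); have := wait_ge0 u i; rewrite /step_arrow k0.
  by case: eqP => [_|]; rewrite ?andbF //=; case: eqP => [?|_]; rewrite ?andbF //; lia.
rewrite /= /flat_arrow /lace_arrow /joined k0 [adj C (pa k) _](adj_sym HC).
case: (adj C (pa i) (pa k)) => //=; rewrite add0r eqxx andbT.
case: (d (pa i) =P d (pa k)) => [->|_] /=.
  by case: (d (pa k) =P 1%N) => [->|_]; rewrite /= ?andbF.
congr (_ || _); case: (ltnP 1 (d (pa k))) => //= d1.
case: (d (pa i) == 1%N) => //=; congr (_ && _); rewrite subr0.
by move: d1; move: (d (pa k) * pm k)%N (d (pa k)) => x y; lia.
Qed.

Lemma arrow_asym u k j : wait u k = 0 -> arrow_at u k j -> arrow_at u j k = false.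
Proof.
move=> k0; rewrite arrow_out // arrow_in // => /and3P [/eqP e _ _].
by rewrite /enters e adj_irr.
Qed.

Lemma B_at_independent u : independent (mut_at u) (B_at u).
Proof.
move=> i j; rewrite !inE => /eqP i0 /eqP j0.
have n k l : wait u k = 0 -> wait u l = 0 -> arrow_at u k l = false.
  move=> k0 l0; rewrite arrow_out // l0.
  by have := dpos (pa k); case: eqP => [?|_]; rewrite ?andbF //; lia.
by rewrite /B_at !n.
Qed.

(** A mutated vertex jumps from waiting time 0 to 2d - 1 while an unmutated one loses one unit; for
    each kind of arrow this turns the condition for one direction into that for the other. *)
Lemma B_at_mutated u i j : i \in mut_at u -> B_at (u + 1) i j = - B_at u i j.
Proof.
rewrite inE => /eqP i0; have di := dpos (pa i); have dj := dpos (pa j).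
have wi : wait (u + 1) i = (2 * d (pa i))%:Z - 1 by rewrite waitS i0.
have wj := waitS u j; have j0 := wait_ge0 u j; have jl := wait_lt u j.
have step0 : step_arrow (u + 1) i j = false.
  rewrite /step_arrow wi; case: eqP => //= pij; rewrite wj -pij in jl *.
  by rewrite [X in _ && X]negbTE ?andbF //; apply/eqP; case: (wait u j =P 0) => ?; lia.
have step1 : step_arrow (u + 1) j i = step_arrow u i j.
  clear step0.
  rewrite /step_arrow wi i0 eq_sym orbC; case: eqP => //= pij.
  by rewrite wj -pij; congr (_ && _); case: (wait u j =P 0) => ?; lia.
have step2 : step_arrow u j i = false.
  clear step0 step1.
  by rewrite /step_arrow i0; case: eqP => //= _; rewrite andbC; case: eqP => //= ?; lia.
have flat0 : flat_arrow (u + 1) j i = false.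
  clear step0 step1 step2.
  rewrite /flat_arrow wi; case: (_ =P d (pa i)) => [e|]; rewrite ?andbF //=.
  rewrite [X in _ && (_ && X)]negbTE ?andbF // wj e.
  by apply/eqP; case: (wait u j =P 0) => ?; lia.
have flat1 : flat_arrow (u + 1) i j = flat_arrow u j i.
  clear step0 step1 step2 flat0.
  rewrite /flat_arrow wi i0 adj_sym // eq_sym [pm _ == _]eq_sym wj.
  case: (_ =P d (pa i)) => [e|]; rewrite ?andbF //= e; congr [&& _, _ & _].
  by case: (wait u j =P 0) => ?; lia.
have flat2 : flat_arrow u i j = false.
  clear step0 step1 step2 flat0 flat1.
  rewrite /flat_arrow i0 [X in [&& _, _, _ & X]]negbTE ?andbF //.
  by apply/eqP; lia.
have lace0 : lace_arrow (u + 1) i j = lace_arrow u j i.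
  clear step0 step1 step2 flat0 flat1 flat2.
  rewrite /lace_arrow /joined wi i0 eqxx andbT orbC; congr (_ || _).
    case aji: (adj _ _ _) => //=; case: (_ =P 1%N) => [e|]; rewrite ?andbF //=.
    rewrite e andbT; congr (_ && _); have := edge_parity u aji e.
    rewrite i0 wj; move: jl; move: (d (pa j) * pm j)%N => x.
    by case: (wait u j =P 0) => ?; lia.
  case aij: (adj _ _ _) => //=; case: (_ =P 1%N) => [e|]; rewrite ?andbF //=.
  rewrite wj; move: jl; rewrite e; move: (d (pa i) * pm i)%N => x.
  by case: (wait u j =P 0) => ?; case: (ltnP 1 (d (pa i))) => //= ?; lia.
have lace1 : lace_arrow (u + 1) j i = lace_arrow u i j.
  clear step0 step1 step2 flat0 flat1 flat2 lace0.
  rewrite /lace_arrow /joined wi i0 /= !andbF orbF.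
  case aij: (adj C (pa i) _) => /=; last by rewrite ?andbF ?orbF adj_sym // aij.
  case: (d (pa j) =P 1%N) => [e|]; rewrite ?andbF ?orbF //=.
    have := edge_parity u aij e; rewrite i0 wj; move: jl; rewrite e.
    move: (d (pa i) * pm i)%N => x.
    case: (ltnP 1 (d (pa i))) => //= ?; rewrite ?andbF //.
    by case: (wait u j =P 0) => ?; lia.
  by rewrite [_ == 0]negbTE ?andbF //; apply/eqP; lia.
by rewrite /B_at /arrow_at step0 step1 step2 flat0 flat1 flat2 lace0 lace1 opprB.
Qed.

Definition paths (u : int) (i j : I) : int :=
  \sum_(k in mut_at u) (arrow_at u i k && arrow_at u k j)%:Z.

(** The second arrow of such a path leaves a mutated vertex, so by [arrow_out] that vertex is a
    neighbour of [j] in its own column and [j] waits half a period. *)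
Lemma pathsE u i j : paths u i j =
  if wait u j == (d (pa j))%:Z then
    (in_range d ell (pa j) (pm j).+1 && enters u i (pa j) (pm j).+1)%:Z
    + (in_range d ell (pa j) (pm j).-1 && enters u i (pa j) (pm j).-1)%:Z
  else 0.
Proof.
have mj : (0 < pm j)%N by case/andP: (coord_range co j).
have term k : k \in mut_at u -> (arrow_at u i k && arrow_at u k j)%:Z =
    if wait u j == (d (pa j))%:Z then
      (if (pa k == pa j) && (pm k == (pm j).+1) then (enters u i (pa k) (pm k))%:Z else 0)
      + (if (pa k == pa j) && (pm k == (pm j).-1) then (enters u i (pa k) (pm k))%:Z else 0)
    else 0.
  rewrite inE => /eqP k0; rewrite (arrow_in i k0) (arrow_out j k0).
  case: (pa k =P pa j) => [->|_] /=; last by rewrite andbF; case: ifP.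
  case: (enters _ _ _ _) => /=; last by do 3?[case: ifP => _].
  case: (pm k =P (pm j).+1) => ?; case: (pm k =P (pm j).-1) => ?;
    by case: (wait u j == _); rewrite ?andbT ?andbF //=; lia.
rewrite /paths (eq_bigr _ term); case: eqP => wj; last by rewrite big1.
have par n : n = (pm j).+1 \/ pm j = n.+1 -> Qplus' d Ip (pa j) n (u + 0).
  move=> h; rewrite addr0; have := wait_parity u j.
  by rewrite wj (@Qplus'_same _ d Ip (pa j) n) //; tauto.
have vtx n : Qplus' d Ip (pa j) n (u + 0) ->
    \sum_(k in mut_at u) (if (pa k == pa j) && (pm k == n)
                         then (enters u i (pa k) (pm k))%:Z else 0)
    = (in_range d ell (pa j) n && enters u i (pa j) n)%:Z.
  move=> h; rewrite -big_mkcondr /=.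
  have := @big_vertex int 0 +%R (fun a m (_ : int) => (enters u i a m)%:Z) u (pa j) n 0.
  rewrite (_ : (if _ then _ else 0)
    = (in_range d ell (pa j) n && enters u i (pa j) n)%:Z); last by case: ifP.
  move=> <- //; last by move: (dpos (pa j)); lia.
  by apply: eq_bigl => k; rewrite inE andbC andbA.
by rewrite big_split /= !vtx //; apply: par; [right; rewrite prednK | left].
Qed.

Lemma B_at_anti u i j : B_at u i j = - B_at u j i.
Proof. by rewrite /B_at opprB. Qed.

(** Over nonadjacent points there are no paths. For equal [d] all waiting times drop together and
    the paths in the two directions cancel. The remaining edges are settled by [window_step]. *)
Lemma B_at_unmutated u i j : wait u i != 0 -> wait u j != 0 ->
  B_at (u + 1) i j = B_at u i j + (paths u i j - paths u j i).
Proof.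
have wS k : wait u k != 0 -> wait (u + 1) k = wait u k - 1.
  by rewrite waitS => /negbTE ->.
have [aij|naij] := boolP (adj C (pa i) (pa j)); last first.
  have naji : ~~ adj C (pa j) (pa i) by rewrite adj_sym.
  move=> i0 j0; rewrite !pathsE /enters (negbTE naij) (negbTE naji) /= !andbF.
  rewrite addr0 !if_same subrr addr0 /B_at /arrow_at /flat_arrow /lace_arrow /joined.
  rewrite (negbTE naij) (negbTE naji) /= !orbF /step_arrow !wS //.
  by congr (_%:Z - _%:Z); congr [&& _, _ & _]; apply/eqP/eqP; lia.
have paij : (pa i == pa j) = false.
  by apply/negP => /eqP e; rewrite e adj_irr in aij.
have stepF v k l : adj C (pa k) (pa l) -> step_arrow v k l = false.
  by rewrite /step_arrow; case: eqP => // ->; rewrite adj_irr.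
have lace k l : adj C (pa k) (pa l) -> (1 < d (pa k))%N -> d (pa l) = 1%N ->
    wait u k != 0 -> wait u l != 0 ->
    B_at (u + 1) k l = B_at u k l + (paths u k l - paths u l k).
  move=> akl dk dl k0 l0; have alk := akl; rewrite adj_sym // in alk.
  (* For [d = 1] the waiting time is 0 or 1, and 0 is excluded. At time [u + 1] it is 0, so every
     lace at [l] is oriented the other way. *)
  have l1 : wait u l = 1 by have := wait_lt u l; have := wait_ge0 u l; lia.
  have dkl : (d (pa k) == d (pa l)) = false by apply/eqP; lia.
  have dlk : (d (pa l) == d (pa k)) = false by apply/eqP; lia.
  have dk1 : (d (pa k) == 1%N) = false by apply/eqP; lia.
  have BE v : B_at v k l = (joined v k l && (wait v l == 0))%:Z
                           - (joined v k l && (wait v l == 1))%:Z.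
    rewrite /B_at /arrow_at !stepF // /flat_arrow dkl dlk !andbF /= /lace_arrow.
    by rewrite [joined v l k]/joined dl /= !andbF orbF.
  rewrite !BE !pathsE !wS // l1 dl eqxx subrr /= !andbT !andbF /enters alk akl.
  rewrite dkl dlk dk dk1 dl l1 /= !orbF !eqxx !andbT /joined akl dk dl /=.
  have wl := wait_lt u k; have wg := wait_ge0 u k.
  have par := edge_parity u akl dl; rewrite l1 in par.
  have mk : (0 < pm k)%N by case/andP: (coord_range co k).
  (* The range conditions are automatic: the window around the long vertex stays inside the short
     column, and a level whose multiple is the height of [l] lies inside the long one. *)
  have near n : in_range d ell (pa l) n
      && (`|n%:Z - (d (pa k) * pm k)%:Z|
          <= Num.min (wait u k) ((2 * d (pa k))%:Z - 1 - wait u k))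
    = (`|n%:Z - (d (pa k) * pm k)%:Z|
          <= Num.min (wait u k) ((2 * d (pa k))%:Z - 1 - wait u k)).
    apply: andb_idl => h; apply: (in_range_near dl (coord_range co k)).
    by move: h; move: (d (pa k) * pm k)%N => x; lia.
  have far n : in_range d ell (pa k) n && (pm l == d (pa k) * n)%N
             = (pm l == d (pa k) * n)%N.
    apply: andb_idl => /eqP h; rewrite -(in_range_mul ell HD _ _ dl) -h.
    exact: (coord_range co).
  rewrite wS // !near !far.
  have -> : (d (pa k) * (pm k).+1 = d (pa k) + d (pa k) * pm k)%N by rewrite mulnS.
  have eqx : (d (pa k) * pm k = d (pa k) + d (pa k) * (pm k).-1)%N.
    by rewrite -{1}(prednK mk) mulnS.
  have ml : (0 < pm l)%N by case/andP: (coord_range co l).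
  rewrite eqx in par *; move: wl wg k0 dk ml par.
  move: (d (pa k) * (pm k).-1)%N => x; move: (wait u k) (pm l) (d (pa k)) => w n D.
  (* [x] has replaced [d * (m - 1)] for the height [m] of [k], so [X] is [d * m] and [n%:Z - X] is
     the offset in [window_step]. *)
  move=> wl wg k0 dk ml par; set X := (D + x)%N%:Z.
  have -> : n.+1%:Z - X = n%:Z - X + 1 by lia.
  have -> : n.-1%:Z - X = n%:Z - X - 1 by lia.
  have -> : (n == D + (D + x))%N = (n%:Z - X == D%:Z) by lia.
  have -> : (n == x)%N = (n%:Z - X == - D%:Z) by lia.
  have -> : (2 * D)%:Z = 2 * D%:Z by lia.
  rewrite (@window_step D w); [ring|lia|lia|move: par; rewrite /X; lia].
move=> i0 j0; have aji := aij; rewrite adj_sym // in aji.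
have flat : d (pa i) = d (pa j) ->
    B_at (u + 1) i j = B_at u i j + (paths u i j - paths u j i).
  move=> e; have jF v k l : d (pa k) = d (pa l) -> joined v k l = false.
    rewrite /joined => ->; case: (d (pa l) =P 1%N) => [->|_]; last by rewrite !andbF.
    by rewrite andbF.
  have dF : (1 < d (pa j))%N && (d (pa j) == 1%N) = false by lia.
  have ent k l n : adj C (pa k) (pa l) -> d (pa k) = d (pa j) -> d (pa l) = d (pa j) ->
      enters u k (pa l) n = (pm k == n) && (wait u k == (d (pa j))%:Z).
    move=> kl dk dl; rewrite /enters kl dk dl eqxx /=.
    by rewrite !andbA dF /= orbF.
  have inr k l n : d (pa k) = d (pa l) ->
      in_range d ell (pa k) n && ((pm l == n) && (wait u l == (d (pa j))%:Z))
      = (pm l == n) && (wait u l == (d (pa j))%:Z).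
    move=> dkl; case: eqP => [<-|_]; last by rewrite andbF.
    by rewrite (in_range_eq ell _ dkl) (coord_range co).
  have mi : (0 < pm i)%N by case/andP: (coord_range co i).
  have mj : (0 < pm j)%N by case/andP: (coord_range co j).
  rewrite !pathsE !ent // !inr // e /B_at /arrow_at /lace_arrow !jF //.
  rewrite !stepF // /= !orbF /flat_arrow aij aji e eqxx !wS //= [pm j == pm i]eq_sym.
  have shift (v w D : int) : (v - 1 == w - 1 + D) = (v == w + D) by lia.
  have -> : (pm i == (pm j).-1) = (pm j == (pm i).+1) by lia.
  have -> : (pm j == (pm i).-1) = (pm i == (pm j).+1) by lia.
  rewrite !shift; case: (wait u i == (d (pa j))%:Z);
    case: (wait u j == (d (pa j))%:Z); rewrite ?andbT ?andbF /= ?subrr ?addr0 //.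
  by rewrite [X in _ + (_ - X)]addrC subrr addr0.
case: (adj_d HC HD HT aij) => [//|e|e].
  case: (ltnP 1 (d (pa j))) => dj; last by apply: flat; move: (dpos (pa j)); lia.
  by rewrite B_at_anti lace // [B_at u i j]B_at_anti; lia.
case: (ltnP 1 (d (pa i))) => di; first exact: lace.
by apply: flat; move: (dpos (pa i)); lia.
Qed.

Lemma B_at_step u i j : B_at (u + 1) i j = mutB_set (mut_at u) (B_at u) i j.
Proof.
case: (boolP (i \in mut_at u)) => [iM|niM]; first by rewrite mutB_setN ?iM ?B_at_mutated.
case: (boolP (j \in mut_at u)) => [jM|njM].
  by rewrite mutB_setN ?jM ?orbT // B_at_anti B_at_mutated // -B_at_anti.
rewrite /mutB_set (negbTE niM) (negbTE njM) B_at_unmutated; first last.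
- by move: njM; rewrite inE.
- by move: niM; rewrite inE.
(* Entries at a mutated [k] are 0, 1 or -1 and never come from arrows both ways; the mutation term
   is 1 for a path from [i] to [j], -1 for a path back, and 0 otherwise. *)
congr (_ + _); rewrite /paths -sumrB; apply: eq_bigr => k.
rewrite inE => /eqP k0; rewrite /B_at.
have := @arrow_asym u k j k0; have := @arrow_asym u k i k0.
case: (arrow_at u i k) (arrow_at u k i) (arrow_at u k j) (arrow_at u j k) =>
  [] [] [] [] //= h1 h2; by [have := h1 isT | have := h2 isT].
Qed.

(** * The exchange relations in terms of waiting times *)

Lemma Qplus'_even a n k x : Qplus' d Ip a n (k + 2 * x) = Qplus' d Ip a n k.
Proof. by rewrite /Qplus' /Qplus; case: ifP => _; congr (_ == _); lia. Qed.

(** The T-variable at a vertex is dated half a period before the mutation, which exchanges the two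
    parity conditions. *)
Lemma Qplus_half a n k : Qplus d Ip a n (k - (d a)%:Z) = Qplus' d Ip a n k.
Proof. by rewrite /Qplus' /Qplus; case: ifP => _; congr (_ == _); lia. Qed.

Lemma Qplus'S a n k : Qplus' d Ip a n (k + 1) = ~~ Qplus' d Ip a n k.
Proof.
rewrite /Qplus' /Qplus -(can_eq negbK) -eqb_negLR.
by case: ifP => _; case: (Ip a) => /=; lia.
Qed.

(** * Products over the neighbours of a mutated vertex *)

Section Reindexing.
Variables (K : Type) (idx : K) (op : Monoid.com_law idx).

Lemma big_seq_pred1 (T : eqType) (s : seq T) (i : T) (P : pred T) (F : T -> K) :
  uniq s -> i \in s -> {in s, P =1 pred1 i} -> \big[op/idx]_(w <- s | P w) F w = F i.
Proof.
move=> us si Pi; rewrite -big_filter -[RHS](big_seq1 op).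
apply/perm_big/uniq_perm; rewrite ?filter_uniq // => w.
rewrite mem_filter inE; case ws: (w \in s); first by rewrite andbT Pi.
by rewrite andbF; apply/esym/eqP => wi; rewrite wi si in ws.
Qed.

(** Turns the progressions of step 2 in the T- and Y-systems into sets of waiting times of fixed
    parity in an interval, the form in which laces occur on the quiver. *)
Lemma big_progression (A c N : nat) (F : nat -> K) :
  (2 * c <= A < N + 2)%N ->
  \big[op/idx]_(1 <= q < c.+1) F (A - 2 * q)%N
  = \big[op/idx]_(0 <= w < N |
      [&& (A - 2 * c <= w)%N, (w + 2 <= A)%N & odd w == odd A]) F w.
Proof.
move=> Ac; rewrite -[RHS]big_filter.
transitivity (\big[op/idx]_(w <- [seq (A - 2 * q)%N | q <- index_iota 1 c.+1]) F w).
  by rewrite big_map.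
apply: perm_big; apply: uniq_perm.
- rewrite map_inj_in_uniq ?iota_uniq // => x y; rewrite !mem_index_iota; lia.
- by rewrite filter_uniq ?iota_uniq.
move=> w; rewrite mem_filter mem_index_iota; apply/mapP/idP.
  by case=> q; rewrite mem_index_iota => h ->; lia.
by move=> h; exists ((A - w)./2); rewrite ?mem_index_iota; lia.
Qed.

Lemma big_wait (H : 'I_r -> nat -> int -> K) u b n (P : pred int) :
  \big[op/idx]_(i | [&& pa i == b, pm i == n & P (wait u i)]) H (pa i) (pm i) (wait u i)
  = \big[op/idx]_(0 <= w < 2 * d b | P w%:Z && Qplus' d Ip b n (u + w%:Z))
      (if in_range d ell b n then H b n w%:Z else idx).
Proof.
rewrite (big_nat_cond) (eq_bigr (fun w : nat => \big[op/idx]_(i | [&& pa i == b, pm i == n & wait u i == w%:Z])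
    H (pa i) (pm i) (wait u i))); last first.
  by move=> w /andP [w_lt /andP [_ Qw]]; rewrite big_vertex //; lia.
rewrite (exchange_big_dep (fun i => [&& pa i == b, pm i == n & P (wait u i)])) /=.
  apply: eq_bigr => i /and3P [ib im iP].
  have wg := wait_ge0 u i; have wl := wait_lt u i.
  rewrite (@big_seq_pred1 _ _ `|wait u i|%N) ?iota_uniq //.
    by rewrite mem_index_iota -(eqP ib); lia.
  move=> w; rewrite mem_index_iota /= ib im /= => w_lt.
  apply/idP/eqP => [/andP [_ /eqP ->] //|->].
  rewrite gez0_abs // iP eqxx -(eqP ib) -(eqP im) wait_parity /= andbT.
  by rewrite andbT; lia.
by move=> w i /andP [_ /andP [Pw _]] /and3P [-> -> /eqP ->].
Qed.

Lemma big_step_neighbours u i (H : 'I_r -> nat -> int -> K) (s : int)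
    (P : pred I) :
  0 <= s < (2 * d (pa i))%:Z ->
  Qplus' d Ip (pa i) (pm i) (u + s + (d (pa i))%:Z) ->
  (forall k, P k = [&& pa k == pa i, (pm k == (pm i).+1) || (pm i == (pm k).+1) &
                       wait u k == s]) ->
  \big[op/idx]_(k | P k) H (pa k) (pm k) (wait u k)
  = op (if in_range d ell (pa i) (pm i).+1 then H (pa i) (pm i).+1 s else idx)
       (if in_range d ell (pa i) (pm i).-1 then H (pa i) (pm i).-1 s else idx).
Proof.
move=> s_lt par PE; have mi : (0 < pm i)%N by case/andP: (coord_range co i).
have par' n : n = (pm i).+1 \/ pm i = n.+1 -> Qplus' d Ip (pa i) n (u + s).
  by move=> h; rewrite -(@Qplus'_same _ d Ip (pa i) n (pm i)) //; tauto.
rewrite (bigID (fun k => pm k == (pm i).+1)) /=; congr (op _ _).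
  rewrite -(@big_vertex _ idx op H u) //; last by apply: par'; left.
  apply: eq_bigl => k; rewrite PE; case: (pm k =P _); rewrite ?andbF // => ->.
  by rewrite !andbT.
rewrite -(@big_vertex _ idx op H u) //; last by apply: par'; right; rewrite prednK.
apply: eq_bigl => k; rewrite PE.
by case: eqP => //= _; case: (wait u k == s); rewrite ?andbF // !andbT; lia.
Qed.

Lemma big_arrow_out u i (H : 'I_r -> nat -> int -> K) : wait u i = 0 ->
  \big[op/idx]_(k | arrow_at u i k) H (pa k) (pm k) (wait u k)
  = op (if in_range d ell (pa i) (pm i).+1 then H (pa i) (pm i).+1 (d (pa i))%:Z else idx)
       (if in_range d ell (pa i) (pm i).-1 then H (pa i) (pm i).-1 (d (pa i))%:Z else idx).
Proof.
move=> i0; apply: (@big_step_neighbours u) => [||k]; first by move: (dpos (pa i)); lia.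
  have := wait_parity u i; rewrite i0 addr0 -addrA -(Qplus'_even _ _ _ (d (pa i))%:Z).
  by rewrite mulr_natl.
by rewrite arrow_out // eq_sym [pa k == _]eq_sym; case: eqP.
Qed.

Lemma big_arrow_to u i (G : 'I_r -> nat -> K) :
  \big[op/idx]_(k in mut_at u | arrow_at u k i) G (pa k) (pm k)
  = if wait u i == (d (pa i))%:Z then
      op (if in_range d ell (pa i) (pm i).+1 then G (pa i) (pm i).+1 else idx)
         (if in_range d ell (pa i) (pm i).-1 then G (pa i) (pm i).-1 else idx)
    else idx.
Proof.
have E k : (k \in mut_at u) && arrow_at u k i =
    [&& wait u k == 0, pa k == pa i, (pm k == (pm i).+1) || (pm i == (pm k).+1) &
        wait u i == (d (pa i))%:Z].
  rewrite inE; case: eqP => //= k0; rewrite arrow_out //.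
  by case: eqP => //= ->; rewrite orbC.
case: eqP => wi; last first.
  by rewrite big_pred0 // => k; rewrite E [_ == (d _)%:Z](introF eqP wi) !andbF.
apply: (@big_step_neighbours u i (fun a n _ => G a n) 0).
- by move: (dpos (pa i)); lia.
- by rewrite addr0 -wi wait_parity.
by move=> k; rewrite E wi eqxx andbT andbC -andbA.
Qed.

Lemma big_arrow_in u i (H : 'I_r -> nat -> int -> K) : wait u i = 0 ->
  \big[op/idx]_(k | arrow_at u k i) H (pa k) (pm k) (wait u k)
  = \big[op/idx]_(b | adj C (pa i) b)
      \big[op/idx]_(k | (pa k == b) && enters u k (pa i) (pm i))
        H (pa k) (pm k) (wait u k).
Proof.
move=> i0; rewrite (partition_big pa (adj C (pa i))) /=; last first.
  by move=> k; rewrite arrow_in // => /andP [ki _]; rewrite adj_sym.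
by apply: eq_bigr => b _; apply: eq_bigl => k; rewrite arrow_in // andbC.
Qed.

Lemma big_enters_flat u i b (H : 'I_r -> nat -> int -> K) :
  wait u i = 0 -> adj C (pa i) b -> d (pa i) = d b ->
  \big[op/idx]_(k | (pa k == b) && enters u k (pa i) (pm i)) H (pa k) (pm k) (wait u k)
  = H b (pm i) (d b)%:Z.
Proof.
move=> i0 ib e; have ir : in_range d ell b (pm i).
  by rewrite -(in_range_eq ell _ e) (coord_range co).
transitivity (if in_range d ell b (pm i) then H b (pm i) (d b)%:Z else idx); last by rewrite ir.
rewrite -(@big_vertex _ idx op H u); first last.
- by have := wait_parity u i; rewrite i0 addr0 -(Qplus'_eqd HP _ _ ib e) e.
- by move: (dpos b); lia.
apply: eq_bigl => k; case: eqP => //= kb.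
rewrite /enters kb adj_sym // ib e eqxx /=.
by case: (d b =P 1%N) => [->|_]; rewrite /= ?andbF ?orbF.
Qed.

Lemma big_enters_short u i b (H : 'I_r -> nat -> int -> K) :
  wait u i = 0 -> adj C (pa i) b -> (1 < d (pa i))%N -> d b = 1%N ->
  \big[op/idx]_(k | (pa k == b) && enters u k (pa i) (pm i)) H (pa k) (pm k) (wait u k)
  = H b (d (pa i) * pm i)%N 1.
Proof.
move=> i0 ib d1 e; have ir : in_range d ell b (d (pa i) * pm i)%N.
  by rewrite (in_range_mul ell HD) // (coord_range co).
transitivity (if in_range d ell b (d (pa i) * pm i)%N then
  H b (d (pa i) * pm i)%N 1 else idx); last by rewrite ir.
rewrite -(@big_vertex _ idx op H u); first last.
- have := wait_parity u i; rewrite i0 addr0 => par.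
  by rewrite (Qplus'_edge HP _ _ ib e par); move: (_ * _)%N => x; lia.
- by lia.
apply: eq_bigl => k; case: eqP => //= kb.
rewrite /enters kb adj_sym // ib e eqxx d1 /= [_ == d (pa i)](negbTE _) //=.
by apply/eqP; lia.
Qed.

(** A lace read from its short end. The height of [i] is at distance [j] from level [m] and
    [d b - j] from level [m.+1], and windows have radius below [d b], so only these two levels
    contribute: they are the two products of [Sterm]. *)
Lemma big_enters_long u i b (H : 'I_r -> nat -> int -> K) :
  wait u i = 0 -> adj C (pa i) b -> d (pa i) = 1%N -> (1 < d b)%N ->
  let m := (pm i %/ d b)%N in let j := (pm i %% d b)%N in
  \big[op/idx]_(k | (pa k == b) && enters u k (pa i) (pm i)) H (pa k) (pm k) (wait u k)
  = op
    (\big[op/idx]_(1 <= q < j.+1)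
       if in_range d ell b m.+1 then H b m.+1 ((d b)%:Z + j%:Z + 1 - 2 * q%:Z) else idx)
    (\big[op/idx]_(1 <= q < (d b - j).+1)
       if in_range d ell b m then H b m (2 * (d b)%:Z - j%:Z + 1 - 2 * q%:Z) else idx).
Proof.
move=> i0 ib e db m j; have bi := ib; rewrite adj_sym // in bi.
have par n w : Qplus' d Ip b n (u + w) = odd `|((pm i)%:Z - (d b * n)%:Z + w)%R|.
  have := wait_parity u i; rewrite i0 addr0 => /(Qplus'_edge_long HP n (u + w) bi e) ->.
  by move: (d b * n)%N => x; lia.
have jlt : (j < d b)%N by rewrite ltn_mod; lia.
have en : pm i = (d b * m + j)%N by rewrite mulnC -divn_eq.
clearbody m j.
pose P n (w : int) := `|(pm i)%:Z - (d b * n)%:Z| <= Num.min w ((2 * d b)%:Z - 1 - w).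
have E k : (pa k == b) && enters u k (pa i) (pm i)
         = (pa k == b) && P (pm k) (wait u k).
  have db1 : (d b == 1%N) = false by apply/eqP; lia.
  by case: eqP => //= kb; rewrite /enters kb bi e db db1 /= orbF.
have PE n k : P n k -> n = m.+1 \/ n = m.
  have [nm|[->|[->|mn]]] : (n < m \/ n = m \/ n = m.+1 \/ m.+1 < n)%N by lia.
  - have : (d b * n.+1 <= d b * m)%N by rewrite leq_mul2l nm orbT.
    by rewrite /P en mulnS; move: (d b * n)%N (d b * m)%N => x y; lia.
  - by right.
  - by left.
  have : (d b * m.+2 <= d b * n)%N by rewrite leq_mul2l mn orbT.
  by rewrite /P en !mulnS; move: (d b * n)%N (d b * m)%N => x y; lia.
(* At distance [d b - c] the window is wide enough for waiting times from [d b - c] to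
   [d b + c - 1]; parity keeps [c] of these [2c] values. *)
have window n c : (c <= d b)%N -> `|(pm i)%:Z - (d b * n)%:Z| = (d b)%:Z - c%:Z ->
    \big[op/idx]_(k | [&& pa k == b, pm k == n & P n (wait u k)]) H (pa k) (pm k) (wait u k)
    = \big[op/idx]_(1 <= q < c.+1) if in_range d ell b n then
        H b n ((d b)%:Z + c%:Z + 1 - 2 * q%:Z) else idx.
  move=> cb dist; rewrite (@big_wait H u b n (P n)).
  pose F (w : nat) := if in_range d ell b n then H b n w%:Z else idx.
  transitivity (\big[op/idx]_(1 <= q < c.+1) F (d b + c + 1 - 2 * q)%N).
    rewrite (@big_progression _ _ (2 * d b)); last by lia.
    rewrite [LHS]big_nat_cond [RHS]big_nat_cond; apply: eq_bigl => w.
    case: ltnP; rewrite ?andbF //= => w_lt; rewrite par /P dist.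
    by move: dist; move: (d b * n)%N (pm i) => x y dist; lia.
  by apply: eq_big_nat => q ql; rewrite /F; case: ifP => // _; congr (H _ _ _); lia.
rewrite (eq_bigl _ _ E) (bigID (fun k => pm k == m.+1)) /=; congr (op _ _).
  rewrite -window; first last.
  - by rewrite en mulnS; move: (d b * m)%N => x; lia.
  - exact: ltnW.
  apply: eq_bigl => k; rewrite -andbA; congr (_ && _).
  by rewrite andbC; case: eqP => [->|].
have -> : 2 * (d b)%:Z - j%:Z + 1 = (d b)%:Z + (d b - j)%N%:Z + 1 by lia.
rewrite -window; first last.
- by rewrite en; move: (d b * m)%N => x; lia.
- exact: leq_subr.
apply: eq_bigl => k; case: (pa k == b) => //=; apply/andP/andP.
  by move=> [/[dup] /PE [-> |->] Pk]; rewrite ?eqxx //.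
by move=> [/eqP -> ->]; split=> //; apply/eqP; lia.
Qed.

End Reindexing.

Section TSolution.
Variables (R : comPzRingType) (g : Tgen d ell -> R).

Let F b n k : R := reval g (Tterm d ell b n k).

(* The T-variable carried by the vertex k at time u. *)
Let X u k : R := F (pa k) (pm k) (u + wait u k - (d (pa k))%:Z).

Let FE b n k : (if in_range d ell b n then F b n k else 1) = F b n k.
Proof. by rewrite /F /Tterm; case: ifP => // nrg; rewrite insubF. Qed.

Lemma prod_arrow_out u i : wait u i = 0 ->
  \prod_(k | arrow_at u i k) X u k = F (pa i) (pm i).-1 u * F (pa i) (pm i).+1 u.
Proof.
move=> i0.
rewrite (big_arrow_out _ (fun b n w => F b n (u + w - (d b)%:Z)) i0) /= !addrK.
by rewrite !FE mulrC.
Qed.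

Lemma prod_arrow_in u i : wait u i = 0 ->
  \prod_(k | arrow_at u k i) X u k =
  if (1 < d (pa i))%N
  then \prod_(b | adj C (pa i) b) F b (d (pa i) * pm i %/ d b)%N u
  else \prod_(b | adj C (pa i) b) reval g (Sterm d ell b (pm i) u).
Proof.
move=> i0; rewrite (big_arrow_in _ (fun b n w => F b n (u + w - (d b)%:Z)) i0) /=.
case: ltnP => di; apply: eq_bigr => b ib.
  have [db|db] : d (pa i) = d b \/ d b = 1%N.
    by case: (adj_d HC HD HT ib); [left | lia | right].
    rewrite (big_enters_flat _ (fun b n w => F b n (u + w - (d b)%:Z)) i0 ib db) /=.
    by rewrite addrK db mulKn // dpos.
  rewrite (big_enters_short _ (fun b n w => F b n (u + w - (d b)%:Z)) i0 ib di db) /=.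
  by rewrite db addrK divn1.
have {di} di : d (pa i) = 1%N by move: (dpos (pa i)); lia.
case: (ltnP 1 (d b)) => db.
  rewrite (big_enters_long _ (fun b n w => F b n (u + w - (d b)%:Z)) i0 ib di db) /=.
  rewrite !reval_prod; congr (_ * _); apply: eq_bigr => q _; rewrite FE; congr (F _ _ _); ring.
have {}db : d b = 1%N by move: (dpos b); lia.
rewrite (big_enters_flat _ (fun b n w => F b n (u + w - (d b)%:Z)) i0 ib) ?di //= addrK.
rewrite /Sterm db divn1 modn1 /= !reval_prod big_geq // mul1r subn0 big_nat1.
by congr (F _ _ _); ring.
Qed.

(** No arrows run both ways at a mutated vertex, so the two monomials are the products over outgoing
    arrows, which stay in the column, and over incoming ones, which come from adjacent columns. *)
Lemma exchange_Trhs u i : wait u i = 0 ->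
  exchange (B_at u) (X u) i = reval g (Trhs C d ell (pa i) (pm i) u).
Proof.
move=> i0; rewrite /Trhs /= addrC /exchange.
have pos k : (0 < B_at u k i) = arrow_at u k i.
  have := @arrow_asym u i k i0; rewrite /B_at.
  by case: (arrow_at u k i) (arrow_at u i k) => [] [] // /(_ isT).
have neg k : (B_at u k i < 0) = arrow_at u i k.
  have := @arrow_asym u i k i0; rewrite /B_at.
  by case: (arrow_at u k i) (arrow_at u i k) => [] [] // /(_ isT).
rewrite (eq_bigl _ _ pos) (eq_bigl _ _ neg); congr (_ + _).
  rewrite (fun_if (reval g)) !reval_prod -prod_arrow_in //; apply: eq_bigr => k ki.
  have := @arrow_asym u i k i0; rewrite /B_at ki.
  by case: (arrow_at u i k) => [/(_ isT)|] // _; rewrite expr1.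
rewrite -[RHS]prod_arrow_out //; apply: eq_bigr => k ik.
by rewrite /B_at ik (arrow_asym i0 ik) expr1.
Qed.

End TSolution.

Lemma wait_shift u i (e : nat) : wait u i = 0 -> (0 < e <= 2 * d (pa i))%N ->
  wait (u + e%:Z) i = (2 * d (pa i))%:Z - e%:Z.
Proof.
move=> i0 e_le; have [q qE] := wait_div u i.
apply: (@wait_eq _ _ _ (q - 1)); last by lia.
by rewrite qE i0; ring.
Qed.

(** * Products over a full period between two mutations of a vertex *)

Section ReindexingY.
Variables (K : Type) (idx : K) (op : Monoid.com_law idx).
Variables (u : int) (i : I) (G : 'I_r -> nat -> int -> K).
Hypothesis i0 : wait u i = 0.

Let D := d (pa i).

Lemma big_mutated (Q : int -> 'I_r -> nat -> bool) s b n :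
  \big[op/idx]_(k | [&& pa k == b, wait s k == 0, pm k == n & Q s b n]) G b n s
  = if [&& in_range d ell b n, Qplus' d Ip b n s & Q s b n] then G b n s else idx.
Proof.
case: (Q s b n); last by rewrite !andbF big_pred0 // => k; rewrite !andbF.
rewrite andbT; case: (boolP (Qplus' d Ip b n s)) => Qs; last first.
  rewrite andbF big_pred0 // => k; apply/negP => /and4P [/eqP kb /eqP k0 /eqP kn _].
  by case/negP: Qs; rewrite -kb -kn -[s]addr0 -k0 wait_parity.
have := @big_vertex _ idx op (fun b n _ => G b n s) s b n 0.
rewrite addr0 andbT => <- //; last by move: (dpos b); lia.
apply: eq_big => [k|k /andP [/eqP kb /and3P [_ /eqP kn _]]]; last by rewrite ?kb ?kn.
by rewrite andbT [(_ == 0) && _]andbC.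
Qed.

Lemma big_arrow_from : \big[op/idx]_(1 <= e < 2 * D)
    \big[op/idx]_(k in mut_at (u + e%:Z) | arrow_at (u + e%:Z) i k)
      G (pa k) (pm k) (u + e%:Z)
  = \big[op/idx]_(b | adj C (pa i) b) \big[op/idx]_(1 <= e < 2 * D)
      \big[op/idx]_(k | [&& pa k == b, wait (u + e%:Z) k == 0 &
                            enters (u + e%:Z) i b (pm k)]) G b (pm k) (u + e%:Z).
Proof.
rewrite exchange_big /=; apply: eq_bigr => e _.
rewrite (partition_big pa (adj C (pa i))) /=; last first.
  by move=> k /andP [+ ]; rewrite inE => /eqP k0; rewrite arrow_in // => /andP [].
apply: eq_bigr => b _; apply: eq_big => [k|k /andP [_ /eqP ->] //].
rewrite inE andbC; case: (pa k =P b) => //= <-.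
by case: (wait _ k =P 0) => //= k0; exact: arrow_in.
Qed.

(** At time [u + e] the vertex [i] waits [2D - e], and a flat arrow into a mutated vertex requires a
    wait of [D]; so only [e = D] contributes. *)
Lemma big_leaves_flat b : adj C (pa i) b -> d b = D ->
  \big[op/idx]_(1 <= e < 2 * D) \big[op/idx]_(k | [&& pa k == b,
     wait (u + e%:Z) k == 0 & enters (u + e%:Z) i b (pm k)]) G b (pm k) (u + e%:Z)
  = G b (pm i) (u + D%:Z).
Proof.
move=> ib db.
have dF : (1 < D)%N && (D == 1%N) = false by lia.
rewrite (eq_big_nat _ _ (F2 := fun e => if (e == D)%N then G b (pm i) (u + e%:Z) else idx)).
  rewrite -big_mkcond (@big_seq_pred1 _ _ op _ _ D) ?iota_uniq //.
  by rewrite mem_index_iota; move: (dpos (pa i)); rewrite -/D; lia.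
move=> e e_lt; rewrite (eq_bigr (fun=> G b (pm i) (u + e%:Z))); last first.
  move=> k /and3P [_ _]; rewrite /enters ib db -/D eqxx !andbA dF /= orbF.
  by case: (pm i =P pm k) => [->|].
rewrite (eq_bigl (fun k => [&& pa k == b, wait (u + e%:Z) k == 0, pm k == pm i &
    e == D])).
  rewrite (@big_mutated (fun _ _ _ => e == D)).
  rewrite -(in_range_eq ell _ (esym db)) (coord_range co) /=; case: eqP => [->|].
    have := wait_parity u i.
    by rewrite i0 addr0 -(Qplus'_eqd HP _ _ ib (esym db)) -/D => ->.
  by rewrite andbF.
move=> k; congr [&& _, _ & _]; rewrite /enters ib db -/D eqxx !andbA dF /= orbF.
by rewrite eq_sym (wait_shift i0) -/D; [congr (_ && _); lia | lia].
Qed.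

(** With [D = 1] only [e = 1] occurs. The window of a long vertex under mutation has shrunk to
    offset 0, whence the divisibility condition. *)
Lemma big_leaves_long b : adj C (pa i) b -> D = 1%N -> (1 < d b)%N ->
  \big[op/idx]_(1 <= e < 2 * D) \big[op/idx]_(k | [&& pa k == b,
     wait (u + e%:Z) k == 0 & enters (u + e%:Z) i b (pm k)]) G b (pm k) (u + e%:Z)
  = if (d b %| pm i)%N then G b (pm i %/ d b)%N (u + D%:Z) else idx.
Proof.
move=> ib D1 db; rewrite D1 big_nat1.
have i1 : wait (u + 1) i = 1 by rewrite (@wait_shift u i 1) // -/D D1.
have E n : enters (u + 1) i b n = (pm i == d b * n)%N.
  have h1 : (1%N == d b) = false by apply/eqP; lia.
  by rewrite /enters ib -/D D1 h1 db i1 eqxx /= andbT.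
case: (boolP (d b %| pm i)%N) => dvd; last first.
  rewrite big_pred0 // => k; rewrite E; apply/negP => /and3P [_ _ /eqP e].
  by rewrite e dvdn_mulr in dvd.
set n := (_ %/ _)%N; have en : pm i = (d b * n)%N by rewrite mulnC divnK.
rewrite (eq_bigr (fun=> G b n (u + 1))); last first.
  by move=> k /and3P [_ _]; rewrite E en eqn_pmul2l ?dpos // => /eqP <-.
rewrite (eq_bigl (fun k => [&& pa k == b, wait (u + 1%N%:Z) k == 0, pm k == n & true])).
  rewrite (@big_mutated (fun _ _ _ => true)) andbT.
  have -> : in_range d ell b n.
    by have := coord_range co i; rewrite en (in_range_mul ell HD).
  have -> : Qplus' d Ip b n (u + 1); last by [].
  have bi := ib; rewrite adj_sym // in bi.
  have par := wait_parity u i; rewrite i0 addr0 in par.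
  rewrite (Qplus'_edge_long HP n (u + 1) bi D1 par) en.
  by move: (d b * n)%N => x; lia.
move=> k; congr [&& _, _ & _].
by rewrite E en eqn_pmul2l ?dpos // eq_sym andbT.
Qed.

(** Time and height are exchanged: at offset [j] from [D * pm i], [i] has an arrow into the vertex
    at the times [e] with |j| <= min(2D - e, e - 1), of which parity keeps D - |j|, in steps of 2.
    This is the double product of [Zterm]. *)
Lemma big_leaves_short b : adj C (pa i) b -> (1 < D)%N -> d b = 1%N ->
  \big[op/idx]_(1 <= e < 2 * D) \big[op/idx]_(k | [&& pa k == b,
     wait (u + e%:Z) k == 0 & enters (u + e%:Z) i b (pm k)]) G b (pm k) (u + e%:Z)
  = \big[op/idx]_(0 <= t < (2 * D).-1)
      (let j : int := t%:Z - D%:Z + 1 in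
       \big[op/idx]_(1 <= q < (D - `|j|%N).+1)
         G b `|(D%:Z * (pm i)%:Z + j)%R|%N
             (u + D%:Z + D%:Z - `|j| + 1 - 2 * q%:Z)).
Proof.
move=> ib D1 db.
have mi : (0 < pm i)%N by case/andP: (coord_range co i).
have par := wait_parity u i; rewrite i0 addr0 in par.
(* The height at offset [t - (D - 1)]; the truncated subtraction is harmless by [Dm]. *)
pose N t := (D * pm i + t - D.-1)%N.
pose Q (e t : nat) := (absz (t%:Z - D%:Z + 1)%R <= minn (2 * D - e) e.-1)%N.
have Dm : (D <= D * pm i)%N by rewrite leq_pmulr.
have EQ e n : (0 < e < 2 * D)%N -> enters (u + e%:Z) i b n =
    (`|n%:Z - (D * pm i)%:Z| <= Num.min ((2 * D)%:Z - e%:Z) (e%:Z - 1)).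
  move=> e_lt; rewrite /enters ib -/D db D1 /= (wait_shift i0) -/D; last by lia.
  have -> : (D == 1%N) = false by apply/eqP; lia.
  by rewrite /= orbF; congr (_ <= Num.min _ _); ring.
transitivity (\big[op/idx]_(1 <= e < 2 * D) \big[op/idx]_(0 <= t < (2 * D).-1)
    if Qplus' d Ip b (N t) (u + e%:Z) && Q e t then G b (N t) (u + e%:Z) else idx).
  apply: eq_big_nat => e e_lt.
  have QN t : Q e t = (`|(N t)%:Z - (D * pm i)%:Z|
                        <= Num.min ((2 * D)%:Z - e%:Z) (e%:Z - 1)).
    by rewrite /Q /N; move: Dm; move: (D * pm i)%N => x; lia.
  transitivity (\big[op/idx]_(0 <= t < (2 * D).-1)
     \big[op/idx]_(k | [&& pa k == b, wait (u + e%:Z) k == 0, pm k == N t & Q e t])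
        G b (N t) (u + e%:Z)).
    rewrite (exchange_big_dep (fun k => [&& pa k == b, wait (u + e%:Z) k == 0 &
        enters (u + e%:Z) i b (pm k)])) /=; last first.
      by move=> t k _ /and4P [-> -> /eqP ->]; rewrite QN EQ.
    apply: eq_bigr => k /and3P [kb k0 ek].
    move: (ek); rewrite EQ // => ek'.
    have [t t_lt kt] : exists2 t, (t < (2 * D).-1)%N & pm k = N t.
      exists (pm k + D.-1 - D * pm i)%N; rewrite /N; move: ek' Dm;
        move: (D * pm i)%N (pm k) => x y; lia.
    rewrite (@big_seq_pred1 _ _ op _ _ t) ?iota_uniq ?mem_index_iota ?kt //.
    move=> t' _; rewrite /= kb k0 /= QN; apply/andP/eqP => [[/eqP e1 _]|->].
      by move: e1 Dm t_lt; rewrite /N; move: (D * pm i)%N => x; lia.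
    by rewrite eqxx -kt.
  apply: eq_bigr => t _; rewrite (@big_mutated (fun _ _ _ => Q e t)).
  case: (boolP (Q e t)) => Qet; last by rewrite !andbF.
  rewrite (_ : in_range d ell b (N t) = true) ?andbT //.
  apply: (in_range_near db (coord_range co i)); move: Qet; rewrite QN -/D.
  by move: (D * pm i)%N (N t) => x y; lia.
rewrite exchange_big; apply: eq_big_nat => t /andP [_ t_lt] /=.
set j := t%:Z - D%:Z + 1; pose F (w : nat) := G b (N t) (u + w%:Z).
have jlt : (`|j|%N < D)%N by rewrite /j; lia.
transitivity (\big[op/idx]_(1 <= q < (D - `|j|%N).+1) F (2 * D - `|j| + 1 - 2 * q)%N).
  rewrite (@big_progression _ _ op _ _ (2 * D)); last by lia.
  (* The progression is indexed from 0, the times from 1; the term at 0 is excluded because the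
     progression stays at or above |j| + 1. *)
  rewrite -big_mkcond [RHS]big_ltn_cond; last by lia.
  rewrite [X in if X then _ else _]negbTE; last by lia.
  rewrite [LHS]big_nat_cond [RHS]big_nat_cond; apply: eq_bigl => e.
  case: (boolP (0 < e < 2 * D)%N) => //= e_lt.
  rewrite (Qplus'_edge HP _ _ ib db par) /Q -/j -/D.
  have -> : (N t)%:Z - (D * pm i)%:Z = j.
    by rewrite /N /j; move: Dm; move: (D * pm i)%N => x; lia.
  have oddE (x : int) : odd `|(x + u + (u + e%:Z))%R| = (odd e == ~~ odd `|x|).
    by rewrite !odd_abszE; move: (odd `|x|) (odd `|u|) (odd e) => [] [] [].
  rewrite oddE; move: `|j|%N jlt => J J_lt; rewrite addn1 /= oddB ?oddM /=; last first.
    by rewrite mul2n -addnn ltnW // ltn_addr.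
  rewrite andbA [RHS]andbC; apply: andb_id2l => /eqP oe.
  rewrite leq_min andbC; congr (_ && _); first by move: e_lt J_lt; clear; lia.
  by move: oe e_lt J_lt; clear; lia.
apply: eq_big_nat => q q_lt; rewrite /F; congr (G _ _ _); last by lia.
have -> : D%:Z * (pm i)%:Z = (D * pm i)%N%:Z by rewrite PoszM.
by rewrite /N /j; move: Dm; move: (D * pm i)%N => x; lia.
Qed.

End ReindexingY.

Section YSolution.
Variables (P : semifieldType) (g : Iell d ell -> P).

Let F b n k : P := seval g (Yterm d ell b n k).

(** Everything that [y i] picks up between two consecutive mutations. A mutated vertex that [i]
    points to gives 1 + Y, hence [Ynum]; one pointing to [i] gives Y/(1 + Y), the inverse of 1 +
    Y^{-1}, hence [Yden]. The relation is dated by the middle of the period. *)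
Lemma prod_y_factor u i : wait u i = 0 ->
  \big[*%g/1%g]_(1 <= e < 2 * d (pa i))
    \big[*%g/1%g]_(k in mut_at (u + e%:Z))
      y_factor (B_at (u + e%:Z) k i) (F (pa k) (pm k) (u + e%:Z))
  = seval g (SMul (Ynum C d ell (pa i) (pm i) (u + (d (pa i))%:Z))
      (SInv (SMul (Yden d ell (pa i) (pm i).-1 (u + (d (pa i))%:Z))
                  (Yden d ell (pa i) (pm i).+1 (u + (d (pa i))%:Z))))).
Proof.
move=> i0; set v := u + (d (pa i))%:Z.
have split_factor s k (y : P) : k \in mut_at s -> y_factor (B_at s k i) y
    = ((if arrow_at s i k then sadd 1 y else 1)
       * (if arrow_at s k i then y / sadd 1 y else 1))%g.
  rewrite inE => /eqP k0; have := @arrow_asym s k i k0; rewrite /B_at.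
  by case: (arrow_at s k i) (arrow_at s i k) => [] [] /= => [/(_ isT)//|_|_|_];
    rewrite /y_factor /= ?mulg1 ?mul1g ?expg1.
under eq_bigr => e _.
  under eq_bigr => k kM do rewrite split_factor //.
  rewrite big_split /= -!big_mkcondr.
  over.
rewrite big_split /=; congr (_ * _)%g.
  rewrite (big_arrow_from _ _ _ (fun b n s => sadd 1 (F b n s))%g) /Ynum.
  have D0 := dpos (pa i).
  case: (ltnP 1 (d (pa i))) => di; rewrite seval_prod; last first.
    have {}di : d (pa i) = 1%N by lia.
    rewrite [RHS]big_mkcondr; apply: eq_bigr => b ib.
    case: (ltnP 1 (d b)) => db.
      exact: (big_leaves_long _ (fun b n s => sadd 1 (F b n s))%g i0 ib di db).
    have {}db : d b = d (pa i) by move: (dpos b); lia.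
    rewrite (big_leaves_flat _ (fun b n s => sadd 1 (F b n s))%g i0 ib db).
    have -> : (d b %| pm i)%N by rewrite db di dvd1n.
    by have -> : (pm i %/ d b)%N = pm i by rewrite db di divn1.
  apply: eq_bigr => b ib.
  have [db|db] : d b = d (pa i) \/ d b = 1%N.
    by case: (adj_d HC HD HT ib); [left | lia | right].
    rewrite (big_leaves_flat _ (fun b n s => sadd 1 (F b n s))%g i0 ib db).
    rewrite /Zterm seval_prod db divnn D0 big_nat1 /= seval_prod big_nat1 /=.
    by congr (sadd 1%g (F _ _ _)); rewrite /v; lia.
  rewrite (big_leaves_short _ (fun b n s => sadd 1 (F b n s))%g i0 ib di db).
  rewrite /Zterm seval_prod db divn1; apply: eq_bigr => t _.
  by rewrite seval_prod.
(* Arrows from mutated vertices to [i] run inside its column and occur only at half period. *)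
rewrite (eq_big_nat _ _ (F2 := fun e => if e == d (pa i) then
  (((if in_range d ell (pa i) (pm i).+1 then F (pa i) (pm i).+1 v
       / sadd 1 (F (pa i) (pm i).+1 v) else 1))
  * ((if in_range d ell (pa i) (pm i).-1 then F (pa i) (pm i).-1 v
       / sadd 1 (F (pa i) (pm i).-1 v) else 1)))%g else 1%g)).
  rewrite -big_mkcond (@big_seq_pred1 _ _ _ _ _ (d (pa i))) ?iota_uniq //; last first.
    by rewrite mem_index_iota; move: (dpos (pa i)); lia.
  have den n : seval g (Yden d ell (pa i) n v) = ((if in_range d ell (pa i) n
      then F (pa i) n v / sadd 1 (F (pa i) n v) else 1)^-1)%g.
    rewrite /Yden; case: ifP => _ /=; last by rewrite invg1.
    by rewrite -/(F _ _ _) invgF smulC smulDr mulg1 mulVg saddC.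
  by rewrite /= !den -invgM invgK.
move=> e e_lt.
rewrite (big_arrow_to _ _ _ (fun b n => F b n (u + e%:Z) / sadd 1 (F b n (u + e%:Z)))%g).
rewrite (wait_shift i0); last by lia.
have -> : ((2 * d (pa i))%:Z - e%:Z == (d (pa i))%:Z) = (e == d (pa i)) by lia.
by case: eqP => // ->.
Qed.

End YSolution.

(** * The T-subalgebra *)

Lemma B_atS u : mutB_set (mut_at u) (B_at u) = B_at (u + 1).
Proof. by apply/funext=> i; apply/funext=> j; rewrite B_at_step. Qed.

Lemma B_at_pred u : mutB_set (mut_at u) (B_at (u + 1)) = B_at u.
Proof.
by apply/funext=> i; apply/funext=> j; rewrite -B_atS mutB_setK.
Qed.

Lemma B_atS_independent u : independent (mut_at u) (B_at (u + 1)).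
Proof. by rewrite -B_atS; apply: mutB_set_independent; exact: B_at_independent. Qed.

Lemma set_rev_enum (A : {set I}) : [set k in rev (enum A)] = A.
Proof. by apply/setP => k; rewrite inE mem_rev mem_enum. Qed.

Lemma wait_coords k i j : pa i = pa j -> pm i = pm j -> wait k i = wait k j -> i = j.
Proof.
move=> ea em ew; apply: (coord_inj co) => //.
have [q ->] := wait_div k i; have [q' ->] := wait_div k j.
rewrite ew -ea; apply/eqP; rewrite eqz_mod_dvd.
by apply/dvdzP; exists (q - q'); ring.
Qed.

Definition vertex_at (a : 'I_r) (m : nat) (s k : int) : option I :=
  [pick i | [&& pa i == a, pm i == m & wait k i == s]].

Lemma vertex_atE k i : vertex_at (pa i) (pm i) (wait k i) k = Some i.
Proof.
rewrite /vertex_at; case: pickP => [j|/(_ i)]; last by rewrite !eqxx.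
by case/and3P => /eqP ea /eqP em /eqP ew; rewrite (wait_coords ea em ew).
Qed.

Lemma vertex_at_none a m s k : ~~ Qplus' d Ip a m (k + s) -> vertex_at a m s k = None.
Proof.
move=> nQ; rewrite /vertex_at; case: pickP => // i /and3P [/eqP ia /eqP im /eqP iw].
by rewrite -ia -im -iw wait_parity in nQ.
Qed.

Lemma vertex_at_out a m s k : ~~ in_range d ell a m -> vertex_at a m s k = None.
Proof.
move=> nr; rewrite /vertex_at; case: pickP => // i /and3P [/eqP ia /eqP im _].
by rewrite -ia -im (coord_range co) in nr.
Qed.

Lemma vertex_at_some a m s k : in_range d ell a m -> Qplus' d Ip a m (k + s) ->
  0 <= s < (2 * d a)%:Z -> exists i, [/\ pa i = a, pm i = m & wait k i = s].
Proof.
move=> rg par s_lt; have [i [ia im ik]] := coord_surj co rg par.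
exists i; split=> //; move/eqP: ik; rewrite eqz_mod_dvd => /dvdzP [q e].
by apply: (@wait_eq _ _ _ q); rewrite ia //; rewrite -e; ring.
Qed.

Section TIsomorphism.

Let x (k : int) (i : I) : ratfun I := triv_x (B_at 0) mut_at i k.

Lemma subfree_prod (J : finType) (Q : pred J) (F : J -> ratfun I) (n : J -> nat) :
  (forall j, subfree (F j)) -> subfree (\prod_(j | Q j) F j ^+ n j).
Proof.
move=> Fs; elim/big_ind: _ => [||j _]; [exact: subfree1 | exact: subfreeM |].
by elim: (n j) => [|m IH]; [exact: subfree1 | rewrite exprS; exact: subfreeM].
Qed.

Lemma subfree_exchange (B : I -> I -> int) (z : I -> ratfun I) i :
  (forall j, subfree (z j)) -> subfree (exchange B z i).
Proof. by move=> zs; apply: subfreeD; exact: subfree_prod. Qed.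

(** Subtraction-freeness is carried along because it keeps the variables and the exchange
    polynomials nonzero, as required for undoing a mutation at negative times. *)
Lemma triv_x_step k : (forall i, subfree (x k i)) /\
  x (k + 1) = mutx_set (mut_at k) (B_at k) (x k).
Proof.
pose V k (s : seed I triv_sf (ratfun I)) :=
  (forall i, subfree (seed_x s i)) /\ seed_y s = YSeed (B_at k) (fun=> Triv).
pose c k (s : seed I triv_sf (ratfun I)) :=
  Seed (YSeed (mutB_set (mut_at k) (yB (seed_y s))) (fun=> Triv))
       (mutx_set (mut_at k) (yB (seed_y s)) (seed_x s)).
have mut_sf A B (z : I -> ratfun I) i : (forall j, subfree (z j)) ->
    subfree (mutx_set A B z i).
  move=> zs; rewrite /mutx_set; case: ifP => // _.
  by apply: subfreeM; [exact: subfree_exchange | exact: subfreeV].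
have [[sf ye] e] : V k (evolve (mutate (fun _ : triv_sf => 1)) mut_at
      (Seed (YSeed (B_at 0) (fun=> Triv)) (@ratvar I)) k) /\
    evolve (mutate (fun _ : triv_sf => 1)) mut_at
      (Seed (YSeed (B_at 0) (fun=> Triv)) (@ratvar I)) (k + 1)
    = c k (evolve (mutate (fun _ : triv_sf => 1)) mut_at
      (Seed (YSeed (B_at 0) (fun=> Triv)) (@ratvar I)) k).
  apply: evolveP => {k} [|k [ys z] [/= zs ->]|k [ys z] [/= zs ->]].
  - by split=> // i; exact: subfree_var.
  - rewrite mutate_seq_triv ?enum_uniq ?set_enum //; last exact: B_at_independent.
    by rewrite /c /= B_atS; split=> //; split=> //= i; exact: mut_sf.
  rewrite mutate_seq_triv ?rev_uniq ?enum_uniq ?set_rev_enum //;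
    last exact: B_atS_independent.
  rewrite /c /= B_at_pred; split=> //; first by split=> //= i; exact: mut_sf.
  rewrite B_atS; congr Seed; apply/funext=> i.
  rewrite -[X in mutx_set _ X (mutx_set _ _ _)](B_at_pred k) mutx_setK //.
  + exact: B_atS_independent.
  + by move=> j; exact: subfree_neq0.
  + by move=> _; apply/subfree_neq0/subfree_exchange.
by split=> //; apply/funext=> i; rewrite /x /triv_x e /= ye.
Qed.

Lemma triv_x_neq0 k i : x k i != 0.
Proof. by apply: subfree_neq0; have [] := triv_x_step k. Qed.

Lemma triv_x_unmutated k i : wait k i != 0 -> x (k + 1) i = x k i.
Proof.
have [_ ->] := triv_x_step k; rewrite /mutx_set inE => /negbTE -> //.
Qed.

Lemma triv_x_mutated k i : wait k i = 0 ->
  x k i * x (k + 1) i = exchange (B_at k) (x k) i.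
Proof.
have [_ ->] := triv_x_step k; rewrite /mutx_set inE => ->; rewrite eqxx.
by rewrite mulrC divfK // triv_x_neq0.
Qed.

Lemma triv_x_const k i (n : nat) : n%:Z <= wait k i -> x (k + n%:Z) i = x k i.
Proof.
elim: n => [|n IH] n_le; first by rewrite addr0.
rewrite -IH; last by lia.
have [q qE] := wait_div k i; have wl := wait_lt k i.
have w : wait (k + n%:Z) i = wait k i - n%:Z.
  by apply: (@wait_eq _ _ _ q); [rewrite {1}qE; ring | lia].
have -> : k + n.+1%:Z = k + n%:Z + 1 by lia.
by rewrite triv_x_unmutated // w; lia.
Qed.

Lemma wait_half k i : wait (k + wait k i - (d (pa i))%:Z) i = (d (pa i))%:Z.
Proof.
have [q qE] := wait_div k i; have := dpos (pa i).
by move=> d0; apply: (@wait_eq _ _ _ q); [rewrite {1}qE; ring | lia].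
Qed.

(** Both times lie between the same two consecutive mutations of [i], where the variable is
    constant; the left one is half a period before the later mutation. *)
Lemma triv_x_half k i : x (k + wait k i - (d (pa i))%:Z) i = x k i.
Proof.
have wl := wait_lt k i; have wg := wait_ge0 k i; have wh := wait_half k i.
have [w_ge|w_lt] := lerP (d (pa i))%:Z (wait k i).
  have e : k + wait k i - (d (pa i))%:Z = k + `|wait k i - (d (pa i))%:Z|%N%:Z by lia.
  by rewrite e triv_x_const //; lia.
set k' := k + _ - _ in wh *.
have -> : k = k' + `|(d (pa i))%:Z - wait k i|%N%:Z by rewrite /k'; lia.
by rewrite triv_x_const // wh; lia.
Qed.

(** A vertex at half period exists at time [k] for one parity only; for the other the value at
    [k + 1] is borrowed. Both searches fail exactly outside the range of [m]. *)
Definition T_value (a : 'I_r) (m : nat) (k : int) : ratfun I :=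
  if vertex_at a m (d a)%:Z k is Some i then x k i
  else if vertex_at a m (d a)%:Z (k + 1) is Some i then x (k + 1) i else 1.

Lemma T_valueE k i : T_value (pa i) (pm i) (k + wait k i - (d (pa i))%:Z) = x k i.
Proof.
have := vertex_atE (k + wait k i - (d (pa i))%:Z) i; rewrite wait_half /T_value => ->.
exact: triv_x_half.
Qed.

Lemma T_value_out a m k : ~~ in_range d ell a m -> T_value a m k = 1.
Proof. by move=> nr; rewrite /T_value !vertex_at_out. Qed.

Lemma T_value_shift a m k : ~~ Qplus' d Ip a m (k + (d a)%:Z) ->
  T_value a m k = T_value a m (k + 1).
Proof.
move=> nQ; rewrite /T_value vertex_at_none //.
case: (vertex_at a m (d a)%:Z (k + 1)) => [//|].
rewrite vertex_at_none //.
have -> : k + 1 + 1 + (d a)%:Z = k + (d a)%:Z + 2 * 1 by ring.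
by rewrite Qplus'_even.
Qed.

Lemma T_value_neq0 a m k : T_value a m k != 0.
Proof.
rewrite /T_value; case: vertex_at => [i|]; first exact: triv_x_neq0.
by case: vertex_at => [i|]; [exact: triv_x_neq0 | exact: oner_neq0].
Qed.

(** Every variable on the right side of a relation of the wrong parity is itself of the wrong
    parity, so it may be moved by one unit of time factor by factor. *)
Lemma Trhs_shift (R : comPzRingType) (g : Tgen d ell -> R) a m k :
  (forall b n k', ~~ Qplus' d Ip b n (k' + (d b)%:Z) ->
     reval g (Tterm d ell b n k') = reval g (Tterm d ell b n (k' + 1))) ->
  (0 < m)%N -> ~~ Qplus' d Ip a m k ->
  reval g (Trhs C d ell a m k) = reval g (Trhs C d ell a m (k + 1)).
Proof.
move=> gS m0 nQ; rewrite /Trhs /=; congr (_ * _ + _).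
- by apply: gS; rewrite (@Qplus'_same _ d Ip a m) //; right; rewrite prednK.
- by apply: gS; rewrite (@Qplus'_same _ d Ip a m) //; left.
case: ltnP => da; rewrite !reval_prod; apply: eq_bigr => b ab.
  apply: gS; have [db|db] : d a = d b \/ d b = 1%N.
    by case: (adj_d HC HD HT ab); [left | lia | right].
    by rewrite -db mulKn ?dpos // (Qplus'_eqd HP _ _ ab db).
  have := Qplus'_eq_edge HP m (d a * m) k (k + (d b)%:Z) ab db.
  rewrite (negbTE nQ) db divn1 eq_sym eqbF_neg => ->.
  by move: (d a * m)%N => y; lia.
have {}da : d a = 1%N by move: (dpos a); lia.
have ba := ab; rewrite adj_sym // in ba.
rewrite /Sterm /= !reval_prod; set q := (m %/ d b)%N; set j := (m %% d b)%N.
have em : m = (d b * q + j)%N by rewrite mulnC -divn_eq.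
have jlt : (j < d b)%N by rewrite ltn_mod dpos.
congr (_ * _); apply: eq_big_nat => e e_lt.
  have -> : k + 1 + j%:Z + 1 - 2 * e%:Z = k + j%:Z + 1 - 2 * e%:Z + 1 by ring.
  apply: gS.
  have := Qplus'_eq_edge HP q.+1 m (k + j%:Z + 1 - 2 * e%:Z + (d b)%:Z) k ba da.
  rewrite (negbTE nQ) eqbF_neg => ->.
  by rewrite {1}em mulnS; move: (d b * q)%N => y; lia.
have -> : k + 1 + (d b)%:Z - j%:Z + 1 - 2 * e%:Z
  = k + (d b)%:Z - j%:Z + 1 - 2 * e%:Z + 1 by ring.
apply: gS.
have := Qplus'_eq_edge HP q m (k + (d b)%:Z - j%:Z + 1 - 2 * e%:Z + (d b)%:Z) k ba da.
rewrite (negbTE nQ) eqbF_neg => ->.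
by rewrite {1}em; move: (d b * q)%N => y; lia.
Qed.

Definition T_eval (t : Tgen d ell) : ratfun I :=
  match t with
  | Tpos y => T_value (val y).1.1 (val y).1.2 (val y).2
  | Tneg y => (T_value (val y).1.1 (val y).1.2 (val y).2)^-1
  end.

Lemma T_eval_term a m k : reval T_eval (Tterm d ell a m k) = T_value a m k.
Proof.
rewrite /Tterm; case: insubP => [y _ e|] /=; first by rewrite e.
by move/T_value_out => ->.
Qed.

Lemma T_eval_rel s t : Trel C s t -> reval T_eval s = reval T_eval t.
Proof.
case=> [y|a m k rg]; first by rewrite /= mulfV // T_value_neq0.
have main k' : Qplus' d Ip a m k' ->
    T_value a m (k' - (d a)%:Z) * T_value a m (k' + (d a)%:Z)
    = reval T_eval (Trhs C d ell a m k').
  move=> Q; have d0 := dpos a.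
  have [i [ia im i0]] : exists i, [/\ pa i = a, pm i = m & wait k' i = 0].
    by apply: vertex_at_some; rewrite ?addr0 //; lia.
  rewrite -ia -im -exchange_Trhs //.
  have -> : exchange (B_at k') (fun j => reval T_eval (Tterm d ell (pa j) (pm j)
      (k' + wait k' j - (d (pa j))%:Z))) i = exchange (B_at k') (x k') i.
    apply: (congr1 (fun z => exchange (B_at k') z i)); apply/funext => j.
    by rewrite T_eval_term T_valueE.
  rewrite -triv_x_mutated // -!T_valueE i0 addr0 waitS i0 eqxx.
  by congr (_ * T_value _ _ _); ring.
rewrite [LHS]/= !T_eval_term.
have [Q|nQ] := boolP (Qplus' d Ip a m k); first exact: main.
have Q2 : ~~ Qplus' d Ip a m (k + (d a)%:Z + (d a)%:Z).
  by rewrite -addrA -mulr2n -mulr_natl Qplus'_even.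
rewrite (@T_value_shift a m (k - (d a)%:Z)) ?subrK // (@T_value_shift a m (k + (d a)%:Z)) //.
rewrite (@Trhs_shift _ T_eval); first last.
- exact: nQ.
- by case/andP: rg.
- by move=> b n k' nQ'; rewrite !T_eval_term; exact: T_value_shift.
rewrite -main ?Qplus'S //; congr (T_value _ _ _ * T_value _ _ _); ring.
Qed.

(* The generator of the T-ring corresponding to the cluster variable x k i. *)
Let tv k i : Tring C d ell :=
  Tvar C d ell (pa i) (pm i) (k + wait k i - (d (pa i))%:Z).

Lemma Tvar_unit a m k : in_range d ell a m ->
  exists t : Tring C d ell, t * Tvar C d ell a m k = 1.
Proof.
move=> rg; pose y : Iell d ell := exist _ (a, m, k) rg.
exists (pr_class (Trel C (ell := ell)) (RGen (Tneg y))).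
rewrite /Tvar /Tterm; case: insubP => [z _ e|]; last by rewrite rg.
have -> : z = y by apply: val_inj.
rewrite mulrC -[LHS]/(pr_mul _ _) pr_mulE; exact/pr_classP/rcong_rel/Trel_inv.
Qed.

Lemma Tvar_exchange k i : wait k i = 0 ->
  tv k i * tv (k + 1) i = exchange (B_at k) (tv k) i.
Proof.
move=> i0.
pose gen y : Tring C d ell := pr_class (Trel C (ell := ell)) (RGen y).
have -> : exchange (B_at k) (tv k) i = reval gen (Trhs C d ell (pa i) (pm i) k).
  rewrite -exchange_Trhs //; apply: (congr1 (fun z => exchange (B_at k) z i)).
  by apply/funext => j; rewrite /tv /Tvar pr_class_reval.
rewrite -pr_class_reval /tv /Tvar waitS i0 eqxx addr0.
have -> : k + 1 + ((2 * d (pa i))%:Z - 1) - (d (pa i))%:Z = k + (d (pa i))%:Z by lia.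
rewrite -[LHS]/(pr_mul _ _) pr_mulE; apply/pr_classP/rcong_rel/Trel_sys.
exact: (coord_range co).
Qed.

Lemma tv_unmutated k i : wait k i != 0 -> tv (k + 1) i = tv k i.
Proof.
move=> iw; rewrite /tv waitS (negbTE iw); congr (Tvar _ _ _ _ _ _); ring.
Qed.

Let sf := same_fraction (tv 0) (@ratvar I).

(** Only vertices not mutated at time [k] occur in the exchange polynomial, and in the backward
    induction they are the only ones known beforehand. *)
Lemma same_fraction_exchange k i : wait k i = 0 ->
  (forall j, wait k j != 0 -> sf (tv k j) (x k j)) ->
  sf (exchange (B_at k) (tv k) i) (exchange (B_at k) (x k) i).
Proof.
move=> i0 sfj; have B0 j : wait k j = 0 -> B_at k j i = 0.
  by move=> j0; apply: B_at_independent; rewrite inE ?j0 ?i0.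
have sfX a w n : sf a w -> sf (a ^+ n) (w ^+ n).
  move=> saw; elim: n => [|n IH]; first exact: same_fraction1.
  by rewrite !exprS; exact: same_fractionM.
by apply: same_fractionD; apply: same_fraction_prod => j Bji; apply/sfX/sfj;
   apply: contraTneq Bji => /B0 ->; rewrite ltxx.
Qed.

Lemma tv_unit k i : exists t, t * tv k i = 1.
Proof. by apply: Tvar_unit; exact: (coord_range co). Qed.

Lemma same_fraction_quotient (a b e : Tring C d ell) (v w f : ratfun I) :
  a * b = e -> v * w = f -> (exists t, t * a = 1) -> v != 0 ->
  sf a v -> sf e f -> sf b w.
Proof.
move=> ab vw [t ta] v0 sav sef.
have -> : b = e * t by rewrite -ab mulrAC [a * t]mulrC ta mul1r.
have -> : w = f * v^-1 by rewrite -vw mulrAC mulfV ?mul1r.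
by apply: same_fractionM => //; exact: same_fractionV ta v0 sav.
Qed.

(** Induction in both directions from time 0, where both families are the initial variables. The
    exchange relation holds in both rings and is solved for its one new variable, the other factor
    being a unit in the T-ring and nonzero in the field. *)
Lemma same_fraction_tv k i : sf (tv k i) (x k i).
Proof.
have up j : (forall i, sf (tv j i) (x j i)) -> forall i, sf (tv (j + 1) i) (x (j + 1) i).
  move=> H l; have [l0|l0] := eqVneq (wait j l) 0; last first.
    by rewrite tv_unmutated // triv_x_unmutated.
  apply: same_fraction_quotient (Tvar_exchange l0) (triv_x_mutated l0) _ _ (H l) _.
  - exact: tv_unit.
  - exact: triv_x_neq0.
  - by apply: same_fraction_exchange => // *; exact: H.
have down j : (forall i, sf (tv (j + 1) i) (x (j + 1) i)) -> forall i, sf (tv j i) (x j i).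
  move=> H; have unm l : wait j l != 0 -> sf (tv j l) (x j l).
    by move=> l0; rewrite -tv_unmutated // -triv_x_unmutated.
  move=> l; have [l0|] := eqVneq (wait j l) 0; last exact: unm.
  have e1 := Tvar_exchange l0; rewrite mulrC in e1.
  have e2 := triv_x_mutated l0; rewrite mulrC in e2.
  apply: same_fraction_quotient e1 e2 _ _ (H l) _.
  - exact: tv_unit.
  - exact: triv_x_neq0.
  - exact: same_fraction_exchange.
have base l : sf (tv 0 l) (x 0 l) by exact: same_fraction_var.
case: k i => n.
  elim: n => // n IH l; have := up _ IH l.
  by rewrite -PoszD addn1.
rewrite NegzE; elim: n => [|n IH]; first by apply: down; rewrite addNr.
by apply: down; have -> : - n.+2%:Z + 1 = - n.+1%:Z by lia.
Qed.

Theorem T_isomorphism :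
  exists f : {rmorphism Tcirc_plus C d ell Ip -> A_T (B_at 0) mut_at}, bijective f.
Proof.
have [f fE] := pring_lift T_eval_rel.
have ftv k i : f (tv k i) = x k i by rewrite fE T_eval_term T_valueE.
have gen_tv a m k : in_range d ell a m -> Qplus d Ip a m k ->
    exists i, Tvar C d ell a m k = tv k i.
  move=> rg Q; have [||i [ia im iw]] := @vertex_at_some a m (d a)%:Z k rg.
  - by rewrite -Qplus_half addrK.
  - by move: (dpos a); lia.
  by exists i; rewrite /tv iw ia im addrK.
have tv_gen k i : Qplus d Ip (pa i) (pm i) (k + wait k i - (d (pa i))%:Z).
  by rewrite Qplus_half wait_parity.
apply: (@gen_subring_iso _ _ _ _ f).
- move=> y [a [m [k [rg Q ->]]]]; have [i ->] := gen_tv _ _ _ rg Q.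
  by apply: subring_gen_in; exists i, k; rewrite ftv.
- move=> y [i [k ->]]; exists (tv k i); last exact: ftv.
  apply: subring_gen_in; exists (pa i), (pm i), (k + wait k i - (d (pa i))%:Z).
  by split; [exact: (coord_range co) | exact: tv_gen |].
(* Carrying the comparison from the generators to all elements of the subring makes an image 0 force
   the element to vanish. *)
move=> y yG fy0; suff : sf y (f y).
  rewrite fy0; apply: same_fraction_eq0 => t; exact: reval_ratvar_eq0.
elim: yG {fy0} => [z [a [m [k [rg Q ->]]]]||z w _ sz _ sw|z w _ sz _ sw].
- by have [i ->] := gen_tv _ _ _ rg Q; rewrite ftv; exact: same_fraction_tv.
- by rewrite rmorph1; exact: same_fraction1.
- by rewrite rmorphB; exact: same_fractionB.
- by rewrite rmorphM; exact: same_fractionM.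
Qed.

End TIsomorphism.

(** * The Y-subgroup *)

Lemma y_factor_hom (P P' : semifieldType) (f : P -> P') b z :
  sfhom f -> f (y_factor b z) = y_factor b (f z).
Proof.
move=> fh; have f1z : f (sadd 1%g z) = sadd 1%g (f z) by rewrite (sfhomD fh) (sfhom1 fh).
rewrite /y_factor; case: ifP => _; rewrite (sfhomX fh) ?f1z //.
by rewrite (sfhomM fh) (sfhomV fh) f1z.
Qed.

Lemma muty_set_hom (P P' : semifieldType) (f : P -> P') A (B : I -> I -> int) z i :
  sfhom f -> f (muty_set A B z i) = muty_set A B (f \o z) i.
Proof.
move=> fh; rewrite /muty_set; case: ifP => _; first exact: sfhomV.
rewrite (sfhomM fh) (sfhom_prod fh); congr (_ * _)%g.
by apply: eq_bigr => k _; exact: y_factor_hom.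
Qed.

Definition contribution (P : semifieldType) (z : int -> I -> P) (k : int) (i : I) : P :=
  \big[*%g/1%g]_(j in mut_at k) y_factor (B_at k j i) (z k j).

Section Evolution.
Variables (P : semifieldType) (z : int -> I -> P).
Hypothesis z_step : forall k, z (k + 1) = muty_set (mut_at k) (B_at k) (z k).

Lemma evolution_mutated k i : wait k i = 0 -> z (k + 1) i = ((z k i)^-1)%g.
Proof. by move=> i0; rewrite z_step /muty_set inE i0 eqxx. Qed.

Lemma evolution_unmutated k i : wait k i != 0 ->
  z (k + 1) i = (z k i * contribution z k i)%g.
Proof. by move=> i0; rewrite z_step /muty_set inE (negbTE i0). Qed.

Lemma evolution_back k : z k = muty_set (mut_at k) (B_at (k + 1)) (z (k + 1)).
Proof.
by apply/funext=> i; rewrite z_step -B_atS muty_setK.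
Qed.

(** The mutation at [k] inverts the value, and up to [k + 2d] it is only multiplied by the
    contributions of other vertices. *)
Lemma evolution_period k i : wait k i = 0 ->
  (z k i * z (k + (2 * d (pa i))%:Z) i)%g
  = \big[*%g/1%g]_(1 <= e < 2 * d (pa i)) contribution z (k + e%:Z) i.
Proof.
move=> i0; have d0 := dpos (pa i).
suff H n : (n < 2 * d (pa i))%N -> z (k + n.+1%:Z) i
    = ((z k i)^-1 * \big[*%g/1%g]_(1 <= e < n.+1) contribution z (k + e%:Z) i)%g.
  have := H (2 * d (pa i)).-1; rewrite prednK; last by lia.
  by move=> ->; [rewrite mulgA mulgV mul1g | lia].
elim: n => [|n IH] n_lt; first by rewrite big_geq // mulg1 evolution_mutated.
have -> : k + n.+2%:Z = k + n.+1%:Z + 1 by lia.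
rewrite evolution_unmutated; last by rewrite (wait_shift i0); lia.
by rewrite IH 1?ltnW // [in RHS]big_nat_recr //= mulgA.
Qed.

End Evolution.

Section YIsomorphism.

Let y (k : int) (i : I) : Qsf I := coef_y (B_at 0) mut_at i k.

Lemma coef_y_step k : y (k + 1) = muty_set (mut_at k) (B_at k) (y k).
Proof.
pose V k (s : yseed I (Qsf I)) := yB s = B_at k.
pose c k (s : yseed I (Qsf I)) :=
  YSeed (mutB_set (mut_at k) (yB s)) (muty_set (mut_at k) (yB s) (yy s)).
have [ye e] : V k (evolve (@mutate_y I (Qsf I)) mut_at (YSeed (B_at 0) (@Qsf_var I)) k) /\
    evolve (@mutate_y I (Qsf I)) mut_at (YSeed (B_at 0) (@Qsf_var I)) (k + 1)
    = c k (evolve (@mutate_y I (Qsf I)) mut_at (YSeed (B_at 0) (@Qsf_var I)) k).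
  apply: evolveP => {k} [//|k [ys z]|k [ys z]]; rewrite /V /= => ->.
    rewrite mutate_seq_y ?enum_uniq ?set_enum //; last exact: B_at_independent.
    by rewrite /c /= B_atS.
  rewrite mutate_seq_y ?rev_uniq ?enum_uniq ?set_rev_enum //;
    last exact: B_atS_independent.
  rewrite /c /= B_at_pred B_atS; split=> //; congr YSeed; apply/funext=> i.
  by rewrite -[X in muty_set _ X (muty_set _ _ _)](B_at_pred k) muty_setK.
by apply/funext=> i; rewrite /y /coef_y e /= ye.
Qed.

(** A Y-variable is read off at the moment of mutation, waiting time 0, instead of half a period
    earlier; the wrong parity again borrows the value at the next time. *)
Definition Y_value (a : 'I_r) (m : nat) (k : int) : Qsf I :=
  if vertex_at a m 0 k is Some i then y k i
  else if vertex_at a m 0 (k + 1) is Some i then y (k + 1) i else 1%g.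

Lemma Y_valueE k i : wait k i = 0 -> Y_value (pa i) (pm i) k = y k i.
Proof. by move=> i0; have := vertex_atE k i; rewrite /Y_value i0 => ->. Qed.

Lemma Y_value_out a m k : ~~ in_range d ell a m -> Y_value a m k = 1%g.
Proof. by move=> nr; rewrite /Y_value !vertex_at_out. Qed.

Lemma Y_value_shift a m k : ~~ Qplus' d Ip a m k -> Y_value a m k = Y_value a m (k + 1).
Proof.
move=> nQ; rewrite /Y_value vertex_at_none ?addr0 //.
case: (vertex_at a m 0 (k + 1)) => [//|].
rewrite vertex_at_none // addr0.
have -> : k + 1 + 1 = k + 2 * 1 by ring.
by rewrite Qplus'_even.
Qed.

Definition Y_eval (t : Iell d ell) : Qsf I := Y_value (val t).1.1 (val t).1.2 (val t).2.

Lemma Y_eval_term a m k : seval Y_eval (Yterm d ell a m k) = Y_value a m k.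
Proof.
rewrite /Yterm; case: insubP => [t _ e|] /=; first by rewrite /Y_eval e.
by move/Y_value_out => ->.
Qed.

Lemma Yrhs_shift (P : semifieldType) (g : Iell d ell -> P) a m k :
  (forall b n k', ~~ Qplus' d Ip b n k' ->
     seval g (Yterm d ell b n k') = seval g (Yterm d ell b n (k' + 1))) ->
  (0 < m)%N -> ~~ Qplus' d Ip a m (k - (d a)%:Z) ->
  seval g (SMul (Ynum C d ell a m k) (SInv (SMul (Yden d ell a m.-1 k) (Yden d ell a m.+1 k))))
  = seval g (SMul (Ynum C d ell a m (k + 1))
      (SInv (SMul (Yden d ell a m.-1 (k + 1)) (Yden d ell a m.+1 (k + 1))))).
Proof.
move=> gS m0 nQ.
have den n : n = m.+1 \/ m = n.+1 ->
    seval g (Yden d ell a n k) = seval g (Yden d ell a n (k + 1)).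
  move=> h; rewrite /Yden; case: ifP => // _ /=; congr (sadd _ _^-1)%g; apply: gS.
  by rewrite -[k](subrK (d a)%:Z) (@Qplus'_same _ d Ip a m).
rewrite /= !den; [|by left|by right; rewrite prednK].
congr (_ * _)%g; rewrite /Ynum; case: ltnP => da; rewrite !seval_prod.
  apply: eq_bigr => b ab; rewrite /Zterm !seval_prod.
  apply: eq_big_nat => t t_lt; rewrite !seval_prod; apply: eq_big_nat => q _ /=.
  set p := (d a %/ d b)%N; set j := t%:Z - p%:Z + 1.
  have -> : k + 1 + p%:Z - `|j| + 1 - 2 * q%:Z = k + p%:Z - `|j| + 1 - 2 * q%:Z + 1 by ring.
  congr (sadd _ _); apply: gS.
  have [db|db] : d a = d b \/ d b = 1%N.
    by case: (adj_d HC HD HT ab); [left | lia | right].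
    have p1 : p = 1%N by rewrite /p db divnn dpos.
    have -> : `|(p%:Z * m%:Z + j)%R|%N = m by rewrite /j p1; rewrite -/p p1 in t_lt; lia.
    have -> : k + p%:Z - `|j| + 1 - 2 * q%:Z = k - (d a)%:Z + (d a)%:Z + 2 * (1 - q%:Z).
      by rewrite /j p1; rewrite -/p p1 in t_lt; lia.
    by rewrite Qplus'_even (Qplus'_eqd HP _ _ ab db).
  have pE : p = d a by rewrite /p db divn1.
  have jp : - p%:Z < j by rewrite /j; lia.
  have pm_ge : (p <= p * m)%N by rewrite leq_pmulr.
  have nE : (`|(p%:Z * m%:Z + j)%R|%N)%:Z = (p * m)%N%:Z + j.
    by rewrite -PoszM; move: (p * m)%N pm_ge jp => z; lia.
  have := Qplus'_eq_edge HP m `|(p%:Z * m%:Z + j)%R|%N (k - (d a)%:Z)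
    (k + p%:Z - `|j| + 1 - 2 * q%:Z) ab db.
  rewrite (negbTE nQ) eq_sym eqbF_neg => ->; rewrite nE pE.
  by clearbody j; move: (d a * m)%N (d a) => z p'; clear; lia.
apply: eq_bigr => b /andP [ab dm] /=; congr (sadd _ _); apply: gS.
have {}da : d a = 1%N by move: (dpos a); lia.
have ba := ab; rewrite adj_sym // in ba.
have := Qplus'_eq_edge HP (m %/ d b) m k (k - (d a)%:Z) ba da.
rewrite (negbTE nQ) eqbF_neg => ->.
by rewrite [(d b * _)%N]mulnC divnK // da; lia.
Qed.

Lemma Y_eval_rel s t : Yrel C s t -> seval Y_eval s = seval Y_eval t.
Proof.
case=> a m k rg; have d0 := dpos a.
have main k' : Qplus' d Ip a m (k' - (d a)%:Z) ->
    (Y_value a m (k' - (d a)%:Z) * Y_value a m (k' + (d a)%:Z))%g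
    = seval Y_eval (SMul (Ynum C d ell a m k')
        (SInv (SMul (Yden d ell a m.-1 k') (Yden d ell a m.+1 k')))).
  move=> Q.
  have [i [ia im i0]] : exists i, [/\ pa i = a, pm i = m & wait (k' - (d a)%:Z) i = 0].
    by apply: vertex_at_some; rewrite ?addr0 //; lia.
  (* The relation at [k'] lies half a period after the mutation at [k' - d a], where [prod_y_factor]
     starts. *)
  have e : k' = k' - (d (pa i))%:Z + (d (pa i))%:Z by ring.
  rewrite -ia -im [in RHS]e -prod_y_factor; last by rewrite ia.
  rewrite Y_valueE ?ia //.
  have -> : k' + (d a)%:Z = k' - (d a)%:Z + (2 * d (pa i))%:Z by rewrite ia; lia.
  have e1 : wait (k' - (d a)%:Z + (2 * d (pa i))%:Z) i = 0.
    by rewrite (wait_shift i0) ?subrr //; rewrite ia; lia.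
  rewrite -ia Y_valueE; last by rewrite -ia in e1.
  rewrite (evolution_period coef_y_step); last by rewrite ia.
  apply: eq_bigr => e' _; apply: eq_bigr => j; rewrite inE => /eqP j0.
  by rewrite Y_eval_term Y_valueE.
rewrite [LHS]/= !Y_eval_term.
have [Q|nQ] := boolP (Qplus' d Ip a m (k - (d a)%:Z)); first exact: main.
have Q2 : ~~ Qplus' d Ip a m (k + (d a)%:Z).
  have -> : k + (d a)%:Z = k - (d a)%:Z + 2 * (d a)%:Z by ring.
  by rewrite Qplus'_even.
rewrite (@Y_value_shift a m (k - (d a)%:Z)) // (@Y_value_shift a m (k + (d a)%:Z)) //.
rewrite (@Yrhs_shift _ Y_eval); first last.
- exact: nQ.
- by case/andP: rg.
- by move=> b n k' nQ'; rewrite !Y_eval_term; exact: Y_value_shift.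
have sw : k + 1 - (d a)%:Z = k - (d a)%:Z + 1 by ring.
rewrite -main sw ?Qplus'S //; congr (_ * Y_value _ _ _)%g; ring.
Qed.

Let yv (b : 'I_r) n k : Ysemifield C d ell := Yvar C d ell b n k.

Let gen t : Ysemifield C d ell := ps_class (Yrel C (ell := ell)) (SGen t).

Let gen_yv b n k : seval gen (Yterm d ell b n k) = yv b n k.
Proof. by rewrite /yv /Yvar ps_class_seval. Qed.

Let mutated_yv (k : int) (j : I) := yv (pa j) (pm j) k.

(* The y-variables of the Y-semifield at all times: y_i is multiplied by the
   contributions of the mutated vertices until it becomes a generator at the next
   mutation at i. *)
Let yh (k : int) (i : I) : Ysemifield C d ell :=
  (yv (pa i) (pm i) (k + wait k i)
   / \big[*%g/1%g]_(0 <= e < `|wait k i|%N) contribution mutated_yv (k + e%:Z) i)%g.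

Lemma yv_period k i : wait k i = 0 ->
  (yv (pa i) (pm i) k * yv (pa i) (pm i) (k + (2 * d (pa i))%:Z))%g
  = \big[*%g/1%g]_(1 <= e < 2 * d (pa i)) contribution mutated_yv (k + e%:Z) i.
Proof.
move=> i0.
transitivity (\big[*%g/1%g]_(1 <= e < 2 * d (pa i))
    \big[*%g/1%g]_(j in mut_at (k + e%:Z)) y_factor (B_at (k + e%:Z) j i)
       (seval gen (Yterm d ell (pa j) (pm j) (k + e%:Z)))); last first.
  by apply: eq_bigr => e _; apply: eq_bigr => j _; rewrite gen_yv.
rewrite prod_y_factor // -ps_class_seval.
have -> : k + (2 * d (pa i))%:Z = k + (d (pa i))%:Z + (d (pa i))%:Z by lia.
rewrite -{1}[k](addrK (d (pa i))%:Z) /yv /Yvar -[LHS]/(ps_mul _ _) ps_mulE.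
apply/ps_classP/scong_rel/Yrel_sys; exact: (coord_range co).
Qed.

Lemma yh_mutated k i : wait k i = 0 -> yh k i = yv (pa i) (pm i) k.
Proof. by move=> i0; rewrite /yh i0 addr0 big_geq // invg1 mulg1. Qed.

(** At a mutated vertex this is the Y-relation, in the form [yv_period]; elsewhere the waiting time
    drops by one and the product in [yh] loses its first factor. *)
Lemma yh_step k : yh (k + 1) = muty_set (mut_at k) (B_at k) (yh k).
Proof.
apply/funext=> i; rewrite /muty_set inE; have d0 := dpos (pa i).
have [i0|iw] := eqVneq (wait k i) 0.
  rewrite [yh k i]yh_mutated // /yh waitS i0 eqxx.
  have -> : k + 1 + ((2 * d (pa i))%:Z - 1) = k + (2 * d (pa i))%:Z by ring.
  have -> : `|((2 * d (pa i))%:Z - 1)%R|%N = (2 * d (pa i)).-1 by lia.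
  have := yv_period i0; rewrite big_add1 => e.
  apply: (mulgI (yv (pa i) (pm i) k)); rewrite mulgV mulgA e.
  rewrite (eq_bigr (fun n => contribution mutated_yv (k + 1 + n%:Z) i)) ?mulgV //.
  by move=> n _; congr (contribution _ _ _); lia.
have wg := wait_ge0 k i.
have -> : \big[*%g/1%g]_(j in mut_at k) y_factor (B_at k j i) (yh k j)
    = contribution mutated_yv k i.
  by apply: eq_bigr => j; rewrite inE => /eqP j0; rewrite yh_mutated.
rewrite /yh waitS (negbTE iw).
have -> : k + 1 + (wait k i - 1) = k + wait k i by ring.
have -> : `|wait k i|%N = `|(wait k i - 1)%R|%N.+1 by lia.
rewrite [in RHS]big_nat_recl // addr0 invgM -!mulgA; congr (_ * _)%g.
rewrite mulVg mulg1; congr (_^-1)%g; apply: eq_bigr => e _.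
by congr (contribution _ _ _); lia.
Qed.

Theorem Y_isomorphism :
  exists g : {multiplicative Ycirc_plus C d ell Ip -> G_Y (B_at 0) mut_at}, bijective g.
Proof.
have [f fh fE] := psemifield_lift Y_eval_rel.
have [th thh thE] := Qsf_lift (yh 0).
have fyv k i : wait k i = 0 -> f (yv (pa i) (pm i) k) = y k i.
  by move=> i0; rewrite fE Y_eval_term Y_valueE.
(* Composite mutations commute with semifield morphisms and [yh] obeys the same ones as [y];
   agreement at time 0 spreads forwards, and backwards because each step can be undone. *)
have th_y k : th \o y k = yh k.
  have up n : th \o y n = yh n -> th \o y (n + 1) = yh (n + 1).
    move=> IH; rewrite coef_y_step yh_step -IH; apply/funext=> i.
    exact: muty_set_hom.
  have down n : th \o y (n + 1) = yh (n + 1) -> th \o y n = yh n.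
    move=> IH; rewrite (evolution_back coef_y_step) (evolution_back yh_step) -IH.
    by apply/funext=> i; exact: muty_set_hom.
  have base : th \o y 0 = yh 0 by apply/funext=> i; rewrite /= -thE.
  case: k => n; first by elim: n => // n /up; rewrite -PoszD addn1.
  rewrite NegzE; elim: n => [|n IH]; first by apply: down; rewrite addNr.
  by apply: down; have -> : - n.+2%:Z + 1 = - n.+1%:Z by lia.
have vertex a m k : in_range d ell a m -> Qplus' d Ip a m k ->
    exists i, [/\ pa i = a, pm i = m & wait k i = 0].
  by move=> rg Q; apply: vertex_at_some; rewrite ?addr0 //; move: (dpos a); lia.
pose G (z : Ysemifield C d ell) := exists a m k,
  [/\ in_range d ell a m, Qplus' d Ip a m k & z = yv a m k \/ z = sadd 1%g (yv a m k)].
pose inf z := exists2 t, subgroup_gen G t & f t = z.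
have infM z w : inf z -> inf w -> inf (z * w)%g.
  move=> [t tG <-] [s sG <-]; exists (t * s)%g; first exact: subgroup_genM.
  exact: sfhomM.
have infV z : inf z -> inf (z^-1)%g.
  move=> [t tG <-]; exists (t^-1)%g; first exact: subgroup_genV.
  exact: sfhomV.
have inf1 : inf 1%g by exists 1%g; [exact: subgroup_gen1 | exact: sfhom1].
have infX z n : inf z -> inf (z ^+ n)%g.
  by move=> zi; elim: n => // n IH; rewrite expgS; exact: infM.
have inf_mut k i : wait k i = 0 -> inf (y k i) /\ inf (sadd 1%g (y k i)).
  move=> i0; have Q : Qplus' d Ip (pa i) (pm i) k by rewrite -[k]addr0 -i0 wait_parity.
  have gG z : z = yv (pa i) (pm i) k \/ z = sadd 1%g (yv (pa i) (pm i) k) -> G z.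
    by move=> h; exists (pa i), (pm i), k; split=> //; exact: (coord_range co).
  split.
    by exists (yv (pa i) (pm i) k); [apply/subgroup_gen_in/gG; left | exact: fyv].
  exists (sadd 1%g (yv (pa i) (pm i) k)); first by apply/subgroup_gen_in/gG; right.
  by rewrite (sfhomD fh) (sfhom1 fh) fyv.
(* Going back from the next mutation of [i], each step divides by factors of vertices mutated at
   that moment, whose [y] and 1 + [y] are already in the image. *)
have inf_y k i : inf (y k i).
  have [n] := ubnP `|wait k i|%N; elim: n k => // n IH k; rewrite ltnS => w_le.
  have [i0|iw] := eqVneq (wait k i) 0; first by case: (inf_mut _ _ i0).
  have -> : y k i = (y (k + 1) i / contribution y k i)%g.
    by rewrite (evolution_unmutated coef_y_step iw) mulgK.
  apply: (infM); last apply: (infV).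
    by apply: IH; rewrite waitS (negbTE iw); have := wait_ge0 k i; lia.
  rewrite /contribution; apply: (big_ind inf) => [//||j]; first exact: infM.
  rewrite inE => /eqP /inf_mut [yj ysj].
  by rewrite /y_factor; case: ifP => _; apply: (infX) => //; apply: (infM) => //; exact: infV.
apply: (@gen_subgroup_iso _ _ G _ f th).
- exact: sfhomM.
- exact: sfhomV.
- exact: sfhom1.
- exact: sfhomM.
- exact: sfhomV.
- exact: sfhom1.
- move=> z [a [m [k [rg Q zE]]]]; have [i [ia im i0]] := vertex _ _ _ rg Q.
  rewrite -ia -im in zE; apply: subgroup_gen_in; exists i, k.
  case: zE => ->; [left | right]; first exact: fyv.
  split; first by left; rewrite inE i0.
  by rewrite (sfhomD fh) (sfhom1 fh) fyv.
- move=> z [i [k [->|[ik ->]]]]; first exact: inf_y.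
  case: ik; rewrite inE => /eqP i0; first by case: (inf_mut _ _ i0).
  have [yi ysi] := inf_mut _ _ i0.
  (* Just after its mutation [y] is the inverse of its former value, and 1 + y^{-1} = (1 + y)/y. *)
  have := evolution_mutated coef_y_step i0; rewrite subrK => e; rewrite -/(y k i) e.
  have -> : sadd 1%g ((y (k - 1) i)^-1)%g = (sadd 1 (y (k - 1) i) / y (k - 1) i)%g.
    by rewrite smulC smulDr mulg1 mulVg saddC.
  by apply: (infM) => //; exact: infV.
move=> z [a [m [k [rg Q zE]]]]; have [i [ia im i0]] := vertex _ _ _ rg Q.
have thyv : th (f (yv a m k)) = yv a m k.
  by rewrite -ia -im fyv // -[th _]/((th \o y k) i) th_y yh_mutated.
by case: zE => -> //; rewrite (sfhomD fh) (sfhom1 fh) (sfhomD thh) (sfhom1 thh) thyv.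
Qed.

End YIsomorphism.

End Coordinates.

(** * The mutation times of the vertices of the quiver *)

(** For odd [D] the times [i - 1] of odd [i] are even and the times [D - i] of even [i] are odd;
    together they run once through 0, ..., D - 1. The summand [D] belongs to the sign -. *)
Lemma odd_index_at (D p : nat) : odd D -> (p < 2 * D)%N ->
  exists i, [/\ (0 < i <= D)%N, odd i = odd p (+) (p < D)%N &
    ((if odd i then i.-1 else D - i) + (if p < D then 0 else D) = p)%N].
Proof.
move=> oD p_lt; case: (ltnP p D) => pD; case op: (odd p).
- have oi : odd (D - p) = false by rewrite oddB ?oD ?op // ltnW.
  exists (D - p)%N; rewrite oi; split=> //; first by rewrite subn_gt0 pD leq_subr.
  by rewrite subKn ?addn0 // ltnW.
- by exists p.+1; rewrite /= op addn0.
- have oi : odd (p.+1 - D) by rewrite oddB ?leqW //= oD op.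
  exists (p.+1 - D)%N; rewrite oi; split=> //.
    by rewrite subn_gt0 ltnS pD leq_subLR addnn -mul2n.
  by rewrite subSn //= subnK.
have oi : odd (2 * D - p) = false by rewrite oddB ?oddM ?op // ltnW.
exists (2 * D - p)%N; rewrite oi; split=> //.
  by rewrite subn_gt0 p_lt leq_subLR mul2n -addnn leq_add2r.
by move: p_lt pD; clear; lia.
Qed.

(** For even [D] all these times are even and each occurs twice, for an odd index here and for an
    even one in [even_index_at']. The bound is the one for columns of a doubled block. *)
Lemma even_index_at (D p : nat) : ~~ odd D -> ~~ odd p -> (p < 2 * D)%N ->
  exists i, [/\ (0 < i <= D.-1)%N, odd i &
    (i.-1 + (if p < D then 0 else D) = p)%N].
Proof.
move=> oD op p_lt; case: (ltnP p D) => pD.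
  exists p.+1; rewrite /= op addn0; split=> //.
  move: pD oD; case: (D) => // n; rewrite ltnS leq_eqVlt => /orP [/eqP <-|//].
  by rewrite /= op.
exists (p.+1 - D)%N; rewrite oddB ?leqW //= op (negbTE oD); split=> //.
  rewrite subn_gt0 ltnS pD /=; move: (p_lt); rewrite mul2n -addnn.
  have : p.+1 != (D + D)%N by apply/eqP => /(congr1 odd); rewrite oddD addbb /= op.
  by move: pD; clear; lia.
by rewrite subSn //= subnK.
Qed.

Lemma even_index_at' (D p : nat) : ~~ odd D -> ~~ odd p -> (p < 2 * D)%N ->
  exists i, [/\ (0 < i <= D)%N, odd i = false &
    (D - i + (if p < D then 0 else D) = p)%N].
Proof.
move=> oD op p_lt; case: (ltnP p D) => pD.
  exists (D - p)%N; rewrite oddB ?(ltnW pD) // (negbTE op) (negbTE oD) subn_gt0 pD leq_subr.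
  by rewrite subKn ?addn0 // ltnW.
exists (2 * D - p)%N; rewrite oddB ?(ltnW p_lt) // oddM (negbTE op); split=> //.
  by rewrite subn_gt0 p_lt leq_subLR mul2n -addnn leq_add2r.
by move: p_lt pD; clear; lia.
Qed.

Section ColumnTime.
Variables (D i : nat).
Hypothesis i_le : (0 < i <= D)%N.

Let T := (if odd i then i.-1 else D - i)%N.

Lemma odd_timeE q : odd D -> (q < D)%N ->
  (T == q) = (i == if odd q then D - q else q.+1)%N.
Proof.
case/andP: i_le => i0 iD oD qD; rewrite /T; case oq: (odd q); case oi: (odd i).
- transitivity false; last apply/esym; apply/eqP.
    by move=> e; move: oi; rewrite -(prednK i0) /= e oq.
  by move=> e; move: oi; rewrite e oddB ?oD ?oq // ltnW.
- by apply/eqP/eqP => [<-|->]; rewrite subKn // ltnW.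
- by apply/eqP/eqP => [<-|->//]; rewrite prednK.
transitivity false; last apply/esym; apply/eqP.
  by move=> e; move: oq; rewrite -e oddB // oD oi.
by move=> e; move: oi; rewrite e /= oq.
Qed.

Lemma even_timeE q : ~~ odd D -> (q < D)%N ->
  (T == q) = ~~ odd q && ((i == q.+1) || (i == D - q)%N).
Proof.
case/andP: i_le => i0 iD /negbTE oD qD; rewrite /T; case oi: (odd i).
  have -> : (i.-1 == q) = (i == q.+1) by apply/eqP/eqP => [<-|->//]; rewrite prednK.
  case: eqP => [e|_] /=; first by rewrite e /= in oi; rewrite oi.
  case oq: (odd q) => //=; apply/esym/eqP => e.
  by move: oi; rewrite e oddB ?oD ?oq // ltnW.
have -> : (D - i == q)%N = (i == D - q)%N.
  by apply/eqP/eqP => [<-|->]; rewrite subKn // ltnW.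
case: (i =P (D - q)%N) => [e|_]; rewrite ?orbT ?andbT ?orbF.
  by move: oi; rewrite e oddB ?(ltnW qD) // oD => /= ->.
by apply/esym/negP => /andP [/negbTE oq /eqP e]; move: oi; rewrite e /= oq.
Qed.

End ColumnTime.

Lemma odd_time_inj (D i j : nat) : (0 < i <= D)%N -> (0 < j <= D)%N -> odd D ->
  (if odd i then i.-1 else D - i)%N = (if odd j then j.-1 else D - j)%N -> i = j.
Proof.
move=> hi hj oD e; have q_lt : ((if odd j then j.-1 else D - j) < D)%N.
  by case/andP: hj; case: j {e} => // j _ jD; case: ifP => _; rewrite ?ltn_subrL (leq_ltn_trans _ jD).
have := odd_timeE hi oD q_lt; rewrite e eqxx => /esym/eqP ->.
by have := odd_timeE hj oD q_lt; rewrite eqxx => /esym/eqP <-.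
Qed.

Lemma sign_timeE (T D P : nat) (s : bool) : (T < D)%N ->
  (T + (if s then 0 else D) == P)%N
  = if (P < D)%N then s && (T == P) else ~~ s && (T == P - D)%N.
Proof.
move=> TD; case: ltnP => PD; case: s; rewrite /= ?addn0 //.
- by apply/eqP => e; move: PD; rewrite -e ltnNge leq_addl.
- by apply/eqP => e; move: PD; rewrite -e leqNgt TD.
by rewrite -[RHS](eqn_add2r D) subnK.
Qed.

Lemma sign_time_min (T D : nat) (s : bool) : (T < D)%N ->
  Num.min ((T + (if s then 0 else D))%N%:Z)
    ((2 * D)%:Z - 1 - (T + (if s then 0 else D))%N%:Z)
  = (if s then T else D.-1 - T)%N%:Z.
Proof. by case: s; lia. Qed.

(** * Coordinates on the combinatorial quiver and comparison of its arrows *)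

Section QuiverCoordinates.
Variables (r ell : nat) (C : 'M[int]_r) (d : 'I_r -> nat) (Ip : pred 'I_r).
Variable c : J C d -> colour.
Hypotheses (HC : gen_cartan C) (HD : symmetrizer C d) (HT : tamely_laced C d).
Hypotheses (HP : parity_decomposition C d Ip) (Hc : proper_colouring c).

Let dpos := d_gt0 HD.

Lemma even_adj_sym : ssrbool.symmetric (even_adj C d).
Proof. by move=> a b; rewrite /even_adj adj_sym // andbCA andbC -andbA andbCA andbA. Qed.

Lemma even_block_even a b : ~~ odd (d a) -> b \in even_block C d a -> ~~ odd (d b).
Proof.
move=> da; rewrite inE => /connectP [p + ->].
elim: p a da => //= e p IH a da /andP [/and3P [_ _ de]]; exact: IH.
Qed.

Lemma even_block_eq a b : b \in even_block C d a -> even_block C d b = even_block C d a.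
Proof.
move=> ab; apply/setP => e; rewrite !inE; rewrite inE in ab.
apply/idP/idP; first exact: connect_trans.
by apply: connect_trans; rewrite sym_connect_sym //; exact: even_adj_sym.
Qed.

Lemma even_block_adj a b : adj C a b -> ~~ odd (d a) -> ~~ odd (d b) ->
  b \in even_block C d a.
Proof. by move=> ab da db; rewrite inE connect1 // /even_adj ab da db. Qed.

Lemma nonbip_block a b : ~~ odd (d a) -> b \in even_block C d a ->
  nonbip C d b = nonbip C d a.
Proof.
by move=> da ab; rewrite /nonbip (even_block_even da ab) da (even_block_eq ab).
Qed.

Lemma colour_cases (x y z : colour) : x <> y -> x <> z -> y = z.
Proof. by case: x y z => [] [] []. Qed.

Lemma J_val_inj (v w : J C d) : base v = base w -> eps v = eps w -> v = w.
Proof. by move=> b e; apply: val_inj; exact: injective_projections. Qed.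

Lemma double_exists b e : nonbip C d b -> exists w : J C d, base w = b /\ eps w = e.
Proof.
move=> nb; have h : ~~ (b, e).2 ==> nonbip C d (b, e).1 by rewrite nb implybT.
by exists (exist _ (b, e) h).
Qed.

(* If some a_+ and a_- had the same colour, so would all pairs in the block, and
   the block would be bipartite. *)
Lemma double_colour (v w : J C d) :
  doubled v -> base v = base w -> eps v <> eps w -> c v <> c w.
Proof.
move=> dv bvw evw cvw; set a := base v in dv bvw.
have da : ~~ odd (d a) by case/andP: dv.
have lift b e : b \in even_block C d a -> exists w' : J C d, base w' = b /\ eps w' = e.
  by move=> ba; apply: double_exists; rewrite (nonbip_block da ba).
have adjJP (v1 v2 : J C d) : base v1 \in even_block C d a -> base v2 \in even_block C d a ->
    adj C (base v1) (base v2) -> eps v1 <> eps v2 -> c v1 <> c v2.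
  move=> b1 b2 a12 e12; apply: Hc.
  - exact: even_block_even da b1.
  - exact: even_block_even da b2.
  by rewrite /adjJ a12; apply/implyP => _; apply/eqP.
(* Holds at [a] by assumption and passes along edges: a lift of the next vertex is adjacent to the
   lift of [b] of opposite sign, so it has the other one of two colours. *)
pose S b := forall v1 v2 : J C d, base v1 = b -> base v2 = b -> c v1 = c v2.
have Sa : S a.
  have one (u : J C d) : base u = a -> c u = c v.
    move=> ua; have [e|e] := eqVneq (eps u) (eps v); first by rewrite (J_val_inj ua e).
    rewrite cvw; congr c; apply: J_val_inj; first by rewrite ua.
    by move: e evw; case: (eps u) (eps v) (eps w) => [] [] [] //= _ h; case: h.
  by move=> v1 v2 h1 h2; rewrite !one.
have walkS p b : b \in even_block C d a -> S b -> path (even_adj C d) b p -> S (last b p).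
  elim: p b => //= e p IH b ba Sb /andP [/and3P [be db de]].
  have ea : e \in even_block C d a by rewrite -(even_block_eq ba) even_block_adj.
  apply: IH => // v1 v2 v1e v2e.
  have [w1 [w1b w1e]] := lift _ (~~ eps v1) ba.
  have [w2 [w2b w2e]] := lift _ (~~ eps v2) ba.
  apply: (@colour_cases (c w1)).
    by apply: adjJP; rewrite ?w1b ?v1e // w1e; case: (eps v1).
  rewrite (Sb w1 w2) //.
  by apply: adjJP; rewrite ?w2b ?v2e // w2e; case: (eps v2).
have same b : b \in even_block C d a -> S b.
  by rewrite inE => /connectP [p ap ->]; apply: walkS => //; rewrite inE.
case/andP: dv => _ /negP; apply; apply/asboolP => s /andP [cyc _].
pose col b : bool := `[< exists2 u : J C d, base u = b & c u = alpha >].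
have colE b (u : J C d) : b \in even_block C d a -> base u = b ->
    col b = if c u is alpha then true else false.
  move=> ba ub; apply/asboolP/idP => [[u' u'b cu']|]; last by case E: (c u) => // _; exists u.
  by rewrite (same b ba u u') // cu'.
have flip b b' : b \in even_block C d a -> b' \in even_block C d a -> adj C b b' ->
    col b' = ~~ col b.
  move=> ba b'a bb'; have [u [ub ue]] := lift _ true ba.
  have [u' [u'b u'e]] := lift _ false b'a.
  have : c u <> c u' by apply: adjJP; rewrite ?ub ?u'b // ue u'e.
  by rewrite (colE b u) // (colE b' u') //; case: (c u) (c u') => [] [].
have walk x p : path (fun x y => [&& x \in even_block C d a, y \in even_block C d a
    & adj C x y]) x p -> col (last x p) = odd (size p) (+) col x.
  elim: p x => [|y p IH] x /=; first by case: (col x).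
  case/andP=> /and3P [xa ya xy] /IH ->; rewrite (flip x y) //.
  by case: (odd _) (col x) => [] [].
case: s cyc => // x p /= /walk; rewrite last_rcons size_rcons /=.
by case: (odd (size p)) (col x) => [] [].
Qed.

Implicit Types (x y : QI C d ell) (v w : J C d).

(** The case distinction of [Mv] for the sign +, solved for the time. The extra unit is the delay of
    [J_-] for even [d]; in [first_time] vertices of sign - follow half a period later. *)
Definition column_time (x : QI C d ell) : nat :=
  ((if odd (qi x) then (qi x).-1 else dJ (qv x) - qi x)
   + (~~ odd (dJ (qv x)) && ~~ inJp Ip (qv x)))%N.

Definition first_time (x : QI C d ell) : int :=
  (column_time x + (if sgn Ip c x then 0 else dJ (qv x)))%N.

Definition quiver_base (x : QI C d ell) : 'I_r := base (qv x).

Lemma QI_inN x : inN (qv x) (qi x).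
Proof. by case/andP: (valP x). Qed.

Lemma QI_range x : in_range d ell (quiver_base x) (qm x).
Proof. by case/andP: (valP x). Qed.

Lemma QI_index x : (0 < qi x <= dJ (qv x))%N.
Proof.
have := QI_inN x; rewrite /inN; case: ifP => // _; have := dpos (base (qv x)).
by rewrite -/(dJ _); case: (qi x) => //= i; lia.
Qed.

Lemma doubled_even (v : J C d) : doubled v -> ~~ odd (dJ v).
Proof. by case/andP. Qed.

Lemma doubled_index x : doubled (qv x) -> odd (qi x).
Proof. by have := QI_inN x; rewrite /inN => + dx; rewrite dx => /andP []. Qed.

Lemma eps_true (v : J C d) : ~~ doubled v -> eps v.
Proof. by have := valP v; rewrite /doubled /eps; case: (val v).2 => //= ->. Qed.

Lemma column_time_lt x : (column_time x < dJ (qv x))%N.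
Proof.
have := QI_index x; rewrite /column_time.
case: (boolP (odd (dJ (qv x)))) => /= o; case: (boolP (odd (qi x))) => /= oi.
- by lia.
- by lia.
- by case: (inJp _ _) => /=; lia.
- by case: (inJp _ _) => /=; lia.
Qed.

Lemma first_time_lt x : 0 <= first_time x < (2 * dJ (qv x))%:Z.
Proof.
by rewrite /first_time; have := column_time_lt x; case: (sgn _ _ _); lia.
Qed.

Lemma first_time_parity x : Qplus' d Ip (quiver_base x) (qm x) (first_time x).
Proof.
have := QI_index x; rewrite /Qplus' /Qplus /first_time /column_time /sgn.
rewrite -/(dJ (qv x)) /inJp -/(quiver_base x).
case: (boolP (odd (dJ (qv x)))) => /= o.
  by case: (Ip (quiver_base x)); case: (boolP (odd (qi x))) => oi /=; case: ifP => s; lia.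
by case: (Ip (quiver_base x)); case: (boolP (odd (qi x))) => oi /=; case: ifP => s; lia.
Qed.

Definition colour_bit (v : J C d) : bool := if c v is beta then true else false.

Lemma sgn_even x : ~~ odd (dJ (qv x)) ->
  sgn Ip c x = (colour_bit (qv x) != odd (qi x + qm x)).
Proof.
rewrite /sgn /colour_bit => /negbTE ->.
by case: (c _); case: (odd _).
Qed.

Lemma colour_bitP v w : c v <> c w -> colour_bit w = ~~ colour_bit v.
Proof. by rewrite /colour_bit; case: (c v) (c w) => [] []. Qed.

(** For even [d] two columns can share their time: an odd and an even index, or the two copies in a
    doubled block. The sign, which depends on the parity of [i + m] and on the colour, separates
    them, for the copies by [double_colour]. *)
Lemma same_column x y : quiver_base x = quiver_base y ->
  column_time x = column_time y ->
  (sgn Ip c x == sgn Ip c y) = ~~ odd (qm x + qm y) ->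
  qv x = qv y /\ qi x = qi y.
Proof.
move=> bxy; have dxy : dJ (qv y) = dJ (qv x) by rewrite /dJ -/(quiver_base y) -bxy.
have Ixy : inJp Ip (qv y) = inJp Ip (qv x) by rewrite /inJp -/(quiver_base y) -bxy.
have dbl : doubled (qv y) = doubled (qv x) by rewrite /doubled -/(quiver_base y) -bxy.
have ix := QI_index x; have iy := QI_index y; rewrite dxy in iy.
rewrite /column_time dxy Ixy.
case: (boolP (odd (dJ (qv x)))) => o /=.
  have nd : ~~ doubled (qv x) by apply/negP => /doubled_even; rewrite o.
  rewrite !addn0 => t _; split; last exact: odd_time_inj t.
  by apply: J_val_inj => //; rewrite !eps_true // dbl.
move=> t; rewrite !sgn_even ?dxy //; case: (boolP (doubled (qv x))) => dx.
  have ox := doubled_index dx; have oy := @doubled_index y; rewrite dbl in oy.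
  have {}oy := oy dx; rewrite ox oy in t => s.
  have ixy : qi x = qi y by clear -t ix iy; lia.
  split=> //; apply: J_val_inj => //; apply/eqP; apply: contraTT isT => /eqP e.
  have cb := colour_bitP (double_colour dx bxy e); move: s; rewrite cb ixy !oddD.
  by case: (colour_bit _); case: (odd (qi y)); case: (odd (qm x)); case: (odd (qm y)).
have vxy : qv x = qv y by apply: J_val_inj => //; rewrite !eps_true // dbl.
rewrite -vxy !oddD => s; split=> //.
have oi : odd (qi x) = odd (qi y).
  move: s; clear; case: (colour_bit _); case: (odd (qi x)); case: (odd (qi y));
    by case: (odd (qm x)); case: (odd (qm y)).
by move: t; rewrite oi; clear -ix iy; case: ifP => ?; lia.
Qed.

Lemma QI_ext x y : qv x = qv y -> qi x = qi y -> qm x = qm y -> x = y.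
Proof.
rewrite /qv /qi /qm => ev ei em; apply/val_inj.
case: (val x) (val y) ev ei em => [[v i] m] [[w j] n] /= -> ei em.
by rewrite (ord_inj ei) (ord_inj em).
Qed.

Lemma lcmd_gt0 : (0 < lcmd d)%N.
Proof.
by rewrite /lcmd; elim/big_ind: _ => // m n m0 n0; rewrite lcmn_gt0 m0.
Qed.

Lemma QI_exists v i m : inN v i -> in_range d ell (base v) m ->
  exists x, [/\ qv x = v, qi x = i & qm x = m].
Proof.
move=> vi rg; have dl : (dJ v <= lcmd d)%N.
  by rewrite dvdn_leq ?lcmd_gt0 // /dJ -(codeg_mul d (base v)) dvdn_mulr.
have i_lt : (i < (lcmd d).+1)%N.
  rewrite ltnS; apply: leq_trans dl; move: vi; rewrite /inN.
  by case: ifP => _ /andP [_] // h; apply: leq_trans h (leq_pred _).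
have m_lt : (m < (lcmd d * ell).+1)%N.
  case/andP: rg => _ m_lt; apply: ltnW; rewrite ltnS; apply: leq_trans m_lt _.
  by rewrite leq_mul2r -(codeg_mul d (base v)) leq_pmull ?orbT ?dpos.
have h : inN v (Ordinal i_lt) && (0 < Ordinal m_lt < tJ v * ell)%N by rewrite /= vi.
by exists (exist _ (v, Ordinal i_lt, Ordinal m_lt) h).
Qed.

Lemma J_exists a : exists v, base v = a /\ eps v = true.
Proof. by exists (exist _ (a, true) isT). Qed.

Lemma first_time_inj x y : quiver_base x = quiver_base y -> qm x = qm y ->
  (first_time x = first_time y %[mod (2 * d (quiver_base x))%:Z])%Z -> x = y.
Proof.
move=> bxy mxy; have dxy : dJ (qv y) = dJ (qv x) by rewrite /dJ -/(quiver_base y) -bxy.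
have hx := first_time_lt x; have hy := first_time_lt y; rewrite dxy in hy.
rewrite !modz_small // /first_time dxy => e.
have cx := column_time_lt x; have cy := column_time_lt y; rewrite dxy in cy.
have [s t] : sgn Ip c x = sgn Ip c y /\ column_time x = column_time y.
  move: e cx cy; clear; case: (sgn Ip c x); case: (sgn Ip c y); lia.
have [|ev ei] := same_column bxy t; last exact: QI_ext.
by rewrite s mxy eqxx oddD addbb.
Qed.

Lemma first_time_surj a m (p : nat) : in_range d ell a m -> Qplus' d Ip a m p%:Z ->
  (p < 2 * d a)%N -> exists x, [/\ quiver_base x = a, qm x = m & first_time x = p%:Z].
Proof.
move=> rg Q p_lt; have d0 := dpos a.
have [v [vb ve]] := J_exists a; have dv : dJ v = d a by rewrite /dJ vb.
have build w i : base w = a -> inN w i -> (forall x, qv x = w -> qi x = i -> qm x = m ->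
    first_time x = p%:Z) ->
    exists x, [/\ quiver_base x = a, qm x = m & first_time x = p%:Z].
  move=> wb wi H; have [|x [xw xi xm]] := QI_exists (m := m) wi; first by rewrite wb.
  by exists x; rewrite /quiver_base xw; split=> //; exact: H.
move: Q; rewrite /Qplus' /Qplus; case: (boolP (odd (d a))) => o Q.
  have nd : doubled v = false by apply/negbTE/negP => /doubled_even; rewrite dv o.
  have [i [i_le oi iE]] := odd_index_at o p_lt.
  apply: (build v i) => // [|x xv xi xm]; first by rewrite /inN nd dv.
  rewrite /first_time /column_time /sgn xv xi xm dv o /= /inJp vb addn0 -[in RHS]iE.
  suff -> : (odd (i + m) == ~~ Ip a) = (p < d a)%N by [].
  move: Q; rewrite !odd_abszE o oddD oi.
  by case: (p < d a)%N; case: (odd m); case: (odd p); case: (Ip a).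
have {}Q : odd p = ~~ Ip a.
  by move: Q; rewrite !odd_abszE (negbTE o) addbF => /eqP.
(* Removes the delay of [J_-]; what remains is even. *)
pose p0 := (p - ~~ Ip a)%N.
have pE : (p = p0 + ~~ Ip a)%N.
  by rewrite subnK //; move: Q; case: (Ip a) => //; case: (p).
clearbody p0; have op0 : ~~ odd p0 by move: Q; rewrite pE oddD; case: (Ip a); case: (odd p0).
have p0_lt : (p0 < 2 * d a)%N by apply: leq_ltn_trans p_lt; rewrite pE leq_addr.
pose s := (p0 < d a)%N.
have [i0 [i0_lt oi0 i0E]] := even_index_at o op0 p0_lt; rewrite -/s in i0E.
have ft x w j : qv x = w -> dJ w = d a -> sgn Ip c x = s ->
    column_time x = (j + ~~ Ip a)%N -> (j + (if s then 0 else d a))%N = p0 ->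
    first_time x = p%:Z.
  by move=> xw dw sx cx jE; rewrite /first_time xw dw sx cx pE -jE addnAC.
have pick_sign t u : u = (s != t) -> (u != t) = s by move=> ->; case: t; case: (s).
(* Only odd indices exist in a doubled block, and the sign required by [p] is achieved by choosing
   the copy of the right colour. *)
have [dv'|nd] := boolP (doubled v).
  have nb : nonbip C d a by rewrite -vb.
  have [w1 [w1b w1e]] := double_exists true nb.
  have [w2 [w2b w2e]] := double_exists false nb.
  have dw1 : doubled w1 by rewrite /doubled w1b.
  have w12 : colour_bit w2 = ~~ colour_bit w1.
    by apply/colour_bitP/double_colour; rewrite // ?w1b ?w2b // w1e w2e.
  have [w [wb wc]] : exists w, base w = a /\ colour_bit w = (s != odd (i0 + m)).
    case: (boolP (colour_bit w1 == (s != odd (i0 + m)))) => [/eqP e|]; first by exists w1.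
    by move=> ne; exists w2; rewrite w12; split=> //; move: ne; case: (colour_bit w1);
       case: (s != _).
  have dw : dJ w = d a by rewrite /dJ wb.
  have ddw : doubled w by rewrite /doubled wb.
  apply: (build w i0) => // [|x xw xi xm].
    by rewrite /inN ddw oi0 dw; case/andP: i0_lt => _ ->.
  apply: (ft x w i0.-1) => //; first by rewrite sgn_even xw ?dw // xi xm pick_sign.
  by rewrite /column_time xw xi oi0 dw o /inJp wb.
(* With a single copy, the choice between the odd and the even column of this time achieves the sign
   instead. *)
have [i1 [i1_lt oi1 i1E]] := even_index_at' o op0 p0_lt; rewrite -/s in i1E.
have [e|ne] := eqVneq (colour_bit v) (s != odd (i0 + m)).
  apply: (build v i0) => // [|x xv xi xm].
    by rewrite /inN (negbTE nd) dv; case/andP: i0_lt => -> /leq_trans -> //; exact: leq_pred.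
  apply: (ft x v i0.-1) => //; first by rewrite sgn_even xv ?dv // xi xm pick_sign.
  by rewrite /column_time xv xi oi0 dv o /inJp vb.
apply: (build v i1) => // [|x xv xi xm]; first by rewrite /inN (negbTE nd) dv.
have e : colour_bit v = (s != odd (i1 + m)).
  move: ne; rewrite !oddD oi0 oi1; case: (colour_bit v); case: (s); case: (odd m) => //.
apply: (ft x v (d a - i1)%N) => //; first by rewrite sgn_even xv ?dv // xi xm pick_sign.
by rewrite /column_time xv xi oi1 dv o /inJp vb.
Qed.

Lemma quiver_coordinates :
  coordinates d ell Ip quiver_base (@qm r C d ell) first_time.
Proof.
split; [exact: QI_range | exact: first_time_parity | exact: first_time_inj |].
move=> a m k rg Q; have d0 := dpos a.
have p_ge : 0 <= (k %% (2 * d a)%:Z)%Z by apply: modz_ge0; lia.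
have p_lt : (k %% (2 * d a)%:Z)%Z < (2 * d a)%:Z by apply: ltz_pmod; lia.
have pE : (`|(k %% (2 * d a)%:Z)%Z|%N)%:Z = (k %% (2 * d a)%:Z)%Z by rewrite gez0_abs.
have [||x [xa xm xt]] := @first_time_surj a m `|(k %% (2 * d a)%:Z)%Z|%N rg.
- by rewrite pE -(Qplus'_period _ _ _ _ _ (k %/ (2 * d a)%:Z)%Z) addrC -divz_eq.
- by lia.
by exists x; split=> //; rewrite xt pE modz_mod.
Qed.

Lemma mut_at_first k x :
  (x \in mut_at d quiver_base first_time k)
  = (first_time x == (k %% (2 * dJ (qv x))%:Z)%Z).
Proof.
rewrite inE /wait -/(dJ (qv x)) -[X in _ = (X == _)](modz_small (first_time_lt x)).
by rewrite eqz_mod_dvd; apply/eqP/dvdz_mod0P.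
Qed.

Lemma modz_pred (n : nat) (k : int) : (0 < n)%N ->
  ((k - 1) %% n%:Z)%Z
  = if (k %% n%:Z)%Z == 0 then n%:Z - 1 else (k %% n%:Z)%Z - 1.
Proof.
move=> n0; have := divz_eq k n%:Z.
have : 0 <= (k %% n%:Z)%Z by apply: modz_ge0; lia.
have : (k %% n%:Z)%Z < n%:Z by apply: ltz_pmod; lia.
move: (k %/ n%:Z)%Z (k %% n%:Z)%Z => q p p_lt p_ge ->.
case: eqP => [->|p0].
  by rewrite addr0 -{1}(subrK 1 q) mulrDl mul1r -addrA modzMDl modz_small //; lia.
by rewrite -addrA modzMDl modz_small //; lia.
Qed.

Lemma in_Mset k x :
  (x \in Mset ell Ip c k) = (x \in mut_at d quiver_base first_time k).
Proof.
have d0 := dpos (base (qv x)); rewrite -/(dJ (qv x)) in d0.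
have Mq v : x \in Mv ell Ip c v k -> v = qv x.
  have I v' s i : (x \in Ivset ell Ip c v' s i) -> v' = qv x.
    by rewrite inE => /and3P [/eqP].
  rewrite /Mv; case: ifP => _; first by case: ifP => _; case: ifP => _; exact: I.
  case: ifP => _; first by rewrite inE.
  by case: ifP => _; rewrite in_setU => /orP []; exact: I.
have -> : (x \in Mset ell Ip c k) = (x \in Mv ell Ip c (qv x) k).
  apply/bigcupP/idP => [[v _ xv]|xM]; last by exists (qv x).
  by rewrite -(Mq v xv).
rewrite mut_at_first.
have modE k' : exists2 p : nat, (k' %% (2 * dJ (qv x))%:Z)%Z = p%:Z & (p < 2 * dJ (qv x))%N.
  have := @modz_ge0 k' (2 * dJ (qv x))%:Z; have := @ltz_pmod k' (2 * dJ (qv x))%:Z.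
  move: (k' %% _)%Z => q q_lt q_ge; exists `|q|%N; move: d0 q_lt q_ge; clear; lia.
have T_lt := column_time_lt x; have ix := QI_index x.
rewrite /Mv /first_time; case: (boolP (odd (dJ (qv x)))) => o /=.
  have [p -> p_lt] := modE k; rewrite eqz_nat sign_timeE //=.
  move: T_lt; rewrite /column_time o /= addn0 => T_lt.
  case: ltnP => pd; first by rewrite odd_timeE //; case: (odd p); rewrite !inE eqxx eqb_id.
  have pd_lt : (p - dJ (qv x) < dJ (qv x))%N by rewrite ltn_subLR // addnn -mul2n.
  rewrite odd_timeE // oddB // o addbT subnBA // addnn -mul2n -subSn //.
  by case: (odd p); rewrite !inE eqxx eqbF_neg.
pose T := (if odd (qi x) then (qi x).-1 else dJ (qv x) - qi x)%N.
have T'_lt : (T < dJ (qv x))%N.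
  by apply: leq_ltn_trans T_lt; rewrite /column_time leq_addr.
have mem (p : nat) : (p < 2 * dJ (qv x))%N ->
    (x \in (if odd p then set0
            else if (p < dJ (qv x))%N
                 then Ivset ell Ip c (qv x) true p.+1 :|: Ivset ell Ip c (qv x) true (dJ (qv x) - p)
                 else Ivset ell Ip c (qv x) false (p.+1 - dJ (qv x))
                      :|: Ivset ell Ip c (qv x) false (2 * dJ (qv x) - p)))
    = (T + (if sgn Ip c x then 0 else dJ (qv x)) == p)%N.
  move=> p_lt; rewrite sign_timeE //; case: ltnP => pd.
    by rewrite even_timeE //; case: (odd p); rewrite !inE ?andbF // eqxx eqb_id /= -andb_orr.
  have pd_lt : (p - dJ (qv x) < dJ (qv x))%N by rewrite ltn_subLR // addnn -mul2n.
  rewrite even_timeE // oddB // (negbTE o) addbF subnBA // addnn -mul2n -subSn //.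
  by case: (odd p); rewrite !inE ?andbF // eqxx eqbF_neg /= -andb_orr.
rewrite /column_time (negbTE o) /= -/T.
case: (inJp Ip (qv x)) => /=.
  by have [p -> p_lt] := modE k; rewrite addn0 mem // eqz_nat.
have D2 : (0 < 2 * dJ (qv x))%N by rewrite muln_gt0.
(* For [p = 0] the residue of [k - 1] wraps around to the odd number 2d - 1, at which nothing is
   mutated; the delayed first time is never 0 either. *)
rewrite modz_pred //; have [p -> p_lt] := modE k; rewrite addn1 addSn eqz_nat.
case: p p_lt => [_|p p_lt] /=.
  rewrite (_ : (2 * dJ (qv x))%:Z - 1 = (2 * dJ (qv x)).-1%:Z); last by rewrite -subn1 subzn.
  by rewrite /= -(negbK (odd _)) -oddS prednK // oddM inE.
by rewrite subn1 /= mem // ltnW.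
Qed.

Lemma wait_first x : wait d quiver_base first_time 0 x = first_time x.
Proof. by rewrite /wait subr0 modz_small // first_time_lt. Qed.

Lemma first_time_opposite x y : dJ (qv x) = dJ (qv y) ->
  first_time y = first_time x + (dJ (qv x))%:Z ->
  [/\ sgn Ip c x, ~~ sgn Ip c y & column_time x = column_time y].
Proof.
move=> dxy; have := column_time_lt x; have := column_time_lt y.
rewrite -dxy /first_time -dxy.
by case: (sgn Ip c x); case: (sgn Ip c y) => /= hy hx e; split=> //; lia.
Qed.

Lemma arrowA1E x y :
  arrowA1 Ip c x y = step_arrow d quiver_base (@qm r C d ell) first_time 0 x y.
Proof.
rewrite /arrowA1 /step_arrow !wait_first.
apply/idP/idP => [/and5P [/eqP v /eqP i -> sx sy]|/and3P [/eqP bxy mxy /eqP e]].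
  rewrite /quiver_base v eqxx /first_time /column_time i v sx (negbTE sy) /= addn0.
  by apply/eqP; rewrite PoszD /dJ.
have dxy : dJ (qv x) = dJ (qv y) by rewrite /dJ -/(quiver_base x) bxy.
have [sx sy cxy] := first_time_opposite dxy e.
have [|-> ->] := same_column bxy cxy; last by rewrite !eqxx mxy sx sy.
by rewrite sx (negbTE sy) oddD; case/orP: mxy => /eqP -> /=; case: (odd _).
Qed.

Lemma adjJ_adj v w : adjJ v w -> adj C (base v) (base w).
Proof. by case/andP. Qed.

Lemma adjJ_odd v w : odd (dJ v) || odd (dJ w) -> adjJ v w = adj C (base v) (base w).
Proof.
rewrite /adjJ => o; case: (adj _ _ _) => //=.
apply/implyP => /andP [dv bw]; have ev := doubled_even dv.
by move: o; rewrite (negbTE ev) /= (negbTE (even_block_even ev bw)).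
Qed.

Lemma arrowA2E x y :
  arrowA2 Ip c x y = flat_arrow C d quiver_base (@qm r C d ell) first_time 0 x y.
Proof.
rewrite /arrowA2 /flat_arrow !wait_first -/(dJ (qv x)) -/(dJ (qv y)).
have shift : adj C (quiver_base x) (quiver_base y) -> dJ (qv x) = dJ (qv y) ->
    ~~ odd (dJ (qv x)) -> inJp Ip (qv x) = inJp Ip (qv y).
  move=> /HP + e o; rewrite -/(dJ (qv x)) -/(dJ (qv y)) -e (negbTE o) /=.
  by move/eqP.
apply/idP/idP => [/and5P [axy /eqP e /eqP i /eqP m /andP [sx sy]]|].
  have {}axy := adjJ_adj axy; rewrite axy e m !eqxx /= /first_time /column_time i e.
  rewrite sy (negbTE sx) addn0; case: (boolP (odd (dJ (qv y)))) => o /=.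
    by apply/eqP; rewrite PoszD.
  by rewrite shift ?e //; apply/eqP; rewrite PoszD.
case/and4P=> axy /eqP e /eqP m /eqP t.
have [|sy sx cyx] := @first_time_opposite y x (esym e); first by rewrite -e.
rewrite e m sy sx !eqxx /= !andbT.
have ix := QI_index x; have iy := QI_index y.
case: (boolP (odd (dJ (qv x)))) => o.
  rewrite adjJ_odd ?o // axy /=; move: cyx; rewrite /column_time -e o /= !addn0 in iy *.
  by move/(odd_time_inj iy ix o) ->.
have yb : quiver_base y \in even_block C d (quiver_base x).
  by apply: even_block_adj => //; rewrite -/(dJ (qv y)) -e.
have dbl : doubled (qv y) = doubled (qv x) by rewrite /doubled (nonbip_block o yb).
rewrite !sgn_even -?e // m in sx sy.
rewrite /column_time -e o shift // in cyx.
case: (boolP (doubled (qv x))) => dx.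
  have ox := doubled_index dx; have oy := @doubled_index y; rewrite dbl in oy.
  have {}oy := oy dx; rewrite ox oy in cyx.
  have ixy : qi x = qi y by clear -cyx ix iy; lia.
  rewrite ixy eqxx andbT /adjJ axy dx yb /=; apply/eqP => exy.
  (* The other copy [w] over the base of [y] would be adjacent to [x]. Its colour would differ from
     those of [x] and [y], so these would agree, against the opposite signs at equal [i] and [m]. *)
  have [w [wb we]] := double_exists (~~ eps (qv x)) (etrans dbl dx : nonbip C d (base (qv y))).
  have cyw : c (qv y) <> c w.
    by apply: double_colour; rewrite ?dbl // we exy; case: (eps _).
  have cxw : c (qv x) <> c w.
    apply: Hc => //; first by rewrite /dJ wb -/(dJ (qv y)) -e.
    by rewrite /adjJ wb axy dx yb /= we; case: (eps _).
  move: sx sy; rewrite ixy /colour_bit.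
  by case: (c (qv x)) (c (qv y)) (c w) cyw cxw => [] [] [] //=; case: (odd _).
have axy' : adjJ (qv x) (qv y) by rewrite /adjJ axy (negbTE dx).
rewrite axy' /=; have cxy : c (qv x) <> c (qv y).
  by apply: Hc => //; rewrite -e.
rewrite (colour_bitP cxy) !oddD in sx sy.
have oi : odd (qi x) = odd (qi y).
  move: sx sy; clear; case: (colour_bit _); case: (odd (qi x)); case: (odd (qi y));
    by case: (odd (qm y)).
by move: cyx; rewrite oi; clear -ix iy e; case: ifP => ?; lia.
Qed.

(** All cases of [rho] are one function of the first mutation time. Passing from [i] to its partner
    on [J_-] is the delay by one: for odd [i] the delayed time is [i] itself, the partner minus
    1. *)
Lemma rhoE x : (rho Ip c x)%:Z
  = Num.min (first_time x) ((2 * dJ (qv x))%:Z - 1 - first_time x).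
Proof.
rewrite /first_time sign_time_min ?column_time_lt //; congr Posz.
have := QI_index x; rewrite /rho /column_time /sgn /inJp.
move: (dJ (qv x)) (qi x) (qm x) (Ip _) (c _) => D i m ip cx; clear => iD.
have h1 : (D.-1 - i.-1 = D - i)%N by lia.
have h2 : (D.-1 - (D - i) = i.-1)%N by lia.
have h3 : (i.-1 + 1 = i)%N by lia.
have h4 : (D.-1 - i = D - i.+1)%N by lia.
have h5 : (D - i + 1 = D - i.-1)%N by lia.
have h6 : (D.-1 - (D - i.-1) = i.-2)%N.
  by rewrite -subn1 subnAC subKn ?subn1 // (leq_trans (leq_pred i)); case/andP: iD.
rewrite oddD; case: (odd D); case: ip; case: cx; case: (odd m); case: (odd i);
  by rewrite /= ?addn0 ?h3 ?h5 ?h1 ?h2 ?h4 ?h6.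
Qed.

Lemma joinedA3E x y :
  joinedA3 Ip c x y = joined C d quiver_base (@qm r C d ell) first_time 0 x y.
Proof.
rewrite /joinedA3 /joined !wait_first rhoE -/(dJ (qv x)) -/(dJ (qv y)).
case: (dJ (qv y) =P 1%N) => [e|_]; last by rewrite !andbF.
by rewrite adjJ_odd ?e ?orbT.
Qed.

(** For [d = 1] the column time is 0, so the sign is the initial waiting time; this turns the
    orientation rule of the laces into that of [lace_arrow]. *)
Lemma sgn_short x : dJ (qv x) = 1%N ->
  (sgn Ip c x = (first_time x == 0)) * (~~ sgn Ip c x = (first_time x == 1)).
Proof.
move=> e; have := column_time_lt x; rewrite /first_time e.
by case: (sgn _ _ _) => h /=; split; lia.
Qed.

Lemma Bmat_B_at x y :
  Bmat Ip c x y = B_at C d quiver_base (@qm r C d ell) first_time 0 x y.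
Proof.
have E (z w : QI C d ell) : arrow Ip c z w
    = arrow_at C d quiver_base (@qm r C d ell) first_time 0 z w.
  rewrite /arrow /arrow_at arrowA1E arrowA2E; congr [|| _, _ | _].
  rewrite /arrowA3 /lace_arrow !joinedA3E !wait_first; congr (_ || _).
    case: (boolP (joined _ _ _ _ _ _ z w)) => //= /and4P [_ _ /eqP e _].
    exact: (sgn_short e).1.
  case: (boolP (joined _ _ _ _ _ _ w z)) => //= /and4P [_ _ /eqP e _].
  exact: (sgn_short e).2.
by rewrite /Bmat /B_at !E.
Qed.

End QuiverCoordinates.

Theorem theorem7p1 (r ell : nat) (C : 'M[int]_r) (d : 'I_r -> nat)
    (Ip : pred 'I_r) (c : J C d -> colour) :
  gen_cartan C -> symmetrizer C d -> tamely_laced C d -> indecomposable C ->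
  bipartite_X' C d -> (2 <= ell)%N ->
  parity_decomposition C d Ip -> proper_colouring c ->
  (exists f : {rmorphism Tcirc_plus C d ell Ip ->
                         A_T (Bmat Ip c) (@Mset r C d ell Ip c)},
      bijective f)
  /\
  (exists g : {multiplicative Ycirc_plus C d ell Ip ->
                              G_Y (Bmat Ip c) (@Mset r C d ell Ip c)},
      bijective g).
Proof.
move=> HC HD HT _ _ _ HP Hc.
have co : coordinates d ell Ip (@quiver_base r ell C d) (@qm r C d ell) (first_time Ip c).
  exact: quiver_coordinates.
have eB : Bmat Ip c
    = B_at C d (@quiver_base r ell C d) (@qm r C d ell) (first_time Ip c) 0.
  by apply/funext => x; apply/funext => y; exact: Bmat_B_at.
have eM : @Mset r C d ell Ip c = mut_at d (@quiver_base r ell C d) (first_time Ip c).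
  by apply/funext => k; apply/setP => x; exact: in_Mset.
rewrite eB eM; split; [exact: T_isomorphism | exact: Y_isomorphism].
Qed.
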